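(* Let $\Omega \subset \mathbb{C}$ be a domain. Then: (a) $\mathrm{g}(\Omega) = 0$ if and only if $\mathrm{b}(\Omega) = +\infty$. (b) $\mathrm{g}(\Omega) = +\infty$ if and only if $\mathrm{b}(\Omega) = 0$. (c) If $0 < \mathrm{g}(\Omega) < +\infty$, then $\mathrm{g}(\Omega)\,\mathrm{b}(\Omega) = 1$. In particular, if $\Omega$ is hyperbolic, unbounded, and $0 \in \Omega$, then $$\mathrm{b}(\Omega) = \liminf_{R \to +\infty}\dfrac{d_{\Omega}(0,F_R)}{\log(R)},$$ where $F_R = \{w \in \Omega : |w| = R\}$ for $R > 0$.
   Context: $\mathbb{D}$ is the open unit disk and $\mathrm{Hol}(\mathbb{D},\Omega)$ is the set of holomorphic maps on $\mathbb{D}$ with values in $\Omega$. A domain is an open connected subset of $\mathbb{C}$; it is hyperbolic if $\mathbb{C}\setminus\Omega$ contains at least two points. Conventions: $\inf(\emptyset)=+\infty$, $\sup(\emptyset)=0$. Growth number: for $\alpha \ge 0$ let $v_\alpha(z) = (1-|z|)^\alpha$, $z\in\mathbb{D}$, and let $\mathrm{H}^\infty_{v_\alpha}$ be the set of holomorphic $f\colon\mathbb{D}\to\mathbb{C}$ with $\sup_{z\in\mathbb{D}}|f(z)|v_\alpha(z)<+\infty$. Then $\mathrm{g}(\Omega) = \inf\{\alpha>0 : \mathrm{Hol}(\mathbb{D},\Omega)\subset \mathrm{H}^\infty_{v_\alpha}\}$. Bergman number: for $p>0$ and $\alpha>-1$, $A^p_\alpha$ is the set of holomorphic $f$ on $\mathbb{D}$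 with $\int_{\mathbb{D}}(1-|z|^2)^\alpha|f(z)|^p\,dA(z)<+\infty$ ($A$ is area measure). For $f$ holomorphic on $\mathbb{D}$, $\mathrm{b}(f)=\sup\{\frac{p}{\alpha+2}: p>0,\ \alpha>-1,\ f\in A^p_\alpha\}$, and $\mathrm{b}(\Omega)=\inf\{\mathrm{b}(f): f\in\mathrm{Hol}(\mathbb{D},\Omega)\}$. Hyperbolic distance: for $z_1,z_2\in\mathbb{D}$, $d_{\mathbb{D}}(z_1,z_2)=\log\frac{1+\rho}{1-\rho}$ with $\rho=\left|\frac{z_1-z_2}{1-z_1\overline{z_2}}\right|$. For a hyperbolic domain $\Omega$ with holomorphic universal covering map $f_\Omega\colon\mathbb{D}\to\Omega$ and $w_1,w_2\in\Omega$, $d_\Omega(w_1,w_2)=\inf\{d_{\mathbb{D}}(a,b): a,b\in\mathbb{D},\ f_\Omega(a)=w_1,\ f_\Omega(b)=w_2\}$ (independent of the choice of $f_\Omega$). For a set $F\subset\Omega$, $d_\Omega(0,F)=\inf_{w\in F}d_\Omega(0,w)$. *)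

(* Defs.v *)
From mathcomp Require Export all_boot all_order all_algebra complex.
From mathcomp Require Export all_classical all_reals all_analysis.
Export Order.TTheory GRing.Theory Num.Theory.
Export numFieldNormedType.Exports.

Set Implicit Arguments.
Unset Strict Implicit.
Unset Printing Implicit Defensive.

Local Open Scope classical_set_scope.
Local Open Scope ring_scope.

(* The complex numbers R[i], typed as a numFieldType: the library's metric
   topology (that of the norm) and complex derivative on a numFieldType then
   apply to it, which is not so for the bare type R[i]. *)
Definition Cplx (R : realType) : numFieldType := R[i].

(* The modulus as an element of [R]; the norm [`|z|] has values in [Cplx R]. *)
Definition cabs (R : realType) (z : Cplx R) : R :=
  ComplexField.Normc.normc (z : R[i]).

Definition unit_disk (R : realType) : set (Cplx R) := [set z | cabs z < 1].

Definition domain (R : realType) (Omega : set (Cplx R)) : Prop :=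
  open Omega /\ connected Omega.

Definition hyperbolic (R : realType) (Omega : set (Cplx R)) : Prop :=
  exists a b : Cplx R, [/\ a != b, ~ Omega a & ~ Omega b].

(* [derivable f z 1] over the scalar field [Cplx R] is complex
   differentiability at [z]. *)
Definition holomorphic_on (R : realType) (U : set (Cplx R))
    (f : Cplx R -> Cplx R) : Prop := forall z, U z -> derivable f z 1.

(* Maps on the disk are represented by total functions; the values outside the
   disk are irrelevant in all that follows. *)
Definition Hol (R : realType) (Omega : set (Cplx R)) :
    set (Cplx R -> Cplx R) :=
  [set f | holomorphic_on (@unit_disk R) f /\ set_fun (@unit_disk R) Omega f].

Definition weight (R : realType) (alpha : R) (z : Cplx R) : R :=
  (1 - cabs z) `^ alpha.

Definition Hinf (R : realType) (alpha : R) : set (Cplx R -> Cplx R) :=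
  [set f | holomorphic_on (@unit_disk R) f /\
    (ereal_sup [set (cabs (f z) * weight alpha z)%:E | z in @unit_disk R]
      < +oo)%E].

Definition growth_number (R : realType) (Omega : set (Cplx R)) : \bar R :=
  ereal_inf [set alpha%:E | alpha in
    [set alpha : R | 0 < alpha /\ Hol Omega `<=` Hinf alpha]].

Definition Bergman_space (R : realType) (p alpha : R) :
    set (Cplx R -> Cplx R) :=
  [set f | holomorphic_on (@unit_disk R) f /\
    (\int[@lebesgue_measure R \x @lebesgue_measure R]_(xy in
         [set xy : R * R | @unit_disk R (xy.1 +i* xy.2)%C])
       ((1 - cabs (xy.1 +i* xy.2)%C ^+ 2) `^ alpha *
        cabs (f (xy.1 +i* xy.2)%C) `^ p)%:E < +oo)%E].

(* Supremum in [0, +oo], with the convention sup(set0) = 0; [ereal_sup set0]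
   is -oo, whereas [ereal_inf set0] is +oo already. *)
Definition esup0 (R : realType) (A : set (\bar R)) : \bar R :=
  if A == set0 then 0%E else ereal_sup A.

Definition bergman_number_fun (R : realType) (f : Cplx R -> Cplx R) : \bar R :=
  esup0 [set (pa.1 / (pa.2 + 2))%:E | pa in
    [set pa : R * R | [/\ 0 < pa.1, -1 < pa.2 & Bergman_space pa.1 pa.2 f]]].

Definition bergman_number (R : realType) (Omega : set (Cplx R)) : \bar R :=
  ereal_inf [set bergman_number_fun f | f in Hol Omega].

Definition homeo_on (R : realType) (V U : set (Cplx R))
    (f : Cplx R -> Cplx R) : Prop :=
  exists g : Cplx R -> Cplx R,
    [/\ set_fun V U f, set_fun U V g,
        {in V, cancel f g}, {in U, cancel g f} &
        {within V, continuous f} /\ {within U, continuous g}].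

Definition covering_map (R : realType) (D Omega : set (Cplx R))
    (f : Cplx R -> Cplx R) : Prop :=
  [/\ {within D, continuous f}, f @` D = Omega &
    forall w, Omega w -> exists U : set (Cplx R),
      [/\ open U, U w, U `<=` Omega &
        exists VV : set (set (Cplx R)),
          [/\ forall V, VV V -> open V,
              D `&` f @^-1` U = \bigcup_(V in VV) V,
              trivIset VV id &
              forall V, VV V -> homeo_on V U f]]].

(* The disk is simply connected, so every covering map defined on it is
   universal. *)
Definition universal_covering (R : realType) (Omega : set (Cplx R))
    (f : Cplx R -> Cplx R) : Prop :=
  Hol Omega f /\ covering_map (@unit_disk R) Omega f.

Definition dist_disk (R : realType) (z1 z2 : Cplx R) : R :=
  let rho := cabs ((z1 - z2) / (1 - z1 * conjc z2)) in
  ln ((1 + rho) / (1 - rho)).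

(* [f] is a universal covering map of the domain under consideration. *)
Definition dist_cover (R : realType) (f : Cplx R -> Cplx R) (w1 w2 : Cplx R) :
    \bar R :=
  ereal_inf [set (dist_disk ab.1 ab.2)%:E | ab in
    [set ab : Cplx R * Cplx R | [/\ @unit_disk R ab.1, @unit_disk R ab.2,
                                    f ab.1 = w1 & f ab.2 = w2]]].

Definition dist_cover_set (R : realType) (f : Cplx R -> Cplx R) (w : Cplx R)
    (F : set (Cplx R)) : \bar R :=
  ereal_inf [set dist_cover f w w' | w' in F].

Definition circle_in (R : realType) (Omega : set (Cplx R)) (r : R) :
    set (Cplx R) :=
  [set w | Omega w /\ cabs w = r].

(* Main.v *)
Require Import Defs.
From mathcomp Require Import measurable_realfun ring lra.

(* The growth and Bergman numbers are linked through the set of exponents beta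
   such that |f(z)| (1 - |z|)^beta is bounded on the disk for every f in
   Hol(D, Omega). Such a bound puts f in A^p_alpha for p = alpha / beta, and
   p / (alpha + 2) tends to 1 / beta as alpha grows. Conversely the area
   sub-mean value inequality for |f|^p on a square around z of size comparable
   to 1 - |z| turns f in A^p_alpha into growth of exponent (alpha + 2) / p.

   For the hyperbolic part, d_D(0, z) is - log (1 - |z|) up to a bounded error,
   so that a lower bound c log |w| on the distance from 0 to w is a growth bound
   of exponent 1 / c on the covering map f_Omega. Every h in Hol(D, Omega) is
   f_Omega o phi with phi a holomorphic self-map of the disk, and the
   Schwarz-Pick lemma transfers the growth bound from f_Omega to h.

   Complex integration is reduced to Goursat's theorem on rectangles, applied to
   k(z) / (z - z0): this bounds |k(z0)| by a mean of |k| over the boundary of a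
   square and gives the maximum principle. The sub-mean value inequality for
   |f|^p with p small is obtained by maximising a weighted modulus, and the
   lifts along f_Omega are holomorphic because an injective holomorphic map has
   a nonzero derivative. *)

Set Implicit Arguments.
Unset Strict Implicit.
Unset Printing Implicit Defensive.

Local Open Scope classical_set_scope.
Local Open Scope ring_scope.

(** Contour integration enters only through the real number [bdint], the imaginary part of the
    integral. After a rotation that makes the value at the centre nonnegative, the imaginary part
    carries all of Cauchy's formula, and a lower bound stands in for the exact value [2 pi]. The
    price is a factor 2 in [center_le_max]. The maximum principle gets rid of it because the
    estimate holds for all powers [P ^+ n] with the same 2; elsewhere it is harmless. The argument
    uses neither power series nor removable singularities. This explains the exponent [m + 2] in the
    Schwarz lemma, the filled-in quotient [quot], and the indirect proof that an injective map has a
    nonzero derivative. Lifts are continued along radii: the disk is star-shaped about 0, and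
    neighbourhoods of radii meet in convex sets, on which lifts are unique. The infima and suprema
    in the two numbers need not be attained. Each comparison therefore runs through strict
    inequalities and an intermediate constant; the same slack absorbs the bounded error in the
    hyperbolic distance. *)

Section Modulus.
Variable R : realType.
Implicit Types z w : Cplx R.

Definition mkC (x y : R) : Cplx R := (x +i* y)%C.
Definition reC z : R := complex.Re (z : R[i]).
Definition imC z : R := complex.Im (z : R[i]).

Lemma cabsE z : cabs z = Num.sqrt (reC z ^+ 2 + imC z ^+ 2).
Proof. by case: z. Qed.

Lemma normC_cabs z : `|z| = mkC (cabs z) 0.
Proof. by case: z. Qed.

Lemma cabs_ge0 z : 0 <= cabs z.
Proof. by rewrite cabsE sqrtr_ge0. Qed.

Lemma cabs0 : cabs (0 : Cplx R) = 0.
Proof. exact: (@ComplexField.Normc.normc0 R). Qed.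

Lemma cabs1 : cabs (1 : Cplx R) = 1.
Proof. exact: (@ComplexField.Normc.normc1 R). Qed.

Lemma cabs_eq0 z : (cabs z == 0) = (z == 0).
Proof.
apply/eqP/eqP => [/(@ComplexField.Normc.eq0_normc R)//|->].
exact: cabs0.
Qed.

Lemma cabs_gt0 z : (0 < cabs z) = (z != 0).
Proof. by rewrite lt0r cabs_eq0 cabs_ge0 andbT. Qed.

Lemma cabsM z w : cabs (z * w) = cabs z * cabs w.
Proof. exact: (@ComplexField.Normc.normcM R). Qed.

Lemma cabsV z : cabs z^-1 = (cabs z)^-1.
Proof. exact: (@ComplexField.Normc.normcV R). Qed.

Lemma cabsX z n : cabs (z ^+ n) = cabs z ^+ n.
Proof. by elim: n => [|n IH]; rewrite ?expr0 ?cabs1// !exprS cabsM IH. Qed.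

Lemma cabsN z : cabs (- z) = cabs z.
Proof. exact: (@normcN R). Qed.

Lemma cabsD z w : cabs (z + w) <= cabs z + cabs w.
Proof. exact: (@le_normcD R). Qed.

Lemma cabsBC z w : cabs (z - w) = cabs (w - z).
Proof. by rewrite -cabsN opprB. Qed.

Lemma cabsB z w : cabs z - cabs w <= cabs (z - w).
Proof. by rewrite lerBlDr (le_trans _ (cabsD _ _))// subrK. Qed.

Lemma cabs_mkC x y : cabs (mkC x y) = Num.sqrt (x ^+ 2 + y ^+ 2).
Proof. by []. Qed.

Lemma cabs_real x : cabs (mkC x 0) = `|x|.
Proof. by rewrite cabs_mkC expr0n addr0 sqrtr_sqr. Qed.

Lemma sqr_cabs z : cabs z ^+ 2 = reC z ^+ 2 + imC z ^+ 2.
Proof. by rewrite cabsE sqr_sqrtr// addr_ge0// sqr_ge0. Qed.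

Lemma reC_le z : `|reC z| <= cabs z.
Proof. by rewrite cabsE -sqrtr_sqr ler_wsqrtr// lerDl sqr_ge0. Qed.

Lemma imC_le z : `|imC z| <= cabs z.
Proof. by rewrite cabsE -sqrtr_sqr ler_wsqrtr// lerDr sqr_ge0. Qed.

Lemma cabs_le z : cabs z <= `|reC z| + `|imC z|.
Proof.
rewrite cabsE -[leRHS]ger0_norm ?addr_ge0// -sqrtr_sqr ler_wsqrtr//.
rewrite sqrrD !real_normK ?num_real//.
have := mulr_ge0 (normr_ge0 (reC z)) (normr_ge0 (imC z)); lra.
Qed.

Lemma reCD z w : reC (z + w) = reC z + reC w. Proof. by case: z; case: w. Qed.
Lemma imCD z w : imC (z + w) = imC z + imC w. Proof. by case: z; case: w. Qed.
Lemma reCN z : reC (- z) = - reC z. Proof. by case: z. Qed.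
Lemma imCN z : imC (- z) = - imC z. Proof. by case: z. Qed.
Lemma reCM z w : reC (z * w) = reC z * reC w - imC z * imC w.
Proof. by case: z; case: w. Qed.
Lemma imCM z w : imC (z * w) = reC z * imC w + imC z * reC w.
Proof. by case: z => a b; case: w => c d. Qed.

Lemma mkCK z : mkC (reC z) (imC z) = z. Proof. by case: z. Qed.

Lemma eqC z w : reC z = reC w -> imC z = imC w -> z = w.
Proof. by case: z; case: w => a b c d /= -> ->. Qed.

Lemma mkCD (a b c d : R) : mkC a b + mkC c d = mkC (a + c) (b + d).
Proof. by []. Qed.

Lemma conjC_mul z : z * (conjc z : Cplx R) = mkC (cabs z ^+ 2) 0.
Proof.
rewrite sqr_cabs; case: z => a b; apply: eqC; rewrite ?reCM ?imCM/=; ring.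
Qed.

End Modulus.

(** * Neighbourhoods, continuity and complex derivatives in epsilon-delta form *)

Section Topology.
Variable R : realType.
Implicit Types (z w : Cplx R) (f : Cplx R -> Cplx R).

Lemma ball_cabs z (e : R) w : ball z (mkC e 0) w <-> cabs (w - z) < e.
Proof.
rewrite -ball_normE /ball_/= normC_cabs -cabsBC.
by rewrite ltcE/= eqxx.
Qed.

(** A ball of [Cplx R] has its radius in [Cplx R]. Positivity for the partial order there forces the
    imaginary part to be 0, so real radii suffice. *)
Lemma nbhsCP z (A : set (Cplx R)) :
  nbhs z A <-> exists2 e : R, 0 < e & forall w, cabs (w - z) < e -> A w.
Proof.
split=> [/nbhs_ballP|].
  move=> [[e e'] /=]; rewrite ltcE/= => /andP[/eqP e'0 e0] H.
  by exists e => // w wz; apply: H; rewrite e'0; apply/ball_cabs.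
move=> [e e0 H]; apply/nbhs_ballP; exists (mkC e 0); first by rewrite /= ltcE/= eqxx.
by move=> w /ball_cabs/H.
Qed.

Lemma openCP (A : set (Cplx R)) :
  open A <-> forall z, A z ->
    exists2 e : R, 0 < e & forall w, cabs (w - z) < e -> A w.
Proof.
rewrite openE; split => H z /H; rewrite /interior/=; by [move/nbhsCP|move=> ?; apply/nbhsCP].
Qed.

Lemma continuousCP f z : {for z, continuous f} <->
  forall e : R, 0 < e -> exists2 d : R, 0 < d &
    forall w, cabs (w - z) < d -> cabs (f w - f z) < e.
Proof.
split.
  move=> fz e e0; have /fz/nbhsCP[d d0 H] : nbhs (f z) [set w | cabs (w - f z) < e].
    by apply/nbhsCP; exists e.
  by exists d.
move=> H A /nbhsCP[e e0 He]; apply/nbhsCP; have [d d0 Hd] := H _ e0.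
by exists d => // w /Hd/He.
Qed.

(** Little-o form of the difference quotient: it is free of division and also makes sense at
    [h = 0]. *)
Lemma derivableCP f z : derivable f z 1 <->
  exists l : Cplx R, forall e : R, 0 < e -> exists2 d : R, 0 < d &
    forall h, cabs h < d -> cabs (f (z + h) - f z - l * h) <= e * cabs h.
Proof.
split.
  move=> /cvg_ex[l Hl]; exists l => e e0.
  have /Hl/nbhsCP[d d0 H] : nbhs l [set w | cabs (w - l) < e].
    by apply/nbhsCP; exists e.
  exists d => // h hd; have [->|h0] := eqVneq h 0.
    by rewrite addr0 mulr0 !subrr cabs0 mulr0.
  have := H h; rewrite subr0 /= => /(_ hd h0) /ltW.
  have hp : 0 < cabs h by rewrite cabs_gt0.
  rewrite -(ler_pM2r hp) -cabsM; congr (cabs _ <= _).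
  rewrite /GRing.scale/= mulr1 (addrC h z) mulrBl mulrAC mulVf// mul1r; ring.
move=> [l Hl]; apply/cvg_ex; exists l => A /nbhsCP[e e0 He].
have e20 : 0 < e / 2 by rewrite divr_gt0.
have [d d0 Hd] := Hl _ e20.
apply/nbhsCP; exists d => // h; rewrite subr0 => hd h0; apply: He => /=.
have hp : 0 < cabs h by rewrite cabs_gt0.
apply: (@le_lt_trans _ _ (e / 2)); last lra.
rewrite -(ler_pM2r hp) -cabsM; apply: le_trans (Hd _ hd).
rewrite le_eqVlt; apply/orP; left; apply/eqP; congr (cabs _).
rewrite /GRing.scale/= mulr1 (addrC h z) mulrBl mulrAC mulVf// mul1r; ring.
Qed.

Lemma derivable_cont f z : derivable f z 1 -> {for z, continuous f}.
Proof. by move=> /derivable1_diffP/differentiable_continuous. Qed.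

End Topology.

Section DerivableRules.
Variable R : realType.
Implicit Types (f g k : Cplx R -> Cplx R) (z w : Cplx R).

Lemma dC_cst w z : derivable (fun=> w : Cplx R) z 1.
Proof. exact (@derivable_cst _ _ _ w z 1). Qed.
Lemma dC_id z : derivable (fun x : Cplx R => x) z 1.
Proof. exact (@derivable_id _ _ z 1). Qed.
Lemma dC_add f g z : derivable f z 1 -> derivable g z 1 -> derivable (fun x => f x + g x) z 1.
Proof. by move=> df dg; exact: (derivableD df dg). Qed.
Lemma dC_sub f g z : derivable f z 1 -> derivable g z 1 -> derivable (fun x => f x - g x) z 1.
Proof. by move=> df dg; exact: (derivableB df dg). Qed.
Lemma dC_mul f g z : derivable f z 1 -> derivable g z 1 -> derivable (fun x => f x * g x) z 1.
Proof. by move=> df dg; exact: (derivableM df dg). Qed.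
Lemma dC_inv f z : f z != 0 -> derivable f z 1 -> derivable (fun x => (f x)^-1) z 1.
Proof. by move=> fz df; exact: (derivableV fz df). Qed.
Lemma dC_exp f n z : derivable f z 1 -> derivable (fun x => f x ^+ n) z 1.
Proof.
move=> df; elim: n => [|n IH].
  rewrite (_ : (fun x => _) = fun=> 1); first exact: dC_cst.
  by apply/funext => x; rewrite expr0.
rewrite (_ : (fun x => _) = fun x => f x * f x ^+ n); first exact: dC_mul.
by apply/funext => x; rewrite exprS.
Qed.

Lemma dC_comp f g z : derivable f z 1 -> derivable g (f z) 1 -> derivable (fun x => g (f x)) z 1.
Proof. move=> /derivable1_diffP df /derivable1_diffP dg; apply/derivable1_diffP.
exact: (differentiable_comp df dg). Qed.
Lemma cC_cst w z : {for z, continuous (fun=> w : Cplx R)}.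
Proof. exact (@cst_continuous _ _ w z). Qed.
Lemma cC_mul f g z : {for z, continuous f} -> {for z, continuous g} -> {for z, continuous (fun x => f x * g x)}.
Proof. by move=> cf cg; exact: (continuousM cf cg). Qed.
Lemma cC_inv f z : f z != 0 -> {for z, continuous f} -> {for z, continuous (fun x => (f x)^-1)}.
Proof. by move=> f0 cf; exact: (continuousV f0 cf). Qed.
End DerivableRules.

Arguments dC_cst {R} w z.
Arguments dC_id {R} z.
Arguments dC_add {R f g z} _ _.
Arguments dC_sub {R f g z} _ _.
Arguments dC_mul {R f g z} _ _.
Arguments dC_inv {R f z} _ _.
Arguments dC_exp {R f} n {z} _.
Arguments dC_comp {R f g z} _ _.
Arguments cC_cst {R} w z.
Arguments cC_mul {R f g z} _ _.
Arguments cC_inv {R f z} _ _.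

Lemma dC_divB (R : realType) (k : Cplx R -> Cplx R) (w z0 z : Cplx R) : z != z0 -> derivable k z 1 ->
  derivable (fun x => w * k x / (x - z0)) z 1.
Proof.
move=> zz0 dk.
have z0' : z - z0 != 0 by rewrite subr_eq0.
exact (dC_mul (dC_mul (dC_cst w z) dk) (dC_inv (f := fun x => x - z0) z0' (dC_sub (dC_id z) (dC_cst z0 z)))).
Qed.

Arguments dC_divB {R k} w {z0 z} _ _.

(** * Integrals of continuous functions over a real segment *)

Section SegmentIntegral.
Variable R : realType.
Implicit Types (u v : R -> R) (a b m x : R).
Local Notation mu := (@lebesgue_measure R).

Definition ival u a b : R := \int[mu]_(x in `[a, b]) u x.

(** Continuity is two-sided even at the endpoints: the integrands come from functions that are
    continuous at points of the plane, not just along a side. *)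
Definition cont_on u a b := {in `[a, b], forall x, {for x, continuous u}}.

Lemma cont_at u x : (forall e : R, 0 < e -> exists2 d : R, 0 < d &
    forall y, `|y - x| < d -> `|u y - u x| < e) -> {for x, continuous u}.
Proof.
move=> H; apply/cvgrPdist_lt => e e0; have [d d0 Hd] := H _ e0.
apply/nbhs_ballP; exists d => // y; rewrite /ball/= distrC => /Hd.
by rewrite distrC.
Qed.

Lemma cont_on_integrable u a b : cont_on u a b ->
  mu.-integrable `[a, b] (EFin \o u).
Proof.
move=> H; apply: continuous_compact_integrable; first exact: segment_compact.
by apply: continuous_in_subspaceT => x; rewrite mem_setE => /H.
Qed.

Lemma cont_onS u a b a' b' : a <= a' -> b' <= b -> cont_on u a b ->
  cont_on u a' b'.
Proof.
move=> aa bb H x; rewrite in_itv/= => /andP[ax xb]; apply: H.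
by rewrite in_itv/= (le_trans aa)// (le_trans xb).
Qed.

Lemma cont_onB u v a b : cont_on u a b -> cont_on v a b ->
  cont_on (fun x => u x - v x) a b.
Proof. by move=> Hu Hv x xab; apply: continuousB; [exact: Hu|exact: Hv]. Qed.

Lemma ivalB u v a b : cont_on u a b -> cont_on v a b ->
  ival (fun x => u x - v x) a b = ival u a b - ival v a b.
Proof.
by move=> Hu Hv; rewrite /ival RintegralB//; exact: cont_on_integrable.
Qed.

Lemma ival_cst k a b : a <= b -> ival (fun=> k) a b = k * (b - a).
Proof.
move=> ab; rewrite /ival Rintegral_cst//.
transitivity (k * fine (if (a%:E < b%:E)%E then (b%:E - a%:E)%E else 0%E)).
  by congr (k * fine _); exact: (lebesgue_measure_itv `[a, b]).
rewrite lte_fin.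
case: ltP => //= ba; have -> : a = b by apply/le_anti; rewrite ab.
by rewrite subrr.
Qed.

Lemma ival_split u a m b : a <= m -> m <= b -> cont_on u a b ->
  ival u a b = ival u a m + ival u m b.
Proof.
move=> am mb Hu; apply/eqP; rewrite addrC -subr_eq; apply/eqP.
rewrite /ival Rintegral_itvB ?bnd_simp//; last exact: cont_on_integrable.
apply: Rintegral_itv_obnd_cbnd.
apply: integrableS (cont_on_integrable Hu) => //.
by apply: subset_itvr; rewrite bnd_simp.
Qed.

Lemma ival_near u k e a b : a <= b -> cont_on u a b ->
  (forall x, a <= x <= b -> `|u x - k| <= e) ->
  `|ival u a b - k * (b - a)| <= e * (b - a).
Proof.
move=> ab Hu H; have ck c : cont_on (fun=> c) a b by move=> x _; exact: cst_continuous.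
rewrite -(ival_cst k ab) -ivalB// -(ival_cst e ab).
have cB := cont_onB Hu (ck k).
apply: le_trans (le_normr_Rintegral _ (cont_on_integrable cB)) _ => //.
apply: le_Rintegral => //.
- apply: cont_on_integrable => x /cB cx.
  exact: (continuous_comp cx (@norm_continuous _ _ _)).
- exact: cont_on_integrable.
Qed.

End SegmentIntegral.

(** * Goursat's theorem on rectangles *)

Section Goursat.
Variable R : realType.
Implicit Types (h : Cplx R -> Cplx R) (a b c d x y : R).

(* The imaginary part of the integral of [h] along the boundary of the
   rectangle [[a, b] x [c, d]], counterclockwise. *)
Definition bdint h a b c d : R :=
  ival (fun x => imC (h (mkC x c)) - imC (h (mkC x d))) a b +
  ival (fun y => reC (h (mkC b y)) - reC (h (mkC a y))) c d.

Definition cont_rect h a b c d :=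
  forall x y, a <= x <= b -> c <= y <= d -> {for mkC x y, continuous h}.

Lemma contC_hre h x y : {for mkC x y, continuous h} ->
  {for x, continuous (fun t => reC (h (mkC t y)))} /\
  {for x, continuous (fun t => imC (h (mkC t y)))}.
Proof.
move=> /continuousCP H; split; apply: cont_at => e /H[d d0 Hd]; exists d => // t tx.
  rewrite -reCN -reCD; apply: le_lt_trans (reC_le _) _; apply: Hd.
  by rewrite [_ - _](_ : _ = mkC (t - x) 0) ?cabs_real//; apply: eqC => //=; rewrite subrr.
rewrite -imCN -imCD; apply: le_lt_trans (imC_le _) _; apply: Hd.
by rewrite [_ - _](_ : _ = mkC (t - x) 0) ?cabs_real//; apply: eqC => //=; rewrite subrr.
Qed.

Lemma contC_vre h x y : {for mkC x y, continuous h} ->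
  {for y, continuous (fun t => reC (h (mkC x t)))} /\
  {for y, continuous (fun t => imC (h (mkC x t)))}.
Proof.
have cabs_im (t : R) : cabs (mkC 0 t) = `|t| by rewrite cabs_mkC expr0n add0r sqrtr_sqr.
move=> /continuousCP H; split; apply: cont_at => e /H[d d0 Hd]; exists d => // t tx.
  rewrite -reCN -reCD; apply: le_lt_trans (reC_le _) _; apply: Hd.
  by rewrite [_ - _](_ : _ = mkC 0 (t - y)) ?cabs_im//; apply: eqC => //=; rewrite subrr.
rewrite -imCN -imCD; apply: le_lt_trans (imC_le _) _; apply: Hd.
by rewrite [_ - _](_ : _ = mkC 0 (t - y)) ?cabs_im//; apply: eqC => //=; rewrite subrr.
Qed.

Lemma cont_side_h h a b y : (forall x, a <= x <= b -> {for mkC x y, continuous h}) ->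
  cont_on (fun x => imC (h (mkC x y))) a b.
Proof. by move=> H x; rewrite in_itv/= => /H/contC_hre[]. Qed.

Lemma cont_side_v h c d x : (forall y, c <= y <= d -> {for mkC x y, continuous h}) ->
  cont_on (fun y => reC (h (mkC x y))) c d.
Proof. by move=> H y; rewrite in_itv/= => /H/contC_vre[]. Qed.

(** The two integrals along the cut cancel. Continuity is asked only along the five segments
    involved, so that a rectangle with a singular point inside may be cut as well. *)
Lemma bdint_split_x h a m b c d : a <= m -> m <= b ->
  (forall x, a <= x <= b -> {for mkC x c, continuous h}) ->
  (forall x, a <= x <= b -> {for mkC x d, continuous h}) ->
  (forall y, c <= y <= d -> {for mkC a y, continuous h}) ->
  (forall y, c <= y <= d -> {for mkC m y, continuous h}) ->
  (forall y, c <= y <= d -> {for mkC b y, continuous h}) ->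
  bdint h a b c d = bdint h a m c d + bdint h m b c d.
Proof.
move=> am mb /cont_side_h Hc /cont_side_h Hd.
move=> /cont_side_v Ha /cont_side_v Hm /cont_side_v Hb.
rewrite /bdint (ival_split am mb) ?(ivalB (u := fun y => reC (h (mkC _ y))))//; last exact: cont_onB.
lra.
Qed.

Lemma bdint_split_y h a b c m d : c <= m -> m <= d ->
  (forall x, a <= x <= b -> {for mkC x c, continuous h}) ->
  (forall x, a <= x <= b -> {for mkC x m, continuous h}) ->
  (forall x, a <= x <= b -> {for mkC x d, continuous h}) ->
  (forall y, c <= y <= d -> {for mkC a y, continuous h}) ->
  (forall y, c <= y <= d -> {for mkC b y, continuous h}) ->
  bdint h a b c d = bdint h a b c m + bdint h a b m d.
Proof.
move=> cm md /cont_side_h Hc /cont_side_h Hm /cont_side_h Hd.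
move=> /cont_side_v Ha /cont_side_v Hb.
rewrite /bdint (ival_split cm md) ?(ivalB (u := fun x => imC (h (mkC x _))))//; last exact: cont_onB.
lra.
Qed.

(* The affine part of [h] at [z] contributes [Re l * (c - d) * (b - a)] and
   its opposite. *)
Lemma bdint_local h z l e a b c d : a <= b -> c <= d -> 0 <= e ->
  cont_rect h a b c d ->
  a <= reC z <= b -> c <= imC z <= d ->
  (forall x y, a <= x <= b -> c <= y <= d ->
    cabs (h (mkC x y) - h z - l * (mkC x y - z)) <= e * cabs (mkC x y - z)) ->
  `|bdint h a b c d| <= 2 * e * (b - a + (d - c)) ^+ 2.
Proof.
move=> ab cd e0 ch zx zy H; set s := b - a + (d - c).
have s0 : 0 <= s by rewrite /s; lra.
have Hs x y : a <= x <= b -> c <= y <= d ->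
    cabs (h (mkC x y) - h z - l * (mkC x y - z)) <= e * s.
  move=> hx hy; apply: le_trans (H _ _ hx hy) _; apply: ler_wpM2l => //.
  apply: le_trans (cabs_le _) _.
  rewrite reCD imCD reCN imCN/= /s; apply: lerD; rewrite ler_norml; lra.
have Hd p q : cabs (h p - h z - l * (p - z)) <= e * s ->
    cabs (h q - h z - l * (q - z)) <= e * s ->
    cabs (h p - h q - l * (p - q)) <= 2 * e * s.
  move=> hp hq.
  have -> : h p - h q - l * (p - q) = (h p - h z - l * (p - z)) - (h q - h z - l * (q - z)) by ring.
  by apply: le_trans (cabsD _ _) _; rewrite cabsN; lra.
have B1 : `|ival (fun x => imC (h (mkC x c)) - imC (h (mkC x d))) a b
    - reC l * (c - d) * (b - a)| <= 2 * e * s * (b - a).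
  apply: ival_near => //.
    by apply: cont_onB; apply: cont_side_h => x hx; apply: ch => //; rewrite ?lexx ?cd.
  move=> x hx; have := Hd (mkC x c) (mkC x d).
  move=> /(_ (Hs _ _ hx _) (Hs _ _ hx _)) Hx; apply: le_trans (Hx _ _); rewrite ?lexx ?cd//.
  apply: le_trans (imC_le _); rewrite !(imCD, imCN, imCM, reCD, reCN)/=.
  by rewrite subrr mulr0 addr0.
have B2 : `|ival (fun y => reC (h (mkC b y)) - reC (h (mkC a y))) c d
    - reC l * (b - a) * (d - c)| <= 2 * e * s * (d - c).
  apply: ival_near => //.
    by apply: cont_onB; apply: cont_side_v => x hx; apply: ch => //; rewrite ?lexx ?ab.
  move=> y hy; have := Hd (mkC b y) (mkC a y).
  move=> /(_ (Hs _ _ _ hy) (Hs _ _ _ hy)) Hx; apply: le_trans (Hx _ _); rewrite ?lexx ?ab//.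
  apply: le_trans (reC_le _); rewrite !(reCM, imCD, imCN, imCM, reCD, reCN)/=.
  by rewrite subrr mulr0 subr0.
have -> : 2 * e * s ^+ 2 = 2 * e * s * (b - a) + 2 * e * s * (d - c) by rewrite /s; ring.
have -> : bdint h a b c d =
  (ival (fun x => imC (h (mkC x c)) - imC (h (mkC x d))) a b - reC l * (c - d) * (b - a)) +
  (ival (fun y => reC (h (mkC b y)) - reC (h (mkC a y))) c d - reC l * (b - a) * (d - c)).
  by rewrite /bdint; ring.
by apply: le_trans (ler_normD _ _) _; exact: lerD.
Qed.

Lemma nested_intervals (a b : nat -> R) :
  (forall n, a n <= a n.+1) -> (forall n, b n.+1 <= b n) -> (forall n, a n <= b n) ->
  exists x, forall n, a n <= x <= b n.
Proof.
move=> ha hb hab.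
have ma : {homo a : m n / (m <= n)%N >-> m <= n} by apply: homo_leq => // ? ? ?; exact: le_trans.
have mb : {homo b : m n / (m <= n)%N >-> n <= m}.
  by apply: homo_leq => // ? ? ? H1 H2; exact: le_trans H2 H1.
have ub n : ubound (range a) (b n).
  move=> _ [m _ <-]; have [mn|/ltnW nm] := leqP m n.
    by apply: le_trans (ma _ _ mn) _.
  by apply: le_trans (hab m) (mb _ _ nm).
exists (sup (range a)) => n; apply/andP; split.
  apply: sup_upper_bound; last by exists n.
  by split; [exists (a 0%N), 0%N|exists (b 0%N); exact: ub].
by apply: ge_sup; [exists (a 0%N), 0%N|exact: ub].
Qed.

Lemma half_split (v x y : R) : v = x + y -> `|v| / 2 <= `|x| \/ `|v| / 2 <= `|y|.
Proof.
move=> ->; have := ler_normD x y.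
by case: (lerP (`|x + y| / 2) `|x|) => H1 H2; [left|right; lra].
Qed.

(** Bisection in [x], then in [y]: one of two summands has at least half the absolute value of the
    sum, which costs a factor 4 in all. *)
Lemma quarter_step h a b c d : a <= b -> c <= d -> cont_rect h a b c d ->
  exists q : R * R * (R * R), [/\ a <= q.1.1, q.1.2 <= b /\ q.1.1 <= q.1.2,
    c <= q.2.1, q.2.2 <= d /\ q.2.1 <= q.2.2 &
    [/\ q.1.2 - q.1.1 = (b - a) / 2, q.2.2 - q.2.1 = (d - c) / 2 &
       `|bdint h a b c d| / 4 <= `|bdint h q.1.1 q.1.2 q.2.1 q.2.2|]].
Proof.
move=> ab cd ch.
have mid (s t : R) : s <= t -> exists m, [/\ s <= m, m <= t, m - s = (t - s) / 2 & t - m = (t - s) / 2].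
  by move=> st; exists ((s + t) / 2); split; lra.
have half4 (s t u : R) : s / 2 <= t -> t / 2 <= u -> s / 4 <= u by lra.
have [m [am mb ma bm]] := mid _ _ ab; have [n [cn nd nc dn]] := mid _ _ cd.
have sx : bdint h a b c d = bdint h a m c d + bdint h m b c d.
  apply: bdint_split_x => //.
  - by move=> x hx; apply: ch; rewrite ?lexx.
  - by move=> x hx; apply: ch; rewrite ?lexx ?cd.
  - by move=> y hy; apply: ch; rewrite ?lexx ?ab.
  - by move=> y hy; apply: ch; rewrite ?am.
  - by move=> y hy; apply: ch; rewrite ?ab ?lexx.
have sy a2 b2 : a <= a2 -> a2 <= b2 -> b2 <= b ->
    bdint h a2 b2 c d = bdint h a2 b2 c n + bdint h a2 b2 n d.
  move=> h1 h2 h3; have h4 x : a2 <= x <= b2 -> a <= x <= b.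
    by move=> /andP[? ?]; rewrite (le_trans h1)// (le_trans _ h3).
  apply: bdint_split_y => //.
  - by move=> x /h4 hx; apply: ch; rewrite ?lexx.
  - by move=> x /h4 hx; apply: ch; rewrite ?cn.
  - by move=> x /h4 hx; apply: ch; rewrite ?lexx ?cd.
  - by move=> y hy; apply: ch; rewrite ?h1 ?(le_trans h2 h3).
  - by move=> y hy; apply: ch; rewrite ?h3 ?(le_trans h1 h2).
have [a2 [b2 [aa bb [ab2 Lx Hx]]]] : exists a2 b2, [/\ a <= a2, b2 <= b &
   [/\ a2 <= b2, b2 - a2 = (b - a) / 2 & `|bdint h a b c d| / 2 <= `|bdint h a2 b2 c d|]].
  by have [H|H] := half_split sx; [exists a, m|exists m, b].
have [c2 [d2 [cc dd [cd2 Ly Hy]]]] : exists c2 d2, [/\ c <= c2, d2 <= d &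
   [/\ c2 <= d2, d2 - c2 = (d - c) / 2 & `|bdint h a2 b2 c d| / 2 <= `|bdint h a2 b2 c2 d2|]].
  by have [H|H] := half_split (sy _ _ aa ab2 bb); [exists c, n|exists n, d].
by exists ((a2, b2), (c2, d2)); split => //; split => //=; exact: half4 Hx Hy.
Qed.

(** Repeated quartering shrinks the rectangle to a point, and differentiability at that point makes
    the quadratic bound of [bdint_local] as small as desired. *)
Lemma goursat h a b c d : a <= b -> c <= d ->
  (forall x y, a <= x <= b -> c <= y <= d -> derivable h (mkC x y) 1) ->
  bdint h a b c d = 0.
Proof.
move=> ab cd dh.
have ch : cont_rect h a b c d by move=> x y hx hy; apply: derivable_cont; exact: dh.
pose T := (R * R * (R * R))%type.
pose I (q : T) := bdint h q.1.1 q.1.2 q.2.1 q.2.2.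
pose good (q : T) := [/\ a <= q.1.1, q.1.1 <= q.1.2 & q.1.2 <= b] /\
   [/\ c <= q.2.1, q.2.1 <= q.2.2 & q.2.2 <= d].
pose P (q q' : T) := good q -> [/\ good q',
   q.1.1 <= q'.1.1 /\ q'.1.2 <= q.1.2, q.2.1 <= q'.2.1 /\ q'.2.2 <= q.2.2,
   q'.1.2 - q'.1.1 = (q.1.2 - q.1.1) / 2 /\ q'.2.2 - q'.2.1 = (q.2.2 - q.2.1) / 2
   & `|I q| / 4 <= `|I q'|].
(* Dependent choice wants a successor for every quadruple; as [P] is guarded by [good], a bad one
   may be its own successor. *)
have step q : {q' | P q q'}.
  apply: cid; case: q => -[a1 b1] [c1 d1].
  have [|ng] := pselect (good ((a1, b1), (c1, d1))); last by exists ((a1, b1), (c1, d1)).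
  move=> [/= [aa ab1 bb] [cc cd1 dd]].
  have cr : cont_rect h a1 b1 c1 d1.
    move=> x y /andP[ax xb] /andP[cy yd].
    by apply: ch; [rewrite (le_trans aa)// (le_trans xb)|rewrite (le_trans cc)// (le_trans yd)].
  have [q' [h1 [h2 h2'] h3 [h4 h4'] [h5 h6 h7]]] := quarter_step ab1 cd1 cr.
  have g' : good q'.
    split; split => //; [exact: le_trans aa h1|exact: le_trans h2 bb|
      exact: le_trans cc h3|exact: le_trans h4 dd].
  by exists q' => _; split => /=.
have [q [q0 qS]] := dependent_choice step ((a, b), (c, d)).
have gq n : good (q n).
  elim: n => [|n IH]; first by rewrite q0; split; split => //=.
  by have [] := qS n IH.
have [x hx] : exists x, forall n, (q n).1.1 <= x <= (q n).1.2.
  apply: nested_intervals => n; [by have [_ []] := qS n (gq n)|by have [_ []] := qS n (gq n)|].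
  by have [[]] := gq n.
have [y hy] : exists y, forall n, (q n).2.1 <= y <= (q n).2.2.
  apply: nested_intervals => n; [by have [_ _ []] := qS n (gq n)|by have [_ _ []] := qS n (gq n)|].
  by have [_ []] := gq n.
pose s0 := b - a + (d - c).
have sz n : (q n).1.2 - (q n).1.1 + ((q n).2.2 - (q n).2.1) = s0 / 2 ^+ n.
  elim: n => [|n IH]; first by rewrite q0/= expr0 divr1.
  have [_ _ _ [-> ->] _] := qS n (gq n).
  by rewrite -mulrDl IH exprSr invfM mulrA.
have In n : `|I (q 0%N)| <= 4 ^+ n * `|I (q n)|.
  elim: n => [|n IH]; first by rewrite expr0 mul1r.
  have [_ _ _ _] := qS n (gq n); rewrite exprSr -mulrA => H.
  apply: le_trans IH _; rewrite ler_pM2l ?exprn_gt0//; lra.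
have dxy : derivable h (mkC x y) 1.
  by apply: dh; [have := hx 0%N|have := hy 0%N]; rewrite q0.
have /derivableCP[l Hl] := dxy.
have s00 : 0 <= s0 by rewrite /s0; lra.
(* The factor [4 ^+ n] lost by quartering is exactly the square of the factor [2 ^+ n] by which the
   size shrinks, so [n] cancels. *)
suff : forall e, 0 < e -> `|I (q 0%N)| <= 2 * e * s0 ^+ 2.
  rewrite q0 {1}/I/= => H; apply/eqP; rewrite -normr_eq0 eq_le normr_ge0 andbT.
  apply/ler_addgt0Pr => e e0; rewrite add0r.
  have p : 0 < 2 * (s0 ^+ 2 + 1) by have := sqr_ge0 s0; lra.
  have := H (e / (2 * (s0 ^+ 2 + 1))) (divr_gt0 e0 p) => /le_trans; apply.
  rewrite (_ : 2 * _ * _ = (2 * s0 ^+ 2 * e) / (2 * (s0 ^+ 2 + 1))); last by ring.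
  rewrite ler_pdivrMr// [leRHS]mulrC; apply: ler_wpM2r; [exact: ltW|lra].
move=> e e0; have [dl dl0 Hd] := Hl _ e0.
have [n Hn] : exists n, s0 / 2 ^+ n < dl.
  pose n := Num.truncn (s0 / dl); exists n.
  have /truncn_itv : 0 <= s0 / dl by rewrite divr_ge0// ltW.
  rewrite -/n => /andP[_]; rewrite ltr_pdivrMr// => h2.
  rewrite ltr_pdivrMr ?exprn_gt0//; apply: lt_le_trans h2 _.
  rewrite mulrC ler_pM2l// -natrX ler_nat; exact: ltn_expl.
have [[aa ab1 bb] [cc cd1 dd]] := gq n.
have clip (u v w t1 t2 : R) : v <= t1 <= w -> v <= t2 <= w -> `|t1 - t2| <= w - v.
  by move=> ? ?; rewrite ler_norml; lra.
have sub (u v w u' w' : R) : u <= u' -> w' <= w -> u' <= v <= w' -> u <= v <= w by lra.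
have : `|I (q n)| <= 2 * e * (s0 / 2 ^+ n) ^+ 2.
  rewrite -(sz n); apply: (@bdint_local h (mkC x y) l) ab1 cd1 (ltW e0) _ (hx n) (hy n) _.
    move=> x1 y1 hx1 hy1; apply: ch; [exact: sub aa bb _|exact: sub cc dd _].
  move=> x1 y1 hx1 hy1; have -> : h (mkC x1 y1) = h (mkC x y + (mkC x1 y1 - mkC x y)).
    by rewrite addrC subrK.
  apply: Hd; apply: le_lt_trans Hn; rewrite -(sz n); apply: le_trans (cabs_le _) _.
  by rewrite reCD imCD reCN imCN; apply: lerD; apply: clip.
move=> H; apply: le_trans (In n) _.
apply: (@le_trans _ _ (4 ^+ n * (2 * e * (s0 / 2 ^+ n) ^+ 2))).
  by rewrite ler_pM2l ?exprn_gt0.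
rewrite expr_div_n -exprM mulnC exprM -[2 ^+ 2]natrX.
rewrite (_ : _ * _ = 2 * e * s0 ^+ 2 * (4 ^+ n / 4 ^+ n)); last by ring.
by rewrite divff ?mulr1 ?expf_neq0.
Qed.

End Goursat.

Section SegmentIntegralBounds.
Variable R : realType.
Implicit Types (u v : R -> R) (a b : R).

Lemma ival_le u v a b : cont_on u a b -> cont_on v a b ->
  (forall x, a <= x <= b -> u x <= v x) -> ival u a b <= ival v a b.
Proof. by move=> Hu Hv H; apply: le_Rintegral => //; exact: cont_on_integrable. Qed.

Lemma ival_ge_cst u k a b : a <= b -> cont_on u a b ->
  (forall x, a <= x <= b -> k <= u x) -> k * (b - a) <= ival u a b.
Proof.
move=> ab Hu H; rewrite -ival_cst//; apply: ival_le => // x _; exact: cst_continuous.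
Qed.

Lemma ival_le_cst u k a b : a <= b -> cont_on u a b ->
  (forall x, a <= x <= b -> u x <= k) -> ival u a b <= k * (b - a).
Proof.
move=> ab Hu H; rewrite -ival_cst//; apply: ival_le => // x _; exact: cst_continuous.
Qed.

End SegmentIntegralBounds.

(** * Cauchy's estimate at an interior point of a rectangle, with a constant that is not sharp *)

Section CenterEstimate.
Variable R : realType.
Implicit Types (k h : Cplx R -> Cplx R) (p q a b c d e t m : R).

(** The parts to the left, to the right, below and above the small square avoid the singular point,
    and Goursat's theorem makes their integrals vanish. *)
Lemma bdint_deform h p q a b c d e : 0 < e ->
  a <= p - e -> p + e <= b -> c <= q - e -> q + e <= d ->
  (forall x y, a <= x <= b -> c <= y <= d -> mkC x y != mkC p q ->
     derivable h (mkC x y) 1) ->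
  bdint h a b c d = bdint h (p - e) (p + e) (q - e) (q + e).
Proof.
move=> e0 ap pb cq qd dh.
have dx x y : a <= x <= b -> c <= y <= d -> x != p -> derivable h (mkC x y) 1.
  by move=> hx hy xp; apply: dh => //; apply: contra xp => /eqP[->].
have dy x y : a <= x <= b -> c <= y <= d -> y != q -> derivable h (mkC x y) 1.
  by move=> hx hy xp; apply: dh => //; apply: contra xp => /eqP[_ ->].
have ch x y (H : derivable h (mkC x y) 1) := derivable_cont H.
have pe : p - e != p by rewrite lt_eqF// ltrBlDr ltrDl.
have pe' : p + e != p by rewrite gt_eqF// ltrDl.
have qe : q - e != q by rewrite lt_eqF// ltrBlDr ltrDl.
have qe' : q + e != q by rewrite gt_eqF// ltrDl.
have ee : p - e <= p + e by lra.
have ee' : q - e <= q + e by lra.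
have ap' : a <= p + e by lra.
have pb' : p - e <= b by lra.
have cq' : c <= q + e by lra.
have qd' : q - e <= d by lra.
have aq : a != p by rewrite lt_eqF//; lra.
have bq : b != p by rewrite gt_eqF//; lra.
have cq2 : c != q by rewrite lt_eqF//; lra.
have dq : d != q by rewrite gt_eqF//; lra.
have ab : a <= b by lra.
have cd : c <= d by lra.
have sx x : p - e <= x <= b -> a <= x <= b.
  by move=> /andP[? ->]; rewrite (le_trans ap).
have sxx x : p - e <= x <= p + e -> a <= x <= b.
  by move=> /andP[? h1]; rewrite (le_trans ap)// (le_trans h1).
have sy y : q - e <= y <= d -> c <= y <= d.
  by move=> /andP[? ->]; rewrite (le_trans cq).
have Hh y : c <= y <= d -> y != q -> forall x, a <= x <= b -> {for mkC x y, continuous h}.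
  by move=> hy yq x hx; apply: ch; exact: dy.
have Vv x : a <= x <= b -> x != p -> forall y, c <= y <= d -> {for mkC x y, continuous h}.
  by move=> hx xp y hy; apply: ch; exact: dx.
have Hc := Hh c; rewrite lexx cd in Hc; have {}Hc := Hc isT cq2.
have Hd := Hh d; rewrite lexx cd in Hd; have {}Hd := Hd isT dq.
have Hq := Hh (q - e); rewrite cq qd' in Hq; have {}Hq := Hq isT qe.
have Hq' := Hh (q + e); rewrite cq' qd in Hq'; have {}Hq' := Hq' isT qe'.
have Va := Vv a; rewrite lexx ab in Va; have {}Va := Va isT aq.
have Vb := Vv b; rewrite lexx ab in Vb; have {}Vb := Vb isT bq.
have Vp := Vv (p - e); rewrite ap pb' in Vp; have {}Vp := Vp isT pe.
have Vp' := Vv (p + e); rewrite ap' pb in Vp'; have {}Vp' := Vp' isT pe'.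
have r1 := bdint_split_x ap pb' Hc Hd Va Vp Vb.
have r2 := bdint_split_x ee pb (fun x hx => Hc x (sx x hx)) (fun x hx => Hd x (sx x hx)) Vp Vp' Vb.
have r3 := bdint_split_y cq qd' (fun x hx => Hc x (sxx x hx)) (fun x hx => Hq x (sxx x hx))
  (fun x hx => Hd x (sxx x hx)) Vp Vp'.
have r4 := bdint_split_y ee' qd (fun x hx => Hq x (sxx x hx)) (fun x hx => Hq' x (sxx x hx))
  (fun x hx => Hd x (sxx x hx)) (fun y hy => Vp y (sy y hy)) (fun y hy => Vp' y (sy y hy)).
have z1 : bdint h a (p - e) c d = 0.
  apply: goursat => // x y /andP[ax xp] hy; apply: dx => //; first by rewrite ax (le_trans xp).
  by rewrite lt_eqF// (le_lt_trans xp)// gtrBl.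
have z2 : bdint h (p + e) b c d = 0.
  apply: goursat => // x y /andP[ax xp] hy; apply: dx => //; first by rewrite xp (le_trans ap').
  by rewrite gt_eqF// (lt_le_trans _ ax)// ltrDl.
have z3 : bdint h (p - e) (p + e) c (q - e) = 0.
  apply: goursat => // x y hx /andP[ay yq]; apply: dy; [exact: sxx|by rewrite ay (le_trans yq)|].
  by rewrite lt_eqF// (le_lt_trans yq)// gtrBl.
have z4 : bdint h (p - e) (p + e) (q + e) d = 0.
  apply: goursat => // x y hx /andP[ay yq]; apply: dy; [exact: sxx|by rewrite yq (le_trans cq')|].
  by rewrite gt_eqF// (lt_le_trans _ ay)// ltrDl.
by rewrite r1 r2 r3 r4 z1 z2 z3 z4 add0r !addr0 add0r.
Qed.

(* On the square of half-side [e] the integrand is that of [kappa / z] up to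
   [eta / e] on each side. *)
Lemma bdint_small_ge (k : Cplx R -> Cplx R) p q e (kappa eta : R) : 0 < e -> 0 <= kappa ->
  (forall x y, mkC x y != mkC p q -> p - e <= x <= p + e -> q - e <= y <= q + e ->
     {for mkC x y, continuous (fun z => k z / (z - mkC p q))}) ->
  (forall x y, p - e <= x <= p + e -> q - e <= y <= q + e ->
     cabs (k (mkC x y) - mkC kappa 0) <= eta) ->
  4 * kappa - 8 * eta <=
    bdint (fun z => k z / (z - mkC p q)) (p - e) (p + e) (q - e) (q + e).
Proof.
move=> e0 k0 ch H; set h := fun z => _.
have pe : p - e != p by rewrite lt_eqF// ltrBlDr ltrDl.
have pe' : p + e != p by rewrite gt_eqF// ltrDl.
have qe : q - e != q by rewrite lt_eqF// ltrBlDr ltrDl.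
have qe' : q + e != q by rewrite gt_eqF// ltrDl.
have ee : p - e <= p + e by lra.
have ee' : q - e <= q + e by lra.
have eta0 : 0 <= eta by apply: le_trans (cabs_ge0 _) (H p q _ _); apply/andP; split; lra.
have reV (s t : R) : complex.Re ((mkC s t)^-1 : R[i]) = s / (s ^+ 2 + t ^+ 2) by [].
have imV (s t : R) : complex.Im ((mkC s t)^-1 : R[i]) = - (t / (s ^+ 2 + t ^+ 2)) by [].
(* Since [s ^+ 2 <= e ^+ 2], each side, of length [2 * e], contributes at least [kappa]: the four
   sides give [4 * kappa] in place of the exact [2 pi kappa]. *)
have main (s : R) : - e <= s <= e -> kappa / (2 * e) <= kappa * (e / (e ^+ 2 + s ^+ 2)).
  move=> hs; rewrite ler_pdivrMr; last by lra.
  rewrite -mulrA ler_peMr// mulrAC ler_pdivlMr; last by have := sqr_ge0 s; nra.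
  rewrite mul1r; nra.
have err (z w : Cplx R) : e <= cabs w -> cabs (z - mkC kappa 0) <= eta ->
    cabs (z / w - mkC kappa 0 / w) <= eta / e.
  move=> hw hz; rewrite -mulrBl cabsM cabsV.
  have w0 : 0 < cabs w by exact: lt_le_trans hw.
  rewrite ler_pdivrMr// mulrAC ler_pdivlMr//.
  by apply: ler_pM => //; [exact: cabs_ge0|exact: ltW].
have dif (x y : R) : mkC x y - mkC p q = mkC (x - p) (y - q) by [].
have S1 (s : R) : e <= cabs (mkC e s) /\ e <= cabs (mkC (-e) s) /\ e <= cabs (mkC s e) /\ e <= cabs (mkC s (- e)).
  do !split; [apply: le_trans (reC_le _)|apply: le_trans (reC_le _)|apply: le_trans (imC_le _)|apply: le_trans (imC_le _)]; by rewrite /= ?normrN gtr0_norm.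
have chb y : (y = q - e \/ y = q + e) -> forall x, p - e <= x <= p + e -> {for mkC x y, continuous h}.
  move=> hy x hx; apply: ch => //; last by case: hy => ->; rewrite ?lexx ?ee'.
  by apply/eqP => -[_ yq]; case: hy; rewrite yq => /esym/eqP; apply/negP.
have chv x : (x = p - e \/ x = p + e) -> forall y, q - e <= y <= q + e -> {for mkC x y, continuous h}.
  move=> hx y hy; apply: ch => //; last by case: hx => ->; rewrite ?lexx ?ee.
  by apply/eqP => -[xp _]; case: hx; rewrite xp => /esym/eqP; apply/negP.
have cab1 : p + e - (p - e) = 2 * e by ring.
have cab2 : q + e - (q - e) = 2 * e by ring.
have fin : 2 * kappa - 4 * eta = (kappa / e - 2 * (eta / e)) * (2 * e).
  by field; rewrite gt_eqF.
have k2 : kappa / e - 2 * (eta / e) = (kappa / (2 * e) - eta / e) + (kappa / (2 * e) - eta / e).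
  by field; rewrite gt_eqF.
rewrite (_ : 4 * kappa - 8 * eta = (2 * kappa - 4 * eta) + (2 * kappa - 4 * eta)); last by ring.
apply: lerD.
  rewrite fin -cab1; apply: ival_ge_cst => //.
    by apply: cont_onB; apply: cont_side_h; apply: chb; auto.
  move=> x hx; have hs : - e <= x - p <= e by apply/andP; split; lra.
  rewrite k2; apply: lerD.
    have hq : q - e - q = - e by ring.
    have := err (k (mkC x (q - e))) (mkC (x - p) (- e)).
    have [_ [_ [_ h4]]] := S1 (x - p).
    move=> /(_ h4) -/(_ (H _ _ hx _)); rewrite lexx ee' => /(_ isT) E.
    have := le_trans (imC_le _) E; rewrite imCD imCN [imC (mkC kappa 0 / _)]imCM.
    rewrite [imC (mkC kappa 0)]/= mul0r addr0 [reC (mkC _ _)]/= [imC _^-1]imV mulNr opprK sqrrN (addrC _ (e ^+ 2)).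
    have := main _ hs; rewrite /h dif hq ler_norml; lra.
  have hq : q + e - q = e by ring.
  have := err (k (mkC x (q + e))) (mkC (x - p) e).
  have [_ [_ [h3 _]]] := S1 (x - p).
  move=> /(_ h3) -/(_ (H _ _ hx _)); rewrite lexx ee' => /(_ isT) E.
  have := le_trans (imC_le _) E; rewrite imCD imCN [imC (mkC kappa 0 / _)]imCM.
  rewrite [imC (mkC kappa 0)]/= mul0r addr0 [reC (mkC _ _)]/= [imC _^-1]imV (addrC _ (e ^+ 2)).
  have := main _ hs; rewrite /h dif hq ler_norml; lra.
rewrite fin -cab2; apply: ival_ge_cst => //.
  by apply: cont_onB; apply: cont_side_v; apply: chv; auto.
move=> y hy; have hs : - e <= y - q <= e by apply/andP; split; lra.
rewrite k2; apply: lerD.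
  have hq : p + e - p = e by ring.
  have := err (k (mkC (p + e) y)) (mkC e (y - q)).
  have [h1 _] := S1 (y - q).
  move=> /(_ h1) -/(_ (H _ _ _ hy)); rewrite lexx ee => /(_ isT) E.
  have := le_trans (reC_le _) E; rewrite reCD reCN [reC (mkC kappa 0 / _)]reCM.
  rewrite [imC (mkC kappa 0)]/= mul0r subr0 [reC (mkC _ _)]/= [reC _^-1]reV.
  have := main _ hs; rewrite /h dif hq ler_norml; lra.
have hq : p - e - p = - e by ring.
have := err (k (mkC (p - e) y)) (mkC (- e) (y - q)).
have [_ [h2 _]] := S1 (y - q).
move=> /(_ h2) -/(_ (H _ _ _ hy)); rewrite lexx ee => /(_ isT) E.
have := le_trans (reC_le _) E; rewrite reCD reCN [reC (mkC kappa 0 / _)]reCM.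
rewrite [imC (mkC kappa 0)]/= mul0r subr0 [reC (mkC _ _)]/= [reC _^-1]reV mulNr sqrrN.
have := main _ hs; rewrite /h dif hq ler_norml; lra.
Qed.

Definition bdabs k a b c d : R :=
  ival (fun x => cabs (k (mkC x c)) + cabs (k (mkC x d))) a b +
  ival (fun y => cabs (k (mkC a y)) + cabs (k (mkC b y))) c d.

Lemma cont_abs_h k a b y : (forall x, a <= x <= b -> {for mkC x y, continuous k}) ->
  cont_on (fun x => cabs (k (mkC x y))) a b.
Proof.
move=> H x; rewrite in_itv/= => /H/continuousCP Hx; apply: cont_at => e /Hx[d d0 Hd].
exists d => // t tx; have := Hd (mkC t y); rewrite (_ : _ - mkC x y = mkC (t - x) 0); last first.
  by apply: eqC => //=; rewrite subrr.
rewrite cabs_real => /(_ tx); apply: le_lt_trans; rewrite ler_norml.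
have := cabsB (k (mkC t y)) (k (mkC x y)); have := cabsB (k (mkC x y)) (k (mkC t y)).
rewrite (cabsBC (k (mkC x y))); lra.
Qed.

Lemma cont_abs_v k c d x : (forall y, c <= y <= d -> {for mkC x y, continuous k}) ->
  cont_on (fun y => cabs (k (mkC x y))) c d.
Proof.
move=> H y; rewrite in_itv/= => /H/continuousCP Hx; apply: cont_at => e /Hx[dl d0 Hd].
exists dl => // t tx; have := Hd (mkC x t); rewrite (_ : _ - mkC x y = mkC 0 (t - y)); last first.
  by apply: eqC => //=; rewrite subrr.
rewrite cabs_mkC expr0n add0r sqrtr_sqr => /(_ tx); apply: le_lt_trans; rewrite ler_norml.
have := cabsB (k (mkC x t)) (k (mkC x y)); have := cabsB (k (mkC x y)) (k (mkC x t)).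
rewrite (cabsBC (k (mkC x y))); lra.
Qed.

(** Every boundary point is at distance at least [m] from the singular point, so the integrand has
    modulus at most [|k| / m]. *)
Lemma bdint_le_abs k p q a b c d m : 0 < m ->
  a <= p - m -> p + m <= b -> c <= q - m -> q + m <= d ->
  (forall x y, a <= x <= b -> c <= y <= d -> mkC x y != mkC p q ->
     derivable k (mkC x y) 1) ->
  m * bdint (fun z => k z / (z - mkC p q)) a b c d <= bdabs k a b c d.
Proof.
move=> m0 ap pb cq qd dk; set h := fun z => _.
have dx x y : a <= x <= b -> c <= y <= d -> x != p -> mkC x y != mkC p q.
  by move=> hx hy xp; apply: contra xp => /eqP[->].
have dy x y : a <= x <= b -> c <= y <= d -> y != q -> mkC x y != mkC p q.
  by move=> hx hy xp; apply: contra xp => /eqP[_ ->].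
have ch z : z != mkC p q -> derivable k z 1 -> {for z, continuous h}.
  move=> hz dz; apply: derivable_cont.
  have -> : h = fun z => 1 * k z / (z - mkC p q) by apply/funext => w; rewrite mul1r.
  by move: (dC_divB 1 hz dz).
have ab : a <= b by lra.
have cd : c <= d by lra.
have dif (x y : R) : mkC x y - mkC p q = mkC (x - p) (y - q) by [].
have est z : m <= cabs (z - mkC p q) -> m * cabs (h z) <= cabs (k z).
  move=> hz; have z0 : 0 < cabs (z - mkC p q) by exact: lt_le_trans hz.
  rewrite /h cabsM cabsV mulrA ler_pdivrMr// mulrC; apply: ler_wpM2l => //; exact: cabs_ge0.
have hb x : m <= cabs (mkC x c - mkC p q) /\ m <= cabs (mkC x d - mkC p q).
  rewrite !dif; split; apply: le_trans (imC_le _); rewrite /= ler_normr; lra.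
have hv y : m <= cabs (mkC a y - mkC p q) /\ m <= cabs (mkC b y - mkC p q).
  rewrite !dif; split; apply: le_trans (reC_le _); rewrite /= ler_normr; lra.
have nz z : m <= cabs (z - mkC p q) -> z != mkC p q.
  by move=> hz; rewrite -subr_eq0 -cabs_gt0; exact: lt_le_trans hz.
have kc x : a <= x <= b -> derivable k (mkC x c) 1.
  by move=> hx; apply: dk; rewrite ?lexx ?cd//; apply: nz; have [] := hb x.
have kd x : a <= x <= b -> derivable k (mkC x d) 1.
  by move=> hx; apply: dk; rewrite ?lexx ?cd//; apply: nz; have [] := hb x.
have ka y : c <= y <= d -> derivable k (mkC a y) 1.
  by move=> hx; apply: dk; rewrite ?lexx ?ab//; apply: nz; have [] := hv y.
have kb y : c <= y <= d -> derivable k (mkC b y) 1.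
  by move=> hx; apply: dk; rewrite ?lexx ?ab//; apply: nz; have [] := hv y.
have ivalZ u s t : cont_on u s t -> m * ival u s t = ival (fun x => m * u x) s t.
  by move=> Hu; rewrite /ival RintegralZl//; exact: cont_on_integrable.
have contZ u s t : cont_on u s t -> cont_on (fun x => m * u x) s t.
  by move=> Hu x xs; apply: continuousM; [exact: cst_continuous|exact: Hu].
have contD (u v : R -> R) s t : cont_on u s t -> cont_on v s t -> cont_on (fun x => u x + v x) s t.
  by move=> Hu Hv x xs; apply: continuousD; [exact: Hu|exact: Hv].
have comb (z w : Cplx R) : m <= cabs (z - mkC p q) -> m <= cabs (w - mkC p q) ->
    m * (imC (h z) - imC (h w)) <= cabs (k z) + cabs (k w) /\
    m * (reC (h z) - reC (h w)) <= cabs (k z) + cabs (k w).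
  move=> /est hz /est hw.
  have e1 : m * (imC (h z)) <= m * cabs (h z).
    by apply: ler_wpM2l; [exact: ltW|exact: le_trans (ler_norm _) (imC_le _)].
  have e2 : m * (- imC (h w)) <= m * cabs (h w).
    by apply: ler_wpM2l; [exact: ltW|apply: le_trans (imC_le _); rewrite -normrN; exact: ler_norm].
  have e3 : m * (reC (h z)) <= m * cabs (h z).
    by apply: ler_wpM2l; [exact: ltW|exact: le_trans (ler_norm _) (reC_le _)].
  have e4 : m * (- reC (h w)) <= m * cabs (h w).
    by apply: ler_wpM2l; [exact: ltW|apply: le_trans (reC_le _); rewrite -normrN; exact: ler_norm].
  clear -hz hw e1 e2 e3 e4; rewrite !mulrBr; split; lra.
have c1 : cont_on (fun x => imC (h (mkC x c)) - imC (h (mkC x d))) a b.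
  have h1 x (hx : a <= x <= b) := ch _ (nz _ (proj1 (hb x))) (kc x hx).
  have h2 x (hx : a <= x <= b) := ch _ (nz _ (proj2 (hb x))) (kd x hx).
  exact: cont_onB (cont_side_h h1) (cont_side_h h2).
have c2 : cont_on (fun y => reC (h (mkC b y)) - reC (h (mkC a y))) c d.
  have h1 y (hy : c <= y <= d) := ch _ (nz _ (proj1 (hv y))) (ka y hy).
  have h2 y (hy : c <= y <= d) := ch _ (nz _ (proj2 (hv y))) (kb y hy).
  exact: cont_onB (cont_side_v h2) (cont_side_v h1).
rewrite /bdint mulrDr !ivalZ//; apply: lerD; apply: ival_le.
- exact: contZ.
- apply: contD; apply: cont_abs_h => x hx; apply: derivable_cont; [exact: kc|exact: kd].
- by move=> x hx; have [u v] := hb x; have [] := comb _ _ u v.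
- exact: contZ.
- apply: contD; apply: cont_abs_v => y hy; apply: derivable_cont; [exact: ka|exact: kb].
- move=> y hy; rewrite (addrC (cabs _)); have [u v] := hv y.
  by have [] := comb _ _ v u.
Qed.

(* Cauchy's formula without its exact constant: rotate so that the value at
   the centre is nonnegative, shrink the contour to a small square. *)
Lemma center_le_bdabs k p q a b c d m : 0 < m ->
  a <= p - m -> p + m <= b -> c <= q - m -> q + m <= d ->
  (forall x y, a <= x <= b -> c <= y <= d -> mkC x y != mkC p q ->
     derivable k (mkC x y) 1) ->
  {for mkC p q, continuous k} ->
  4 * m * cabs (k (mkC p q)) <= bdabs k a b c d.
Proof.
move=> m0 ap pb cq qd dk ck; set K := k (mkC p q).
have [K0|K0] := eqVneq K 0.
  rewrite K0 cabs0 mulr0 /bdabs addr_ge0//;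
   by apply: Rintegral_ge0 => x _; rewrite addr_ge0// cabs_ge0.
have cK : 0 < cabs K by rewrite cabs_gt0.
pose w : Cplx R := (conjc (K : R[i]) : Cplx R) / mkC (cabs K) 0.
have cw : cabs w = 1.
  rewrite /w cabsM cabsV cabs_real (ger0_norm (cabs_ge0 _)).
  have -> : cabs (conjc (K : R[i]) : Cplx R) = cabs K.
    by rewrite !cabsE; case: (K) => x y; rewrite /reC/imC/= sqrrN.
  by rewrite divff// gt_eqF.
have wK : w * K = mkC (cabs K) 0.
  have nz : mkC (cabs K) 0 != 0 :> Cplx R by rewrite -cabs_gt0 cabs_real normr_gt0 gt_eqF.
  apply: (mulIf nz); rewrite /w mulrAC divfK// mulrC conjC_mul.
  by apply: eqC; rewrite ?reCM ?imCM/=; ring.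
pose k' z := w * k z.
have dk' x y : a <= x <= b -> c <= y <= d -> mkC x y != mkC p q ->
    derivable k' (mkC x y) 1.
  by move=> hx hy hxy; exact (dC_mul (dC_cst w _) (dk x y hx hy hxy)).
have ck' : {for mkC p q, continuous k'}.
  by exact (cC_mul (cC_cst w _) ck).
have -> : bdabs k a b c d = bdabs k' a b c d.
  have E z : cabs (k z) = cabs (k' z) by rewrite /k' cabsM cw mul1r.
  by rewrite /bdabs; congr (_ + _); congr ival; apply/funext => x; rewrite !E.
apply: le_trans (bdint_le_abs m0 ap pb cq qd dk').
rewrite mulrAC mulrC; apply: ler_wpM2l; first exact: ltW.
(* [bdint_small_ge] loses 8 times the oscillation of [k']; an oscillation of [eta / 8] therefore
   costs [eta]. *)
apply/ler_addgt0Pr => eta eta0.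
have eta8 : 0 < eta / 8 by rewrite divr_gt0.
have [dl dl0 Hdl] := (continuousCP _ _).1 ck' _ eta8.
(* Points of the square of half-side [e] are within [2 * e <= dl / 2] of the centre, where
   continuity controls [k']. *)
pose e := Num.min m (dl / 4).
have e0 : 0 < e by rewrite lt_min m0 divr_gt0.
have em : e <= m by rewrite ge_min lexx.
have ed : e <= dl / 4 by rewrite ge_min lexx orbT.
have ape : a <= p - e by lra.
have pbe : p + e <= b by lra.
have cqe : c <= q - e by lra.
have qde : q + e <= d by lra.
have dh x y : a <= x <= b -> c <= y <= d -> mkC x y != mkC p q ->
    derivable (fun z => k' z / (z - mkC p q)) (mkC x y) 1.
  move=> hx hy hxy.
  have -> : (fun z => k' z / (z - mkC p q)) = fun z => w * k z / (z - mkC p q) by [].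
  exact (dC_divB w hxy (dk x y hx hy hxy)).
rewrite (bdint_deform e0 ape pbe cqe qde dh).
have sx x : p - e <= x <= p + e -> a <= x <= b.
  by move=> /andP[? h1]; rewrite (le_trans ape)// (le_trans h1).
have sy y : q - e <= y <= q + e -> c <= y <= d.
  by move=> /andP[? h1]; rewrite (le_trans cqe)// (le_trans h1).
have := @bdint_small_ge k' p q e (cabs K) (eta / 8) e0 (ltW cK).
have H1 x y : mkC x y != mkC p q -> p - e <= x <= p + e -> q - e <= y <= q + e ->
     {for mkC x y, continuous (fun z => k' z / (z - mkC p q))}.
  by move=> hxy hx hy; apply: derivable_cont; apply: dh => //; [exact: sx|exact: sy].
have H2 x y : p - e <= x <= p + e -> q - e <= y <= q + e ->
     cabs (k' (mkC x y) - mkC (cabs K) 0) <= eta / 8.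
  move=> hx hy; rewrite -wK; apply/ltW/Hdl; apply: le_lt_trans (cabs_le _) _.
  have -> : mkC x y - mkC p q = mkC (x - p) (y - q) by [].
  rewrite /=; have -> : dl = dl / 2 + dl / 2 by lra.
  have h (s t : R) : t - e <= s <= t + e -> `|s - t| < dl / 2.
    by move=> hs; rewrite ltr_norml; lra.
  by apply: ltrD; exact: h.
move=> /(_ H1 H2); lra.
Qed.

(** The boundary has length [8 * t] and [center_le_bdabs] divides by [4 * t], whence the 2. Mere
    continuity at the centre lets difference quotients in. *)
Lemma center_le_max k p q t (M : R) : 0 < t ->
  (forall x y, p - t <= x <= p + t -> q - t <= y <= q + t -> mkC x y != mkC p q ->
     derivable k (mkC x y) 1) ->
  {for mkC p q, continuous k} ->
  (forall x y, p - t <= x <= p + t -> q - t <= y <= q + t ->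
    t <= cabs (mkC x y - mkC p q) -> cabs (k (mkC x y)) <= M) ->
  cabs (k (mkC p q)) <= 2 * M.
Proof.
move=> t0 dk ck H.
have ee : p - t <= p + t by lra.
have ee' : q - t <= q + t by lra.
have hb x : t <= cabs (mkC x (q - t) - mkC p q) /\ t <= cabs (mkC x (q + t) - mkC p q).
  split; apply: le_trans (imC_le _); rewrite /= ler_normr; lra.
have hv y : t <= cabs (mkC (p - t) y - mkC p q) /\ t <= cabs (mkC (p + t) y - mkC p q).
  split; apply: le_trans (reC_le _); rewrite /= ler_normr; lra.
have nz z : t <= cabs (z - mkC p q) -> z != mkC p q.
  by move=> hz; rewrite -subr_eq0 -cabs_gt0; exact: lt_le_trans hz.
have contD (u v : R -> R) s r : cont_on u s r -> cont_on v s r -> cont_on (fun x => u x + v x) s r.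
  by move=> Hu Hv x xs; apply: continuousD; [exact: Hu|exact: Hv].
have := center_le_bdabs t0 (lexx _) (lexx _) (lexx _) (lexx _) dk ck.
have B1 : ival (fun x => cabs (k (mkC x (q - t))) + cabs (k (mkC x (q + t)))) (p - t) (p + t) <= (M + M) * (p + t - (p - t)).
  apply: ival_le_cst => //.
    by apply: contD; apply: cont_abs_h => x hx; apply: derivable_cont; apply: dk;
       rewrite ?lexx ?ee'//; apply: nz; have [] := hb x.
  move=> x hx; have [h1 h2] := hb x.
  by apply: lerD; apply: H; rewrite ?lexx ?ee'.
have B2 : ival (fun y => cabs (k (mkC (p - t) y)) + cabs (k (mkC (p + t) y))) (q - t) (q + t) <= (M + M) * (q + t - (q - t)).
  apply: ival_le_cst => //.
    by apply: contD; apply: cont_abs_v => x hx; apply: derivable_cont; apply: dk;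
       rewrite ?lexx ?ee//; apply: nz; have [] := hv x.
  move=> x hx; have [h1 h2] := hv x.
  by apply: lerD; apply: H; rewrite ?lexx ?ee.
rewrite /bdabs => B3; have := le_trans B3 (lerD B1 B2).
have -> : (M + M) * (p + t - (p - t)) + (M + M) * (q + t - (q - t)) = 4 * t * (2 * M) by ring.
by rewrite ler_pM2l// mulr_gt0.
Qed.

End CenterEstimate.

(** * Continuous real functions of a complex variable and their maxima *)

Section RealContinuity.
Variable R : realType.
Implicit Types (u v : Cplx R -> R) (k : Cplx R -> Cplx R) (z : Cplx R).

(** Phrased with the modulus so that [rcont_pair] can carry it over to [R * R], where compactness
    and area measure are taken. *)
Definition rcont u z := forall e : R, 0 < e -> exists2 d : R, 0 < d &
  forall w, cabs (w - z) < d -> `|u w - u z| < e.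

Lemma rcont_abs k z : {for z, continuous k} -> rcont (fun x => cabs (k x)) z.
Proof.
move=> /continuousCP H e /H[d d0 Hd]; exists d => // w /Hd; apply: le_lt_trans.
rewrite ler_norml; have := cabsB (k w) (k z); have := cabsB (k z) (k w).
rewrite (cabsBC (k z)); lra.
Qed.

Lemma rcont_pair u x y : rcont u (mkC x y) ->
  {for (x, y), continuous (fun p : R * R => u (mkC p.1 p.2))}.
Proof.
move=> H; apply/cvgrPdist_lt => e /H[d d0 Hd].
exists (ball x (d / 2), ball y (d / 2)).
  by split; apply: nbhsx_ballx; rewrite divr_gt0.
move=> [s t] [/= h1 h2]; rewrite distrC; apply: Hd.
apply: le_lt_trans (cabs_le _) _; move: h1 h2; rewrite /ball/= => h1 h2.
by rewrite (splitr d); apply: ltrD; rewrite distrC.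
Qed.

Lemma rcont_cst (c : R) z : rcont (fun=> c) z.
Proof. by move=> e e0; exists 1 => // w _; rewrite subrr normr0. Qed.

Lemma rcontD u v z : rcont u z -> rcont v z -> rcont (fun w => u w + v w) z.
Proof.
move=> Hu Hv e e0; have e2 : 0 < e / 2 by rewrite divr_gt0.
have [d1 d10 H1] := Hu _ e2; have [d2 d20 H2] := Hv _ e2.
exists (Num.min d1 d2); first by rewrite lt_min d10.
move=> w; rewrite lt_min => /andP[/H1 h1 /H2 h2].
rewrite (splitr e) opprD addrACA; apply: le_lt_trans (ler_normD _ _) _.
exact: ltrD.
Qed.

Lemma rcontM u v z : rcont u z -> rcont v z -> rcont (fun w => u w * v w) z.
Proof.
move=> Hu Hv e e0; pose K := `|u z| + `|v z| + 1.
have K0 : 0 < K by rewrite /K; have := normr_ge0 (u z); have := normr_ge0 (v z); lra.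
pose e' := Num.min 1 (e / (2 * K)).
have e'0 : 0 < e' by rewrite lt_min ltr01/= divr_gt0// mulr_gt0.
have e'1 : e' <= 1 by rewrite ge_min lexx.
have e'K : e' <= e / (2 * K) by rewrite ge_min lexx orbT.
have [d1 d10 H1] := Hu _ e'0; have [d2 d20 H2] := Hv _ e'0.
exists (Num.min d1 d2); first by rewrite lt_min d10.
move=> w; rewrite lt_min => /andP[/H1 h1 /H2 h2].
have -> : u w * v w - u z * v z = (u w - u z) * (v w - v z) + (u w - u z) * v z + u z * (v w - v z) by ring.
apply: (@le_lt_trans _ _ (e' * 1 + e' * `|v z| + `|u z| * e')).
  apply: le_trans (ler_normD _ _) _; apply: lerD; last by rewrite normrM ler_wpM2l// ltW.
  apply: le_trans (ler_normD _ _) _; apply: lerD; last by rewrite normrM ler_wpM2r// ltW.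
  by rewrite normrM ler_pM// ltW// (lt_le_trans h2).
have -> : e' * 1 + e' * `|v z| + `|u z| * e' = e' * K by rewrite /K; ring.
have : e' * K <= e / (2 * K) * K by rewrite ler_wpM2r// ltW.
move=> /le_lt_trans; apply; rewrite invfM mulrA divfK ?gt_eqF//; lra.
Qed.

End RealContinuity.

Section ExtremeValue.
Variable R : realType.
Implicit Types (u : Cplx R -> R).

Lemma rect_max u (a b c d : R) : a <= b -> c <= d ->
  (forall x y, a <= x <= b -> c <= y <= d -> rcont u (mkC x y)) ->
  exists x y, [/\ a <= x <= b, c <= y <= d &
    forall s t, a <= s <= b -> c <= t <= d -> u (mkC s t) <= u (mkC x y)].
Proof.
move=> ab cd H.
have [|||p] := @compact_EVT_max (R * R)%type R (fun p => u (mkC p.1 p.2)) (`[a, b] `*` `[c, d]).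
- by exists (a, c); split; rewrite /= in_itv/= lexx.
- by apply: compact_setX; exact: segment_compact.
- apply: continuous_in_subspaceT => -[x y]; rewrite inE => -[/= hx hy].
  by move: hx hy; rewrite !in_itv/= => hx hy; exact: (rcont_pair (H _ _ hx hy)).
case: p => x y; rewrite inE => -[/=]; rewrite !in_itv/= => hx hy Hm.
exists x, y; split => // s t hs ht; apply: (Hm (s, t)).
by rewrite inE; split; rewrite /= in_itv.
Qed.

Lemma disk_max u (r : R) : 0 <= r ->
  (forall z, cabs z <= r -> rcont u z) ->
  exists2 z, cabs z <= r & forall w, cabs w <= r -> u w <= u z.
Proof.
move=> r0 H; pose A := [set p : R * R | cabs (mkC p.1 p.2) <= r].
have [|||p] := @compact_EVT_max (R * R)%type R (fun p => u (mkC p.1 p.2)) A.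
- have A0 : cabs (mkC (0 : R) 0) <= r by rewrite cabs_real normr0.
  by exists (0 : R, 0 : R).
- apply: (subclosed_compact _ (compact_setX (@segment_compact R (-r) r) (@segment_compact R (-r) r))).
    have -> : A = (fun p : R * R => cabs (mkC p.1 p.2)) @^-1` [set x | x <= r] by [].
    apply: preimage_closed; last exact: closed_le.
    move=> [x y] _; apply: rcont_pair => e e0; exists e => // w; apply: le_lt_trans.
    rewrite ler_norml; have := cabsB w (mkC x y); have := cabsB (mkC x y) w.
    rewrite (cabsBC (mkC x y)); lra.
  move=> [x y]; rewrite /A/= => hr; split => /=; rewrite in_itv/= -ler_norml.
    exact: le_trans (reC_le (mkC x y)) hr.
  exact: le_trans (imC_le (mkC x y)) hr.
- apply: continuous_in_subspaceT => -[x y]; rewrite inE => hxy.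
  exact: (rcont_pair (H _ hxy)).
case: p => x y; rewrite inE => hxy Hm; exists (mkC x y) => // w hw.
by case: w hw => s t hw; exact: (Hm (s, t) (mem_set hw)).
Qed.

End ExtremeValue.

(** * Measurability in the plane and the area mean of a holomorphic function *)

Section PlaneMeasure.
Variable R : realType.
Implicit Types (u : Cplx R -> R) (U : set (R * R)).
Local Notation mu := (@lebesgue_measure R).

(** The product sigma-algebra contains boxes, and an open set is the countable union of the boxes
    with rational centre and half-side [1 / (n + 1)] that it contains. *)
Lemma open_measurable_plane U : open U ->
  measurable (U : set (measurableTypeR R * measurableTypeR R)).
Proof.
move=> oU; pose box (r s : rat) (n : nat) : set (measurableTypeR R * measurableTypeR R) :=
  `]ratr r - n.+1%:R^-1, ratr r + n.+1%:R^-1[ `*` `]ratr s - n.+1%:R^-1, ratr s + n.+1%:R^-1[.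
have -> : (U : set (measurableTypeR R * measurableTypeR R)) = \bigcup_r \bigcup_s \bigcup_n
    (if `[< box r s n `<=` U >] then box r s n else set0).
  apply/seteqP; split; last first.
    by move=> xy [r _ [s _ [n _]]]; case: asboolP => // h /h.
  move=> [x y] Uxy; have /nbhs_ballP[e /= e0 He] : nbhs (x, y) U by exact: open_nbhs_nbhs.
  pose n := Num.truncn (2 / e).
  have n0 : 0 < n.+1%:R^-1 :> R by rewrite invr_gt0.
  have ne : n.+1%:R^-1 + n.+1%:R^-1 < e.
    have /truncn_itv : 0 <= 2 / e by rewrite divr_ge0// ltW.
    rewrite -/n => /andP[_]; rewrite ltr_pdivrMr// => h.
    have -> : n.+1%:R^-1 + n.+1%:R^-1 = 2 / n.+1%:R :> R by rewrite mulrDl mul1r.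
    by rewrite ltr_pdivrMr// mulrC.
  have dens (t : R) : exists r : rat, t - n.+1%:R^-1 < ratr r < t + n.+1%:R^-1.
    have /rat_in_itvoo[r] : t - n.+1%:R^-1 < t + n.+1%:R^-1 by rewrite ltrBlDr -addrA ltrDl addr_gt0.
    by rewrite in_itv; exists r.
  have flip (d t v : R) : t - d < v < t + d -> v - d < t < v + d by lra.
  have near_rat (d t v w : R) : d + d < e -> t - d < v < t + d -> v - d < w < v + d -> `|t - w| < e.
    by move=> h1 h2 h3; rewrite ltr_norml; lra.
  have {}near_rat t v w := near_rat _ t v w ne.
  have [r hr] := dens x; have [s hs] := dens y.
  exists r => //; exists s => //; exists n => //.
  case: asboolP => [_|[]].
    by split; rewrite /= in_itv/=; exact: flip.
  move=> [x' y'] [/=]; rewrite !in_itv/= => hx hy.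
  by apply: He; split; rewrite /ball/=; [exact: near_rat hr hx|exact: near_rat hs hy].
apply: bigcupT_measurable_rat => r; apply: bigcupT_measurable_rat => s.
apply: bigcupT_measurable => n; case: ifP => _; last exact: measurable0.
by apply: measurableX; exact: measurable_itv.
Qed.

Lemma measurable_rcont u U : open U ->
  (forall p, U p -> rcont u (mkC p.1 p.2)) ->
  measurable_fun (U : set (measurableTypeR R * measurableTypeR R))
    (fun p : measurableTypeR R * measurableTypeR R => u (mkC p.1 p.2)).
Proof.
move=> oU H; apply: (measurability _ (RGenOInfty.measurableE R)).
move=> _ [_ [a ->] <-]; apply: open_measurable_plane.
rewrite openE => -[x y] [Uxy /=]; rewrite in_itv/= andbT => hxy.
rewrite /interior; have Uo : nbhs (x, y) U by exact: open_nbhs_nbhs.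
have /cvgrPdist_lt := rcont_pair (H _ Uxy) => Hc.
have ua : 0 < u (mkC x y) - a by rewrite subr_gt0.
have := Hc _ ua => /(filterI Uo); apply: filterS => -[s t] [/= Ust h].
by split => //=; rewrite in_itv/= andbT; move: h; rewrite ltr_norml; lra.
Qed.

(** Chebyshev's argument: above this level on all of [[a, b]], [F] would have an integral larger
    than [I]; [eta] makes the contradiction strict. *)
Lemma exists_le_mean (F : measurableTypeR R -> \bar R) (a b I eta : R) : a < b -> 0 < eta ->
  measurable_fun setT F -> (forall x, 0 <= F x)%E ->
  (\int[mu]_x F x <= I%:E)%E ->
  exists2 x, a <= x <= b & (F x <= (I / (b - a) + eta)%:E)%E.
Proof.
move=> ab eta0 mF F0 FI; apply: contrapT => Hn.
have I0 : 0 <= I.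
  by rewrite -lee_fin; apply: le_trans FI; apply: integral_ge0.
have ba : 0 < b - a by rewrite subr_gt0.
pose c := I / (b - a) + eta.
have c0 : 0 <= c by rewrite addr_ge0 ?divr_ge0// ltW.
have : ((c * (b - a))%:E <= I%:E)%E.
  apply: le_trans FI.
  apply: (@le_trans _ _ (\int[mu]_(x in `[a, b]) F x)%E); last first.
    by apply: ge0_subset_integral => //; exact: measurable_itv.
  apply: (@le_trans _ _ (\int[mu]_(x in `[a, b]) (cst c%:E) x)%E).
    rewrite integral_cst//= lebesgue_measure_itv/= lte_fin ab -EFinB -EFinM.
    by rewrite lee_fin.
  apply: ge0_le_integral => //.
  - exact: measurable_funTS.
  - move=> x; rewrite /= in_itv/= => hx; rewrite leNgt; apply/negP => /ltW h.
    by apply: Hn; exists x.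
rewrite lee_fin /c mulrDl divfK ?gt_eqF//.
have := mulr_gt0 eta0 ba; lra.
Qed.

Lemma ival_EFin (u : R -> R) a b : cont_on u a b ->
  ((ival u a b)%:E = \int[mu]_(x in `[a, b]) (u x)%:E)%E.
Proof.
move=> /cont_on_integrable Hu; rewrite /ival /Rintegral fineK//.
exact: integrable_fin_num.
Qed.

(** The four sides of a rectangle are chosen in the outer strips of width [r / 2], each on a line
    where the integral of [|k|] is at most about its mean. The centre stays at distance [r / 2] from
    them, so [center_le_bdabs] applies. *)
Lemma area_mean (U : set (Cplx R)) (k : Cplx R -> Cplx R) (p q r : R) :
  open U -> holomorphic_on U k -> 0 < r ->
  (forall x y, p - r <= x <= p + r -> q - r <= y <= q + r -> U (mkC x y)) ->
  ((r ^+ 2 * cabs (k (mkC p q)))%:E <=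
   4%:E * \int[mu \x mu]_(xy in `[(p - r)%R, (p + r)%R] `*` `[(q - r)%R, (q + r)%R])
            (cabs (k (mkC xy.1 xy.2)))%:E)%E.
Proof.
move=> oU hk r0 SU.
pose S : set (measurableTypeR R * measurableTypeR R) := `[p - r, p + r] `*` `[q - r, q + r].
have mS : measurable S by apply: measurableX; exact: measurable_itv.
pose g (xy : measurableTypeR R * measurableTypeR R) := (cabs (k (mkC xy.1 xy.2)))%:E.
have kc x y : p - r <= x <= p + r -> q - r <= y <= q + r -> {for mkC x y, continuous k}.
  by move=> hx hy; exact: (derivable_cont (hk _ (SU _ _ hx hy))).
pose V : set (R * R) := [set xy | U (mkC xy.1 xy.2)].
have oV : open V.
  rewrite openE => -[x y] /((openCP _).1 oU)[e e0 He]; apply/nbhs_ballP.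
  exists (e / 2); first by rewrite /= divr_gt0.
  move=> [s t] [/= h1 h2]; apply: He; apply: le_lt_trans (cabs_le _) _.
  by move: h1 h2; rewrite /ball/= => h1 h2; rewrite (splitr e); apply: ltrD; rewrite distrC.
have mg : measurable_fun S g.
  apply/measurable_EFinP.
  apply: (measurable_funS (open_measurable_plane oV)); last first.
    exact: (measurable_rcont (u := fun z => cabs (k z)) oV
      (fun xy Vxy => rcont_abs (derivable_cont (hk _ Vxy)))).
  by move=> [x y] [/=]; rewrite !in_itv/=; exact: SU.
(* Extension by 0, so that Tonelli's theorem can be used on the whole plane. *)
pose G := g \_ S.
have mG : measurable_fun setT G by have /(measurable_restrictT _ mS) := mg.
have G0 xy : (0 <= G xy)%E by rewrite /G patchE; case: ifP => // _; rewrite lee_fin cabs_ge0.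
rewrite -/S (_ : (\int[_]_(xy in S) _)%E = (\int[mu \x mu]_xy G xy)%E); last by rewrite integral_mkcond.
set I := (\int[mu \x mu]_xy G xy)%E.
have I0 : (0 <= I)%E by apply: integral_ge0.
have [->|Ifin] := eqVneq I +oo%E; first by rewrite gt0_muley ?leey// lte_fin.
have If : I \is a fin_num by rewrite ge0_fin_numE// ltey.
rewrite -(fineK If) -EFinM lee_fin; set J := fine I.
pose F x := (\int[mu]_y G (x, y))%E; pose H y := (\int[mu]_x G (x, y))%E.
have mF : measurable_fun setT F by exact: measurable_fun_fubini_tonelli_F mG G0.
have mH : measurable_fun setT H by exact: measurable_fun_fubini_tonelli_G mG G0.
have IF : (\int[mu]_x F x <= J%:E)%E by rewrite /J fineK// /I fubini_tonelli1.
have IH : (\int[mu]_y H y <= J%:E)%E.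
  by apply: le_trans IF; rewrite le_eqVlt -(fubini_tonelli _ mG G0) eqxx.
have F0 x : (0 <= F x)%E by apply: integral_ge0.
have H0 x : (0 <= H x)%E by apply: integral_ge0.
have r2 : 0 < r / 2 by rewrite divr_gt0.
have FE a c d : p - r <= a <= p + r -> q - r <= c -> d <= q + r ->
    ((ival (fun y => cabs (k (mkC a y))) c d)%:E <= F a)%E.
  move=> ha hc hd.
  have cc : cont_on (fun y => cabs (k (mkC a y))) (q - r) (q + r).
    by apply: cont_abs_v => y hy; exact: kc.
  rewrite ival_EFin; last exact: cont_onS cc.
  rewrite /F (_ : (\int[mu]_y _)%E = (\int[mu]_(y in `[(q - r)%R, (q + r)%R]) (cabs (k (mkC a y)))%:E)%E); last first.
    rewrite [RHS]integral_mkcond; apply: eq_integral => y _; rewrite /G !patchE.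
    by rewrite /S in_setX/= (_ : a \in _) //= mem_setE in_itv/=.
  apply: ge0_subset_integral => //.
  - exact: (measurable_int mu (cont_on_integrable cc)).
  - by move=> y _; rewrite lee_fin cabs_ge0.
  - by apply: subset_itv; rewrite bnd_simp.
have HE c a b : q - r <= c <= q + r -> p - r <= a -> b <= p + r ->
    ((ival (fun x => cabs (k (mkC x c))) a b)%:E <= H c)%E.
  move=> ha hc hd.
  have cc : cont_on (fun y => cabs (k (mkC y c))) (p - r) (p + r).
    by apply: cont_abs_h => y hy; exact: kc.
  rewrite ival_EFin; last exact: cont_onS cc.
  rewrite /H (_ : (\int[mu]_y _)%E = (\int[mu]_(y in `[(p - r)%R, (p + r)%R]) (cabs (k (mkC y c)))%:E)%E); last first.
    rewrite [RHS]integral_mkcond; apply: eq_integral => y _; rewrite /G !patchE.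
    by rewrite /S in_setX/= (_ : c \in `[_, _]%classic) ?andbT //= mem_setE in_itv/=.
  apply: ge0_subset_integral => //.
  - exact: (measurable_int mu (cont_on_integrable cc)).
  - by move=> y _; rewrite lee_fin cabs_ge0.
  - by apply: subset_itv; rewrite bnd_simp.
(* Four sides with slack [eta / (2 * r)] each, multiplied by [r / 2] at the end, give exactly
   [eta]. *)
apply/ler_addgt0Pr => eta eta0; have eta4 : 0 < eta / (2 * r) by rewrite divr_gt0// mulr_gt0.
have [a ha Fa] := exists_le_mean (a := p - r) (b := p - r / 2) ltac:(lra) eta4 mF F0 IF.
have [b hb Fb] := exists_le_mean (a := p + r / 2) (b := p + r) ltac:(lra) eta4 mF F0 IF.
have [c hc Hc] := exists_le_mean (a := q - r) (b := q - r / 2) ltac:(lra) eta4 mH H0 IH.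
have [d hd Hd] := exists_le_mean (a := q + r / 2) (b := q + r) ltac:(lra) eta4 mH H0 IH.
have half1 (t : R) : t - r / 2 - (t - r) = r / 2 by clear; lra.
have half2 (t : R) : t + r - (t + r / 2) = r / 2 by clear; lra.
rewrite half1 in Fa; rewrite half1 in Hc; rewrite half2 in Fb; rewrite half2 in Hd.
have center (t : R) : t - r <= t <= t + r by rewrite gerBl lerDl ltW.
have low (t s : R) : s <= t - r / 2 -> s <= t + r.
  by move=> h; apply: le_trans h _; clear -r0; lra.
have high (t s : R) : t + r / 2 <= s -> t - r <= s.
  by move=> h; apply: le_trans h; clear -r0; lra.
have [a1 a2] : p - r <= a /\ a <= p - r / 2 by move/andP: ha.
have [b1 b2] : p + r / 2 <= b /\ b <= p + r by move/andP: hb.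
have [c1 c2] : q - r <= c /\ c <= q - r / 2 by move/andP: hc.
have [d1 d2] : q + r / 2 <= d /\ d <= q + r by move/andP: hd.
have a3 : p - r <= a <= p + r by rewrite a1/= low.
have b3 : p - r <= b <= p + r by rewrite b2 andbT high.
have c3 : q - r <= c <= q + r by rewrite c1/= low.
have d3 : q - r <= d <= q + r by rewrite d2 andbT high.
have e1 := le_trans (FE a c d a3 c1 d2) Fa.
have e2 := le_trans (FE b c d b3 c1 d2) Fb.
have e3 := le_trans (HE c a b c3 a1 b2) Hc.
have e4 := le_trans (HE d a b d3 a1 b2) Hd.
rewrite !lee_fin in e1 e2 e3 e4.
have sx x : a <= x <= b -> p - r <= x <= p + r.
  by move=> /andP[? h]; rewrite (le_trans a1)//= (le_trans h).
have sy x : c <= x <= d -> q - r <= x <= q + r.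
  by move=> /andP[? h]; rewrite (le_trans c1)//= (le_trans h).
have := @center_le_bdabs R k p q a b c d (r / 2) r2 a2 b1 c2 d1.
move=> /(_ (fun x y hx hy _ => hk _ (SU _ _ (sx x hx) (sy y hy)))).
move=> /(_ (kc _ _ (center p) (center q))).
have ivalD (u v : R -> R) s t : cont_on u s t -> cont_on v s t ->
    ival (fun x => u x + v x) s t = ival u s t + ival v s t.
  by move=> Hu Hv; rewrite /ival RintegralD//; exact: cont_on_integrable.
rewrite /bdabs !ivalD; first last.
- by apply: cont_abs_h => x hx; apply: kc => //; exact: sx.
- by apply: cont_abs_h => x hx; apply: kc => //; exact: sx.
- by apply: cont_abs_v => x hx; apply: kc => //; exact: sy.
- by apply: cont_abs_v => x hx; apply: kc => //; exact: sy.
move=> Hm; have {}Hm : 4 * (r / 2) * cabs (k (mkC p q)) <= 4 * (J / (r / 2) + eta / (2 * r)).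
  by apply: le_trans Hm _; clear -e1 e2 e3 e4; lra.
have := ler_wpM2l (ltW r2) Hm.
have -> : r / 2 * (4 * (r / 2) * cabs (k (mkC p q))) = r ^+ 2 * cabs (k (mkC p q)) by field.
have -> : r / 2 * (4 * (J / (r / 2) + eta / (2 * r))) = 4 * J + eta by field; rewrite gt_eqF.
by [].
Qed.

End PlaneMeasure.

Section Bernoulli.
Variable R : realType.

Lemma bernoulli (x : R) n : -1 <= x -> 1 + n%:R * x <= (1 + x) ^+ n.
Proof.
move=> x1; elim: n => [|n IH]; first by rewrite mul0r addr0 expr0.
have p : 0 <= 1 + x by lra.
apply: le_trans (_ : (1 + x) * (1 + n%:R * x) <= _); last by rewrite exprS ler_wpM2l.
rewrite -natr1; have n0 : 0 <= n%:R :> R by rewrite ler0n.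
have := mulr_ge0 n0 (sqr_ge0 x); rewrite expr2; nra.
Qed.

Lemma exists_expr_gt (x K : R) : 1 < x -> exists n, K < x ^+ n.
Proof.
move=> x1; pose n := Num.truncn (`|K| / (x - 1)); exists n.+1.
have x0 : 0 < x - 1 by lra.
have : -1 <= x - 1 by lra.
move=> /(bernoulli n.+1); rewrite (_ : 1 + (x - 1) = x); last by ring.
move=> /(lt_le_trans _); apply.
have /truncn_itv : 0 <= `|K| / (x - 1) by rewrite divr_ge0// ltW.
rewrite -/n => /andP[_]; rewrite ltr_pdivrMr// => h.
have := ler_norm K; lra.
Qed.

End Bernoulli.

(** * The maximum principle and the Schwarz lemma *)

Section MaxPrinciple.
Variable R : realType.
Implicit Types (G f phi : Cplx R -> Cplx R) (z w a b : Cplx R).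

(* A maximum [z] of [|G| (1 + delta |.|^2)] is a strict local maximum of the
   modulus of the holomorphic function [G w * (1 + b * (w - z)) ^+ 2]. *)
Lemma perturbed_sqr z h (delta : R) : 0 <= delta ->
  let A := 1 + delta * cabs z ^+ 2 in
  1 + delta * cabs (z + h) ^+ 2 =
  A * (cabs (1 + mkC (delta / A) 0 * (conjc z : Cplx R) * h) ^+ 2
       + delta / A ^+ 2 * cabs h ^+ 2).
Proof.
move=> d0 A; have A0 : A != 0.
  by rewrite gt_eqF// ltr_pwDl// mulr_ge0// exprn_ge0// cabs_ge0.
move: A0; rewrite /A !sqr_cabs; case: z {A} => x y; case: h => s t.
by rewrite !(reCD, imCD, reCM, imCM)/= /reC/imC/= => A0; field.
Qed.

Lemma disk_mem_cont f z : holomorphic_on (@unit_disk R) f -> cabs z < 1 -> {for z, continuous f}.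
Proof. by move=> hf hz; exact: (derivable_cont (hf z hz)). Qed.

(** Power trick: the centre estimate for [P ^+ n] reads [|P z|^n <= 2 q^n |P z|^n], which fails once
    [q^n < 1 / 2]. *)
Lemma strict_local_max P z (t q : R) : 0 < t -> 0 <= q -> q < 1 ->
  (forall w, cabs (w - z) <= 2 * t -> derivable P w 1) -> P z != 0 ->
  (forall w, t <= cabs (w - z) -> cabs (w - z) <= 2 * t -> cabs (P w) <= q * cabs (P z)) ->
  False.
Proof.
move=> t0 q0 q1 dP Pz H.
have Pz0 : 0 < cabs (P z) by rewrite cabs_gt0.
have key n : cabs (P z) ^+ n <= 2 * (q * cabs (P z)) ^+ n.
  have near (x y : R) : reC z - t <= x <= reC z + t -> imC z - t <= y <= imC z + t ->
      cabs (mkC x y - z) <= 2 * t.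
    move=> hx hy; apply: le_trans (cabs_le _) _; rewrite reCD imCD reCN imCN/=.
    have -> : 2 * t = t + t by lra.
    by apply: lerD; rewrite ler_norml; lra.
  have := @center_le_max R (fun w => P w ^+ n) (reC z) (imC z) t ((q * cabs (P z)) ^+ n) t0.
  rewrite mkCK cabsX; apply.
  - by move=> x y hx hy _; exact: (dC_exp n (dP _ (near x y hx hy))).
  - have hz : cabs (z - z) <= 2 * t by rewrite subrr cabs0; lra.
    exact: (derivable_cont (dC_exp n (dP _ hz))).
  - move=> x y hx hy hxy; rewrite cabsX; apply: lerXn2r; rewrite ?nnegrE ?cabs_ge0//.
      by rewrite mulr_ge0 ?cabs_ge0.
    by apply: H => //; exact: near.
have [q00|qn0] := eqVneq q 0.
  by have := key 1%N; rewrite q00 mul0r !expr1 mulr0; lra.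
have qp : 0 < q by rewrite lt0r qn0.
have q1' : 1 < q^-1 by rewrite invf_gt1.
have [n hn] := exists_expr_gt 2 q1'.
have : 1 <= 2 * q ^+ n.
  by rewrite -(ler_pM2r (exprn_gt0 n Pz0)) mul1r; have := key n; rewrite exprMn mulrA.
move: hn; rewrite exprVn -ltf_pV2 ?posrE ?invr_gt0 ?exprn_gt0// invrK; lra.
Qed.

(** A maximum of [|G|] alone need not be strict, while [strict_local_max] needs a definite drop on
    an annulus; the perturbation by [delta] supplies it. *)
Lemma max_principle G : holomorphic_on (@unit_disk R) G ->
  (forall e : R, 0 < e -> exists2 s : R, s < 1 &
     forall z, s <= cabs z -> cabs z < 1 -> cabs (G z) <= 1 + e) ->
  forall a, cabs a < 1 -> cabs (G a) <= 1.
Proof.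
move=> hG HB a a1; rewrite leNgt; apply/negP => Ga.
pose eta := (cabs (G a) - 1) / 2; have eta0 : 0 < eta by rewrite /eta; lra.
have GaE : cabs (G a) = 1 + 2 * eta by rewrite /eta; lra.
have [s s1 Hs] := HB _ eta0.
have as_ : cabs a < s.
  by rewrite ltNge; apply/negP => /Hs /(_ a1); rewrite GaE; lra.
(* Chosen so that [(1 + eta) * (1 + delta) = 1 + 3 * eta / 2] stays below [1 + 2 * eta]: the maximum
   of [u] is then not on the circle of radius [s]. *)
pose delta := eta / (2 * (1 + eta)).
have e1 : 0 < 2 * (1 + eta) by lra.
have delta0 : 0 < delta by rewrite divr_gt0.
have deltaE : delta * (2 * (1 + eta)) = eta by rewrite /delta divfK// gt_eqF.
have delta1 : delta < 1 by rewrite /delta ltr_pdivrMr//; lra.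
pose u z := cabs (G z) * (1 + delta * cabs z ^+ 2).
have cid (z : Cplx R) : rcont (@cabs R) z.
  move=> e e0; exists e => // w; apply: le_lt_trans.
  rewrite ler_norml; have := cabsB w z; have := cabsB z w; rewrite (cabsBC z); lra.
have cu z : cabs z <= s -> rcont u z.
  move=> hz; apply: rcontM.
    apply: rcont_abs; apply: (disk_mem_cont hG); exact: le_lt_trans hz s1.
  apply: rcontD; first exact: rcont_cst.
  apply: rcontM; first exact: rcont_cst.
  have -> : (fun w => cabs w ^+ 2) = fun w : Cplx R => cabs w * cabs w.
    by apply/funext => w; rewrite expr2.
  exact: rcontM.
have s0 : 0 <= s by apply: le_trans (ltW as_); exact: cabs_ge0.
have [z zs Hz] := disk_max s0 cu.
have ua : 1 + 2 * eta <= u z.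
  apply: le_trans (Hz a (ltW as_)); rewrite /u GaE; apply: ler_peMr; first lra.
  by rewrite lerDl mulr_ge0// ?(ltW delta0)// exprn_ge0// cabs_ge0.
have zs' : cabs z < s.
  rewrite lt_neqAle zs andbT; apply/eqP => zE.
  have : cabs (G z) <= 1 + eta by apply: Hs; rewrite ?zE.
  move=> /(ler_pM (cabs_ge0 _)) => /(_ (1 + delta * cabs z ^+ 2) (1 + delta)).
  have p1 : cabs z ^+ 2 <= 1 by rewrite zE exprn_ile1// ltW.
  have p2 : 0 <= delta * cabs z ^+ 2 by rewrite mulr_ge0// ?(ltW delta0)// exprn_ge0// cabs_ge0.
  have p3 : delta * cabs z ^+ 2 <= delta by rewrite ler_piMr// ltW.
  rewrite -/(u z) => /(_ _ _)/le_trans h.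
  have : u z <= (1 + eta) * (1 + delta).
    by apply: h => //; lra.
  lra.
pose A := 1 + delta * cabs z ^+ 2.
have A1 : 1 <= A by rewrite lerDl mulr_ge0// ?(ltW delta0)// exprn_ge0// cabs_ge0.
pose b : Cplx R := mkC (delta / A) 0 * (conjc z : Cplx R).
have cb : cabs b <= 1.
  rewrite /b cabsM cabs_real ger0_norm; last by rewrite divr_ge0; lra.
  have -> : cabs (conjc z : Cplx R) = cabs z by rewrite !cabsE; case: (z) => x y; rewrite /reC/imC/= sqrrN.
  have : delta / A <= 1 by rewrite ler_pdivrMr; lra.
  by move=> h; rewrite mulr_ile1 ?cabs_ge0//; [rewrite divr_ge0; lra|lra].
pose kappa := delta / A ^+ 2.
have kappa0 : 0 < kappa by rewrite divr_gt0// exprn_gt0//; lra.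
(* The disk of radius [2 * t] about [z] stays in the disk of radius [s], and [2 * t <= 1] gives
   [|1 + b (w - z)| <= 2]. *)
pose t := Num.min (1 / 2) ((s - cabs z) / 2).
have t0 : 0 < t by rewrite lt_min; apply/andP; split; lra.
have t2 : 2 * t <= 1 by have : t <= 1 / 2 by [rewrite ge_min lexx]; lra.
have ts : 2 * t <= s - cabs z by have : t <= (s - cabs z) / 2 by [rewrite ge_min lexx orbT]; lra.
(* With [X ^+ 2 <= 4], the extra term [kappa |w - z|^2 >= kappa t^2] of the completed square gains
   at least this factor over [X ^+ 2]. *)
pose q := 4 / (4 + kappa * t ^+ 2).
have kt : 0 < kappa * t ^+ 2 by rewrite mulr_gt0// exprn_gt0.
have q0 : 0 <= q by rewrite divr_ge0//; lra.
have q1 : q < 1 by rewrite ltr_pdivrMr; lra.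
have inD w : cabs (w - z) <= 2 * t -> cabs w <= s.
  by move=> hw; have := cabsD z (w - z); rewrite addrC subrK; lra.
pose P w := G w * (1 + b * (w - z)) ^+ 2.
have Pz : P z = G z by rewrite /P subrr mulr0 addr0 expr1n mulr1.
apply: (@strict_local_max P z t q) => //.
- move=> w /inD hw; have dG : derivable G w 1 by apply: hG; exact: le_lt_trans hw s1.
  exact (dC_mul dG (dC_exp 2 (dC_add (dC_cst 1 w) (dC_mul (dC_cst b w) (dC_sub (dC_id w) (dC_cst z w)))))).
- rewrite Pz -cabs_gt0 ltNge; apply/negP => h.
  have : cabs (G z) = 0 by apply/eqP; rewrite eq_le h cabs_ge0.
  by move: ua; rewrite /u => + E; rewrite E mul0r; lra.
move=> w tw wt; rewrite Pz.
have := Hz w (inD w wt); rewrite /u.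
have -> : w = z + (w - z) by rewrite addrC subrK.
rewrite (perturbed_sqr z (w - z) (ltW delta0)) -/A -/b -/kappa -/A.
rewrite (_ : cabs (G z) * (1 + _) = A * cabs (G z)); last by rewrite mulrC.
rewrite mulrCA ler_pM2l; last by lra.
rewrite /P (addrC z (w - z)) subrK; set X := cabs (1 + b * (w - z)); move=> hX.
have X2 : X <= 2.
  apply: le_trans (cabsD _ _) _; rewrite cabs1 cabsM.
  have : cabs b * cabs (w - z) <= 1 * 1.
    by apply: ler_pM => //; rewrite ?cabs_ge0//; lra.
  lra.
have X0 : 0 <= X by exact: cabs_ge0.
rewrite cabsM cabsX -/X.
have X4 : X ^+ 2 <= 4.
  have -> : 4 = 2 ^+ 2 :> R by rewrite expr2; lra.
  by rewrite lerXn2r ?nnegrE//; lra.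
have hk : kappa * t ^+ 2 <= kappa * cabs (w - z) ^+ 2.
  by rewrite ler_pM2l// lerXn2r ?nnegrE ?cabs_ge0// ltW.
rewrite /q mulrAC ler_pdivlMr; last by lra.
have X20 : 0 <= X ^+ 2 by rewrite exprn_ge0.
have G0 := cabs_ge0 (G w).
have h1 : X ^+ 2 * (4 + kappa * t ^+ 2) <= 4 * (X ^+ 2 + kappa * cabs (w - z) ^+ 2) by nra.
rewrite -mulrA; apply: le_trans (ler_wpM2l G0 h1) _.
by rewrite mulrCA ler_pM2l.
Qed.

(** Instead of [phi z / z], the maximum principle is applied to [phi ^+ (m + 2) / z ^+ m]: it is
    [O(|z|^2)] at 0, hence differentiable there with derivative 0. Letting [m] grow removes the two
    extra powers. *)
Lemma schwarz phi : holomorphic_on (@unit_disk R) phi ->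
  (forall z, cabs z < 1 -> cabs (phi z) < 1) -> phi 0 = 0 ->
  forall z, cabs z < 1 -> cabs (phi z) <= cabs z.
Proof.
move=> hphi Hphi phi0 z z1.
have D0 : cabs (0 : Cplx R) < 1 by rewrite cabs0.
have [K K0 [d d0 HK]] : exists2 K : R, 0 <= K & exists2 d : R, 0 < d &
    forall h, cabs h < d -> cabs (phi h) <= K * cabs h.
  have /derivableCP[l /(_ 1 ltr01)[d d0 Hd]] := hphi 0 D0.
  exists (1 + cabs l); first by rewrite addr_ge0 ?cabs_ge0.
  exists d => // h /Hd; rewrite add0r phi0 subr0 => hh.
  have := cabsB (phi h) (l * h); rewrite cabsM; lra.
have key m : cabs (phi z) ^+ (m + 2) <= cabs z ^+ m.
  pose G w := phi w ^+ (m + 2) / w ^+ m.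
  have hG : holomorphic_on (@unit_disk R) G.
    move=> w w1; have [->|w0] := eqVneq w 0; last first.
      have wm : (fun x : Cplx R => x ^+ m) w != 0 by rewrite expf_neq0.
      exact (dC_mul (dC_exp (m + 2) (hphi w w1)) (dC_inv (f := fun x : Cplx R => x ^+ m) wm (dC_exp m (dC_id w)))).
    apply/derivableCP; exists 0 => e e0.
    have Km : 0 <= K ^+ (m + 2) by rewrite exprn_ge0.
    exists (Num.min d (e / (K ^+ (m + 2) + 1))).
      by rewrite lt_min d0 divr_gt0//; lra.
    move=> h; rewrite lt_min => /andP[hd he].
    have -> : G 0 = 0 by rewrite /G phi0 addn2 exprS mul0r mul0r.
    rewrite add0r subr0 mul0r subr0; have [->|h0] := eqVneq h 0.
      by rewrite /G phi0 addn2 exprS !mul0r cabs0 mulr0.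
    have hp : 0 < cabs h by rewrite cabs_gt0.
    rewrite /G cabsM cabsV !cabsX ler_pdivrMr ?exprn_gt0//.
    apply: (@le_trans _ _ ((K * cabs h) ^+ (m + 2))).
      by apply: lerXn2r; rewrite ?nnegrE ?mulr_ge0 ?cabs_ge0//; exact: HK.
    rewrite exprMn [cabs h ^+ (m + 2)]exprD expr2.
    have hh : K ^+ (m + 2) * cabs h <= e.
      move: he; rewrite ltr_pdivlMr; [|lra]; move=> he.
      have := mulr_ge0 Km (ltW hp); nra.
    have -> : K ^+ (m + 2) * (cabs h ^+ m * (cabs h * cabs h)) =
      (K ^+ (m + 2) * cabs h) * (cabs h * cabs h ^+ m) by ring.
    rewrite -[leRHS]mulrA; apply: ler_wpM2r => //.
    by rewrite mulr_ge0 ?exprn_ge0 ?cabs_ge0.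
  have [->|z0] := eqVneq z 0.
    by rewrite phi0 cabs0 addn2 exprS mul0r exprn_ge0.
  have zp : 0 < cabs z by rewrite cabs_gt0.
  suff : cabs (G z) <= 1 by rewrite /G cabsM cabsV !cabsX ler_pdivrMr ?exprn_gt0// mul1r.
  apply: max_principle => // e e0.
  (* Bernoulli then gives [(1 + e) * (1 - th) ^+ m >= 1 + e - e * m / (m + 1) >= 1], the bound
     needed for [1 / |w|^m] near the circle; [m + 1] covers [m = 0]. *)
  pose th := e / ((m.+1)%:R * (1 + e)).
  have m0 : 0 < m.+1%:R :> R by rewrite ltr0n.
  have e1 : 0 < 1 + e by lra.
  have me : 0 < m.+1%:R * (1 + e) by rewrite mulr_gt0.
  have th0 : 0 < th by rewrite divr_gt0.
  have thE : th * (m.+1%:R * (1 + e)) = e by rewrite /th divfK// gt_eqF.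
  have th1 : th < 1.
    rewrite /th ltr_pdivrMr// mul1r; have : 1 <= m.+1%:R :> R by rewrite ler1n.
    nra.
  exists (1 - th); first lra.
  move=> w ws w1; have wp : 0 < cabs w by lra.
  rewrite /G cabsM cabsV !cabsX ler_pdivrMr ?exprn_gt0//.
  apply: (@le_trans _ _ 1); first by rewrite exprn_ile1 ?cabs_ge0// ltW// Hphi.
  apply: (@le_trans _ _ ((1 + e) * (1 - th) ^+ m)); last first.
    rewrite ler_pM2l//; apply: lerXn2r; rewrite ?nnegrE//; lra.
  have := @bernoulli R (- th) m; have -> : -1 <= - th by lra.
  move=> /(_ isT) /(ler_wpM2l (ltW e1)); apply: le_trans.
  have : m%:R * th * (1 + e) <= e.
    by rewrite -{2}thE -natr1; have := mulr_gt0 th0 e1; nra.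
  lra.
rewrite leNgt; apply/negP => h.
have x0 : 0 < cabs (phi z) by apply: le_lt_trans h; exact: cabs_ge0.
have [y0|y0] := eqVneq (cabs z) 0.
  by have := key 1%N; rewrite y0 expr1 leNgt exprn_gt0.
have yp : 0 < cabs z by rewrite lt0r y0 cabs_ge0.
have xy : 1 < cabs (phi z) / cabs z by rewrite ltr_pdivlMr// mul1r.
have [n] := exists_expr_gt ((cabs (phi z) ^+ 2)^-1) xy.
rewrite expr_div_n ltr_pdivlMr ?exprn_gt0// mulrC ltr_pdivrMr ?exprn_gt0//.
by rewrite -exprD ltNge key.
Qed.

End MaxPrinciple.

(** * Disk automorphisms and the Schwarz-Pick lemma *)

Section SchwarzPick.
Variable R : realType.
Implicit Types (z w a b : Cplx R) (phi : Cplx R -> Cplx R).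

(** The automorphism of the disk that sends [b] to 0; its modulus is the pseudo-hyperbolic distance
    [rho] of [dist_disk z b]. *)
Definition moebius b z : Cplx R := (z - b) / (1 - z * (conjc b : Cplx R)).

Lemma cabs_conj b : cabs (conjc b : Cplx R) = cabs b.
Proof. by rewrite !cabsE; case: b => x y; rewrite /reC/imC/= sqrrN. Qed.

Lemma moebius_den b z : cabs b < 1 -> cabs z < 1 -> 1 - z * (conjc b : Cplx R) != 0.
Proof.
move=> b1 z1; rewrite subr_eq0; apply/eqP => E.
have : cabs (z * (conjc b : Cplx R)) < 1.
  by rewrite cabsM cabs_conj mulr_ilt1// cabs_ge0.
by rewrite -E cabs1 ltxx.
Qed.

Lemma moebius_sqr b z : cabs b < 1 -> cabs z < 1 ->
  1 - cabs (moebius b z) ^+ 2 =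
  (1 - cabs b ^+ 2) * (1 - cabs z ^+ 2) / cabs (1 - z * (conjc b : Cplx R)) ^+ 2.
Proof.
move=> b1 z1; have den := moebius_den b1 z1.
have dp : 0 < cabs (1 - z * (conjc b : Cplx R)) ^+ 2 by rewrite exprn_gt0// cabs_gt0.
apply: (mulIf (lt0r_neq0 dp)); rewrite divfK ?gt_eqF//.
rewrite mulrBl mul1r /moebius cabsM cabsV exprMn exprVn divfK ?gt_eqF//.
rewrite !sqr_cabs; case: b {b1 den dp} => x y; case: z {z1} => s t.
rewrite !(reCD, imCD, reCN, imCN, reCM, imCM)/= /reC/imC/=; ring.
Qed.

Lemma moebius_lt1 b z : cabs b < 1 -> cabs z < 1 -> cabs (moebius b z) < 1.
Proof.
move=> b1 z1; have : 0 < 1 - cabs (moebius b z) ^+ 2.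
  rewrite moebius_sqr// divr_gt0//; last by rewrite exprn_gt0// cabs_gt0 moebius_den.
  by rewrite mulr_gt0// subr_gt0 expr_lt1 ?cabs_ge0.
by rewrite subr_gt0 expr_lt1 ?cabs_ge0.
Qed.

Lemma moebiusK b z : cabs b < 1 -> cabs z < 1 -> moebius (- b) (moebius b z) = z.
Proof.
move=> b1 z1; have den := moebius_den b1 z1; have denb := moebius_den b1 b1.
rewrite /moebius rmorphN/= opprK mulrN opprK.
set c : Cplx R := conjc b in den denb *.
have e1 : (z - b) / (1 - z * c) + b = z * (1 - b * c) / (1 - z * c).
  by rewrite -[X in _ + X](mulfK den) -mulrDl; congr (_ / _); ring.
have e2 : 1 + (z - b) / (1 - z * c) * c = (1 - b * c) / (1 - z * c).
  by rewrite -{1}(divff den) mulrAC -mulrDl; congr (_ / _); ring.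
by rewrite e1 e2 invfM invrK mulrACA mulVf// mulr1 mulfK.
Qed.

Lemma dC_moebius b z : cabs b < 1 -> cabs z < 1 -> derivable (moebius b) z 1.
Proof.
move=> b1 z1; have den := moebius_den b1 z1.
exact (dC_mul (dC_sub (dC_id z) (dC_cst b z))
  (dC_inv (f := fun x => 1 - x * (conjc b : Cplx R)) den
     (dC_sub (dC_cst 1 z) (dC_mul (dC_id z) (dC_cst (conjc b : Cplx R) z))))).
Qed.

(** Conjugating [phi] by the automorphisms that move [a] and [phi a] to 0 reduces the claim to the
    Schwarz lemma. *)
Lemma schwarz_pick phi a z : holomorphic_on (@unit_disk R) phi ->
  (forall z, cabs z < 1 -> cabs (phi z) < 1) -> cabs a < 1 -> cabs z < 1 ->
  cabs (moebius (phi a) (phi z)) <= cabs (moebius a z).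
Proof.
move=> hphi Hphi a1 z1; have na1 : cabs (- a) < 1 by rewrite cabsN.
pose Phi w := moebius (phi a) (phi (moebius (- a) w)).
have E : Phi (moebius a z) = moebius (phi a) (phi z) by rewrite /Phi moebiusK.
rewrite -E; apply: schwarz; last exact: moebius_lt1.
- move=> w w1; have m1 := moebius_lt1 na1 w1.
  have d1 := dC_moebius na1 w1.
  have d2 := dC_comp d1 (hphi _ m1).
  exact (dC_comp d2 (dC_moebius (Hphi _ a1) (Hphi _ m1))).
- by move=> w w1; apply: moebius_lt1; apply: Hphi => //; exact: moebius_lt1.
- rewrite /Phi; have -> : moebius (- a) 0 = a.
    by rewrite /moebius sub0r opprK mul0r subr0 invr1 mulr1.
  by rewrite /moebius subrr mul0r.
Qed.

End SchwarzPick.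

(** * Derivatives of injective maps and differentiability of lifts *)

Section Derivative.
Variable R : realType.
Implicit Types (f g h phi : Cplx R -> Cplx R) (z w a l p zeta : Cplx R).

(** Names the value of the derivative: by [derivableCP], [derivable f z 1] is the existence of such
    an [l]. *)
Definition cdiff f z l := forall e : R, 0 < e -> exists2 d : R, 0 < d &
  forall k, cabs k < d -> cabs (f (z + k) - f z - l * k) <= e * cabs k.

Lemma derivable_near_eq f g z (d : R) : 0 < d ->
  (forall w, cabs (w - z) < d -> f w = g w) -> derivable f z 1 -> derivable g z 1.
Proof.
move=> d0 fg /derivableCP[l Hl]; apply/derivableCP; exists l => e /Hl[d' d'0 Hd'].
exists (Num.min d d'); first by rewrite lt_min d0.
move=> k; rewrite lt_min => /andP[kd kd'].
rewrite -!fg; [exact: Hd'|by rewrite subrr cabs0|by rewrite addrC addKr].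
Qed.

(** Difference quotient completed by the derivative at [zeta]: continuous there and differentiable
    where [f] is elsewhere, which is what [center_bound] asks for. *)
Definition quot f zeta l z : Cplx R :=
  if z == zeta then l else (f z - f zeta) / (z - zeta).

Lemma quot_cont f zeta l : cdiff f zeta l -> {for zeta, continuous (quot f zeta l)}.
Proof.
move=> H; apply/continuousCP => e e0; have e2 : 0 < e / 2 by rewrite divr_gt0.
have [d d0 Hd] := H _ e2; exists d => // w wd; rewrite /quot eqxx.
case: eqVneq => [_|wz]; first by rewrite subrr cabs0.
have wz0 : w - zeta != 0 by rewrite subr_eq0.
have wp : 0 < cabs (w - zeta) by rewrite cabs_gt0.
rewrite -(ltr_pM2r wp) -cabsM mulrBl divfK//.
have := Hd _ wd; rewrite (_ : zeta + (w - zeta) = w); last by ring.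
move=> /le_lt_trans; apply.
by rewrite ltr_pM2r//; lra.
Qed.

Lemma quot_derivable f zeta l z : z != zeta -> derivable f z 1 ->
  derivable (quot f zeta l) z 1.
Proof.
move=> zz dz; have z0 : z - zeta != 0 by rewrite subr_eq0.
have zp : 0 < cabs (z - zeta) by rewrite cabs_gt0.
apply: (derivable_near_eq zp (f := fun w => (f w - f zeta) / (w - zeta))).
  move=> w wz; rewrite /quot; case: eqVneq => // E.
  by move: wz; rewrite E cabsBC ltxx.
exact (dC_mul (dC_sub dz (dC_cst (f zeta) z))
  (dC_inv (f := fun x => x - zeta) z0 (dC_sub (dC_id z) (dC_cst zeta z)))).
Qed.

Lemma square_near zeta (t x y : R) : reC zeta - t <= x <= reC zeta + t ->
  imC zeta - t <= y <= imC zeta + t -> cabs (mkC x y - zeta) <= 2 * t.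
Proof.
move=> hx hy; apply: le_trans (cabs_le _) _; rewrite reCD imCD reCN imCN/=.
have -> : 2 * t = t + t by lra.
by apply: lerD; rewrite ler_norml; lra.
Qed.

Lemma center_bound k zeta (t M : R) : 0 < t ->
  (forall w, w != zeta -> cabs (w - zeta) <= 2 * t -> derivable k w 1) ->
  {for zeta, continuous k} ->
  (forall w, t <= cabs (w - zeta) -> cabs (w - zeta) <= 2 * t -> cabs (k w) <= M) ->
  cabs (k zeta) <= 2 * M.
Proof.
move=> t0 dk ck H.
have := @center_le_max R k (reC zeta) (imC zeta) t M t0; rewrite mkCK => C.
have d1 x y (hx : reC zeta - t <= x <= reC zeta + t) (hy : imC zeta - t <= y <= imC zeta + t)
  (hxy : mkC x y != zeta) := dk _ hxy (square_near hx hy).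
have d2 x y (hx : reC zeta - t <= x <= reC zeta + t) (hy : imC zeta - t <= y <= imC zeta + t)
  (hxy : t <= cabs (mkC x y - zeta)) := H _ hxy (square_near hx hy).
exact (C d1 ck d2).
Qed.

(** [l] is the central value of [quot], whose modulus is at most [M / t] at distance at least
    [t]. *)
Lemma cauchy_estimate f zeta l (t M : R) : 0 < t -> cdiff f zeta l ->
  (forall w, cabs (w - zeta) <= 2 * t -> derivable f w 1) ->
  (forall w, cabs (w - zeta) <= 2 * t -> cabs (f w - f zeta) <= M) ->
  cabs l <= 2 * (M / t).
Proof.
move=> t0 Hl df HM; have : quot f zeta l zeta = l by rewrite /quot eqxx.
move=> <-; apply: (@center_bound _ _ t) => //.
- by move=> w wz wt; exact: (@quot_derivable f zeta l w wz (df w wt)).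
- exact: quot_cont.
move=> w tw wt; have wp : 0 < cabs (w - zeta) by exact: lt_le_trans tw.
have wz : w != zeta by rewrite -subr_eq0 -cabs_gt0.
rewrite /quot (negbTE wz) cabsM cabsV; apply: ler_pM => //; rewrite ?cabs_ge0 ?invr_ge0 ?cabs_ge0//.
  exact: HM.
by rewrite lef_pV2 ?posrE.
Qed.

(** The centre estimate is applied to the reciprocal of [quot], which has no pole since [f] takes
    the value [f zeta] only at [zeta] and [l] is nonzero. On the annulus it is at most
    [2 * t / m]. *)
Lemma injective_derivative_ge f zeta l (t m : R) : 0 < t -> 0 < m -> cdiff f zeta l ->
  l != 0 ->
  (forall w, cabs (w - zeta) <= 2 * t -> derivable f w 1) ->
  (forall w, w != zeta -> cabs (w - zeta) <= 2 * t -> f w != f zeta) ->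
  (forall w, t <= cabs (w - zeta) -> cabs (w - zeta) <= 2 * t -> m <= cabs (f w - f zeta)) ->
  m <= 4 * t * cabs l.
Proof.
move=> t0 m0 Hl l0 df fi Hm.
have lp : 0 < cabs l by rewrite cabs_gt0.
have qz : quot f zeta l zeta = l by rewrite /quot eqxx.
pose k w := (quot f zeta l w)^-1.
have : cabs (k zeta) <= 2 * (2 * t / m).
  apply: (@center_bound _ _ t) => //.
  - move=> w wz wt; have q0 : quot f zeta l w != 0.
      by rewrite /quot (negbTE wz) mulf_neq0 ?invr_eq0 ?subr_eq0//; exact: fi.
    exact: (dC_inv q0 (@quot_derivable f zeta l w wz (df w wt))).
  - have q0 : quot f zeta l zeta != 0 by rewrite qz.
    exact: (cC_inv q0 (quot_cont Hl)).
  move=> w tw wt; have wp : 0 < cabs (w - zeta) by exact: lt_le_trans tw.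
  have wz : w != zeta by rewrite -subr_eq0 -cabs_gt0.
  have hm := Hm w tw wt; have fp : 0 < cabs (f w - f zeta) by exact: lt_le_trans hm.
  rewrite /k /quot (negbTE wz) invfM invrK mulrC cabsM cabsV.
  by apply: ler_pM => //; rewrite ?cabs_ge0 ?invr_ge0 ?cabs_ge0// lef_pV2 ?posrE.
rewrite /k qz cabsV => h.
have := ler_wpM2r (ltW (mulr_gt0 lp m0)) h.
rewrite mulrA mulVf ?gt_eqF// mul1r.
have -> : 2 * (2 * t / m) * (cabs l * m) = (4 * t * cabs l) * (m^-1 * m) by ring.
by rewrite mulVf ?gt_eqF// mulr1.
Qed.

(** Heine-Cantor on the square of half-side [r] about [p], which contains the disk of radius [r] and
    lies in that of radius [2 * r]. *)
Lemma uniform_shift f p (r : R) : (forall z, cabs (z - p) <= 2 * r -> {for z, continuous f}) ->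
  forall e : R, 0 < e -> exists2 d : R, 0 < d &
    forall z tau, cabs (z - p) <= r -> cabs tau < d -> cabs (f (z + tau) - f z) < e.
Proof.
move=> cf e e0; have e2 : 0 < e / 2 by rewrite divr_gt0.
have /compact_near_coveringP cK := compact_setX
  (@segment_compact R (reC p - r) (reC p + r)) (@segment_compact R (imC p - r) (imC p + r)).
have /nbhsCP[d d0 Hd] : nbhs (0 : Cplx R) [set tau : Cplx R |
    `[reC p - r, reC p + r] `*` `[imC p - r, imC p + r] `<=`
    (fun xy => cabs (f (mkC xy.1 xy.2 + tau) - f (mkC xy.1 xy.2)) < e)].
  apply: (cK (Cplx R) (nbhs (0 : Cplx R))
    (fun tau xy => cabs (f (mkC xy.1 xy.2 + tau) - f (mkC xy.1 xy.2)) < e)).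
  move=> [x y] [/=]; rewrite !in_itv/= => hx hy.
  have /continuousCP/(_ _ e2)[d d0 Hd] := cf _ (square_near hx hy).
  have d20 : 0 < d / 4 by rewrite divr_gt0.
  exists ([set xy : R * R | cabs (mkC xy.1 xy.2 - mkC x y) < d / 2],
          [set tau : Cplx R | cabs tau < d / 2]).
    split.
      exists (ball x (d / 4), ball y (d / 4)); first by split; apply: nbhsx_ballx.
      move=> [s u] [h1 h2]; change (cabs (mkC s u - mkC x y) < d / 2).
      apply: le_lt_trans (cabs_le _) _; move: h1 h2; rewrite /ball/= => h1 h2.
      have -> : d / 2 = d / 4 + d / 4 by lra.
      by apply: ltrD; rewrite distrC.
    by apply/nbhsCP; exists (d / 2); [rewrite divr_gt0|move=> w; rewrite subr0].
  move=> [[s u] tau] [h1 h2]; have {}h1 : cabs (mkC s u - mkC x y) < d / 2 := h1.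
  have {}h2 : cabs tau < d / 2 := h2; change (cabs (f (mkC s u + tau) - f (mkC s u)) < e).
  have -> : f (mkC s u + tau) - f (mkC s u) =
    (f (mkC s u + tau) - f (mkC x y)) - (f (mkC s u) - f (mkC x y)) by ring.
  apply: le_lt_trans (cabsD _ _) _; rewrite cabsN (splitr e); apply: ltrD; apply: Hd.
    rewrite addrAC; apply: le_lt_trans (cabsD _ _) _; rewrite (splitr d); exact: ltrD.
  by apply: lt_le_trans h1 _; lra.
exists d => // z tau hz ht; have ht0 : cabs (tau - 0) < d by rewrite subr0.
have := Hd tau ht0 (reC z, imC z); rewrite /= !mkCK; apply.
have h1 := le_trans (reC_le (z - p)) hz; have h2 := le_trans (imC_le (z - p)) hz.
move: h1 h2; rewrite reCD imCD reCN imCN !ler_norml => h1 h2.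
by split; rewrite /= in_itv/=; [move: h1|move: h2]; lra.
Qed.

(** Along the segment the real and imaginary parts of [f] are real functions with derivative 0, and
    the mean value theorem applies to each. *)
Lemma zero_derivative_segment f p tau :
  (forall s : R, 0 <= s <= 1 -> cdiff f (p + mkC s 0 * tau) 0) -> f (p + tau) = f p.
Proof.
move=> H; have real_zero (u : R -> R) :
    (forall s e : R, 0 <= s <= 1 -> 0 < e -> exists2 d : R, 0 < d &
      forall t, `|t| < d -> `|u (s + t) - u s| <= e * `|t|) -> u 1 = u 0.
  move=> Hu.
  have cu (s : R) : 0 <= s <= 1 -> {for s, continuous u}.
    move=> hs; apply: cont_at => e e0; have [d d0 Hd] := Hu s 1 hs ltr01.
    exists (Num.min d e); first by rewrite lt_min d0.
    move=> y; rewrite lt_min => /andP[yd ye].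
    have := Hd _ yd; rewrite (_ : s + (y - s) = y) ?mul1r; last by ring.
    by move=> /le_lt_trans; exact.
  have du (s : R) : s \in `]0, 1[ -> is_derive s 1 u 0.
    rewrite in_itv/= => /andP[s0 s1]; have hs : 0 <= s <= 1 by rewrite !ltW.
    have lim0 : (fun h : R => h^-1 *: (u (h *: 1 + s) - u s)) @ 0^' --> (0 : R).
      apply/cvgrPdist_le => e e0; have [d d0 Hd] := Hu s e hs e0.
      apply/nbhs_ballP; exists d => // h; rewrite /ball/= sub0r normrN => hd h0.
      have hp : 0 < `|h| by rewrite normr_gt0.
      rewrite sub0r normrN /GRing.scale/= mulr1 normrM normrV ?unitfE//.
      by rewrite mulrC ler_pdivrMr// (addrC h); exact: Hd.
    apply: DeriveDef; first by apply/cvg_ex; exists (0 : R).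
    exact: (cvg_lim _ lim0).
  have cI : {within `[0, 1], continuous u}.
    by apply: continuous_in_subspaceT => x; rewrite mem_setE in_itv/= => /cu.
  have [c _] := MVT ltr01 du cI.
  by rewrite mul0r => /eqP; rewrite subr_eq0 => /eqP.
have est (s e : R) : 0 <= s <= 1 -> 0 < e -> exists2 d : R, 0 < d &
    forall t, `|t| < d -> cabs (f (p + mkC (s + t) 0 * tau) - f (p + mkC s 0 * tau)) <= e * `|t|.
  move=> hs e0; have T0 : 0 < cabs tau + 1 by have := cabs_ge0 tau; lra.
  have e'0 : 0 < e / (cabs tau + 1) by rewrite divr_gt0.
  have [d d0 Hd] := H s hs _ e'0; exists (d / (cabs tau + 1)); first by rewrite divr_gt0.
  move=> t; rewrite ltr_pdivlMr// => td.
  have ct : cabs (mkC t 0 * tau) = `|t| * cabs tau by rewrite cabsM cabs_real.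
  have tt : `|t| * cabs tau <= `|t| * (cabs tau + 1) by apply: ler_wpM2l => //; lra.
  have := Hd (mkC t 0 * tau); rewrite ct => /(_ (le_lt_trans tt td)).
  rewrite mul0r subr0.
  have -> : p + mkC s 0 * tau + mkC t 0 * tau = p + mkC (s + t) 0 * tau.
    by rewrite -addrA -mulrDl mkCD addr0.
  move/le_trans; apply; rewrite mulrAC mulrA ler_pdivrMr//.
  by rewrite -!mulrA; apply: ler_wpM2l; [exact: ltW|exact: tt].
have e1 : p + mkC 1 0 * tau = p + tau by rewrite (_ : mkC 1 0 = 1) ?mul1r.
have e0 : p + mkC 0 0 * tau = p by rewrite (_ : mkC 0 0 = 0) ?mul0r ?addr0.
apply: eqC.
- have := real_zero (fun s => reC (f (p + mkC s 0 * tau))); rewrite e1 e0; apply.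
  move=> s e hs /(est s e hs)[d d0 Hd]; exists d => // t /Hd; apply: le_trans.
  by rewrite -reCN -reCD; exact: reC_le.
- have := real_zero (fun s => imC (f (p + mkC s 0 * tau))); rewrite e1 e0; apply.
  move=> s e hs /(est s e hs)[d d0 Hd]; exists d => // t /Hd; apply: le_trans.
  by rewrite -imCN -imCD; exact: imC_le.
Qed.

(* If [l = 0], the lower bound on the nonzero derivatives nearby and the
   continuity of the derivative force the derivative to vanish near [p]. *)
Lemma injective_derivative_neq0 f p l (rho : R) : 0 < rho ->
  (forall w, cabs (w - p) < rho -> derivable f w 1) ->
  (forall w z, cabs (w - p) < rho -> cabs (z - p) < rho -> f w = f z -> w = z) ->
  cdiff f p l -> l != 0.
Proof.
move=> rho0 df fi Hl; apply/eqP => l0; rewrite {}l0 in Hl.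
pose t := rho / 16; have t0 : 0 < t by rewrite divr_gt0.
have tr : 16 * t = rho by rewrite /t; field.
(* The added bump is positive where [|w| < t] and vanishes on the annulus [t <= |w| <= 8 * t]. The
   minimum of [v] over a disk is thus positive and bounds [|f (p + w) - f p|] below on the
   annulus. *)
pose v w := cabs (f (p + w) - f p) + Num.max 0 (t - cabs w).
have vpos w : cabs w < rho -> 0 < v w.
  move=> wr; have [wt|wt] := ltP (cabs w) t.
    apply: ltr_wpDl; first exact: cabs_ge0.
    by rewrite lt_max subr_gt0 wt orbT.
  apply: ltr_pwDl; last by rewrite le_max lexx.
  rewrite cabs_gt0 subr_eq0; apply/eqP => E.
  have hw : cabs (p + w - p) < rho by rewrite addrC addKr.
  have hp : cabs (p - p) < rho by rewrite subrr cabs0.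
  have := fi _ _ hw hp E; move/eqP; rewrite -subr_eq0 addrC addKr => /eqP w0.
  by move: wt; rewrite w0 cabs0 leNgt t0.
have cv w : cabs w <= 8 * t -> rcont (fun x => - v x) w.
  move=> wr.
  have hw : cabs (p + w - p) < rho by rewrite addrC addKr; lra.
  have c1 : {for w, continuous (fun x => f (p + x) - f p)}.
    have d1 : derivable (fun x => p + x) w 1 by exact (dC_add (dC_cst p w) (dC_id w)).
    have d2 : derivable (fun x => f (p + x)) w 1 by exact (dC_comp d1 (df _ hw)).
    exact: (derivable_cont (dC_sub d2 (dC_cst (f p) w))).
  have c2 := rcont_abs c1.
  have c3 : rcont (fun x : Cplx R => Num.max 0 (t - cabs x)) w.
    move=> e e0; exists e => // x xw; apply: le_lt_trans xw.
    have := cabsB x w; have := cabsB w x; rewrite (cabsBC w x) => h1 h2.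
    have hmax (a b c : R) : `|a - b| <= c -> `|Num.max 0 a - Num.max 0 b| <= c.
      by rewrite !ler_norml /Num.max; case: ltP => ?; case: ltP => ? /andP[? ?]; apply/andP; split; lra.
    by apply: hmax; rewrite ler_norml; lra.
  move=> e e0; have [d d0 Hd] := rcontD c2 c3 e0; exists d => // x /Hd.
  by rewrite -opprD normrN.
have t8 : 0 <= 8 * t by lra.
have [w0 hw0 Hw0] := disk_max t8 cv.
pose m := v w0; have m0 : 0 < m by apply: vpos; lra.
have Hm w : t <= cabs w -> cabs w <= 8 * t -> m <= cabs (f (p + w) - f p).
  move=> tw wt; have := Hw0 w wt; rewrite lerN2 -/m => /le_trans; apply.
  by rewrite /v (_ : Num.max 0 (t - cabs w) = 0) ?addr0// max_l// subr_le0.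
have m4 : 0 < m / 2 by rewrite divr_gt0.
have hp : cabs (p - p) < rho by rewrite subrr cabs0.
have /continuousCP/(_ _ m4)[d1 d10 Hd1] := derivable_cont (df _ hp).
(* [injective_derivative_ge] with radius [2 * t] and bound [m / 2] reads [m / 2 <= 8 * t * |lz|]. *)
pose c := m / (16 * t); have c0 : 0 < c by rewrite divr_gt0// mulr_gt0.
have cE : c * (16 * t) = m by rewrite /c divfK// gt_eqF// mulr_gt0.
have lower zeta lz : cabs (zeta - p) < Num.min d1 t -> cdiff f zeta lz -> lz != 0 ->
    c <= cabs lz.
  rewrite lt_min => /andP[zd zt] Hlz lz0.
  have tri w : cabs (w - p) <= cabs (w - zeta) + cabs (zeta - p).
    by apply: le_trans (cabsD _ _); rewrite addrA subrK.
  have tri2 w : cabs (w - zeta) - cabs (zeta - p) <= cabs (w - p).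
    rewrite lerBlDr (_ : w - zeta = (w - p) - (zeta - p)); last by ring.
    by apply: le_trans (cabsD _ _) _; rewrite cabsN.
  have := @injective_derivative_ge f zeta lz (2 * t) (m / 2) (mulr_gt0 (ltr0n _ 2) t0) m4 Hlz lz0.
  have near w : cabs (w - zeta) <= 2 * (2 * t) -> cabs (w - p) < rho.
    by move=> h; apply: le_lt_trans (tri w) _; lra.
  have h1 w (hw : cabs (w - zeta) <= 2 * (2 * t)) := df w (near w hw).
  have zr : cabs (zeta - p) < rho by lra.
  have h2 w : w != zeta -> cabs (w - zeta) <= 2 * (2 * t) -> f w != f zeta.
    by move=> wz hw; apply: contra wz => /eqP/(fi _ _ (near _ hw) zr) ->.
  have h3 w : 2 * t <= cabs (w - zeta) -> cabs (w - zeta) <= 2 * (2 * t) -> m / 2 <= cabs (f w - f zeta).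
    move=> w1 w2; have := Hm (w - p); rewrite (_ : p + (w - p) = w); last by ring.
    move=> Hmw.
    have := tri w; have := tri2 w => h4 h5.
    have {}Hmw : m <= cabs (f w - f p) by apply: Hmw; lra.
    have := Hd1 _ zd; have := cabsB (f w - f p) (f zeta - f p).
    rewrite (_ : f w - f p - (f zeta - f p) = f w - f zeta); last by ring.
    by lra.
  move=> /(_ h1 h2 h3) h4.
  have : m <= 16 * t * cabs lz by lra.
  by rewrite -cE mulrC ler_pM2l// mulr_gt0.
have cf z : cabs (z - p) <= 2 * (2 * t) -> {for z, continuous f}.
  by move=> hz; apply: derivable_cont; apply: df; lra.
have e40 : 0 < c * t / 16 by rewrite divr_gt0// mulr_gt0.
have [d2 d20 Hd2] := uniform_shift cf e40.
pose d3 := Num.min (Num.min d1 t) d2.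
have d30 : 0 < d3 by rewrite !lt_min d10 t0.
have vanish tau : cabs tau < d3 -> cdiff f (p + tau) 0.
  rewrite lt_min => /andP[h1 h2].
  have ht : cabs tau < t by move: h1; rewrite lt_min => /andP[].
  have hpt : cabs (p + tau - p) < rho by rewrite addrC addKr; lra.
  have /derivableCP[lz Hlz] := df _ hpt.
  have [<-//|lz0] := eqVneq lz 0.
  have := lower (p + tau) lz; rewrite (addrC p) addrK (addrC tau) => /(_ h1 Hlz lz0) clz.
  (* As the derivative of [f] at [p] is 0, [F] has derivative [lz] at [p]. Uniform continuity makes
     [F] small, so Cauchy's estimate yields [|lz| <= c / 4], against the lower bound [c]. *)
  pose F z := f (z + tau) - f z.
  have HF : cdiff F p lz.
    move=> e e0; have ee : 0 < e / 2 by rewrite divr_gt0.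
    have [a1 a10 A1] := Hlz _ ee; have [a2 a20 A2] := Hl _ ee.
    exists (Num.min a1 a2); first by rewrite lt_min a10.
    move=> k; rewrite lt_min => /andP[/A1 k1 /A2 k2].
    have -> : F (p + k) - F p - lz * k =
      (f (p + tau + k) - f (p + tau) - lz * k) - (f (p + k) - f p - 0 * k).
      by rewrite /F (addrAC p k tau); ring.
    apply: le_trans (cabsD _ _) _; rewrite cabsN; lra.
  have dF w : cabs (w - p) <= 2 * t -> derivable F w 1.
    move=> hw; have hw1 : cabs (w - p) < rho by lra.
    have hw2 : cabs (w + tau - p) < rho.
      by rewrite addrAC; apply: le_lt_trans (cabsD _ _) _; lra.
    have da : derivable (fun x => x + tau) w 1 by exact (dC_add (dC_id w) (dC_cst tau w)).
    have db : derivable (fun x => f (x + tau)) w 1 by exact (dC_comp da (df _ hw2)).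
    exact (dC_sub db (df _ hw1)).
  have := cauchy_estimate t0 HF dF (M := c * t / 8).
  have HM w : cabs (w - p) <= 2 * t -> cabs (F w - F p) <= c * t / 8.
    move=> hw; apply: le_trans (cabsD _ _) _; rewrite cabsN.
    have hpp : cabs (p - p) <= 2 * t by rewrite subrr cabs0; lra.
    have := Hd2 w tau hw h2; have := Hd2 p tau hpp h2; rewrite -/(F w) -/(F p); lra.
  move=> /(_ HM); have -> : 2 * (c * t / 8 / t) = c / 4 by field; rewrite gt_eqF.
  lra.
pose tau : Cplx R := mkC (d3 / 2) 0.
have ctau : cabs tau = d3 / 2 by rewrite cabs_real ger0_norm//; lra.
have : f (p + tau) = f p.
  apply: zero_derivative_segment => s /andP[s0 s1]; apply: vanish.
  rewrite cabsM cabs_real ger0_norm// ctau.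
  by have : s * (d3 / 2) <= d3 / 2 by [rewrite ler_piMl//; lra]; lra.
have d3t : d3 <= t by rewrite !ge_min lexx orbT.
have hpt : cabs (p + tau - p) < rho by rewrite addrC addKr ctau; lra.
move=> /(fi _ _ hpt hp) /eqP; rewrite -subr_eq0 (_ : p + tau - p = tau); last by ring.
rewrite -cabs_eq0 ctau => /eqP; lra.
Qed.

(** Solving the expansion of [f (phi w) = h w] for the increment of [phi] gives the derivative
    [L / l]. Only continuity of [phi] is known, so a Lipschitz bound at [z] has to come first. *)
Lemma lift_derivable f phi h z l (r : R) : 0 < r -> {for z, continuous phi} ->
  cdiff f (phi z) l -> l != 0 -> derivable h z 1 ->
  (forall w, cabs (w - z) < r -> f (phi w) = h w) -> derivable phi z 1.
Proof.
move=> r0 /continuousCP cphi Hl l0 /derivableCP[L HL] fh.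
have lp : 0 < cabs l by rewrite cabs_gt0.
apply/derivableCP; exists (L / l) => e e0.
(* With [e1 <= |l| / 2] and [e2 <= 1], half of [|l| |k|] is absorbed on the left, leaving
   [|k| <= C |eta|]. *)
pose C := 2 * (cabs L + 1) / cabs l.
have C0 : 0 < C by rewrite divr_gt0// mulr_gt0//; have := cabs_ge0 L; lra.
pose e1 := Num.min (cabs l / 2) (e * cabs l / (2 * C)).
have e10 : 0 < e1.
  by rewrite lt_min; apply/andP; split; apply: divr_gt0 => //; apply: mulr_gt0.
pose e2 := Num.min 1 (e * cabs l / 2).
have e20 : 0 < e2 by rewrite lt_min ltr01/= divr_gt0// mulr_gt0.
have [d1 d10 H1] := Hl _ e10; have [d2 d20 H2] := HL _ e20.
have [d3 d30 H3] := cphi _ d10.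
exists (Num.min (Num.min d2 d3) r); first by rewrite !lt_min d20 d30.
move=> eta; rewrite !lt_min => /andP[/andP[ed2 ed3] er].
set k := phi (z + eta) - phi z.
have kE : phi (z + eta) = phi z + k by rewrite /k; ring.
have kd : cabs k < d1 by apply: H3; rewrite addrC addKr.
have hz : f (phi z) = h z by apply: fh; rewrite subrr cabs0.
have hze : f (phi z + k) = h (z + eta) by rewrite -kE; apply: fh; rewrite addrC addKr.
have A1 := H1 _ kd; have A2 := H2 _ ed2; rewrite hze hz in A1.
have le1 : e1 <= cabs l / 2 by rewrite ge_min lexx.
have le1' : e1 <= e * cabs l / (2 * C) by rewrite ge_min lexx orbT.
have le2 : e2 <= 1 by rewrite ge_min lexx.
have le2' : e2 <= e * cabs l / 2 by rewrite ge_min lexx orbT.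
have k0 := cabs_ge0 k; have eta0 := cabs_ge0 eta.
set D := h (z + eta) - h z in A1 A2.
have B : cabs (l * k - L * eta) <= e1 * cabs k + e2 * cabs eta.
  have -> : l * k - L * eta = (D - L * eta) - (D - l * k) by ring.
  by apply: le_trans (cabsD _ _) _; rewrite cabsN; lra.
have kC : cabs k <= C * cabs eta.
  have : cabs l * cabs k <= cabs L * cabs eta + (e1 * cabs k + e2 * cabs eta).
    by rewrite -!cabsM; have := cabsB (l * k) (L * eta); lra.
  have m1 := ler_wpM2r k0 le1; have m2 := ler_wpM2r eta0 le2.
  move=> h1; rewrite -(ler_pM2l lp) /C.
  have -> : cabs l * (2 * (cabs L + 1) / cabs l * cabs eta) = 2 * (cabs L + 1) * cabs eta.
    by field; rewrite gt_eqF.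
  lra.
rewrite -(ler_pM2l lp) -cabsM.
have -> : l * (k - L / l * eta) = l * k - L * eta by field.
apply: le_trans B _.
have m1 : e1 * cabs k <= e * cabs l / 2 * cabs eta.
  apply: le_trans (ler_pM (ltW e10) k0 le1' kC) _.
  have -> : e * cabs l / (2 * C) * (C * cabs eta) = e * cabs l / 2 * cabs eta.
    by field; rewrite gt_eqF.
  exact: lexx.
have m2 := ler_wpM2r eta0 le2'.
lra.
Qed.

End Derivative.

(** * Lifting maps of the disk through a covering *)

Section Lifting.
Variable R : realType.
Implicit Types (f g h phi : Cplx R -> Cplx R) (z w a p x y : Cplx R).
Implicit Types (C N W : set (Cplx R)).
Local Notation D := (@unit_disk R).

(** Connectedness of [[0, 1]] as an induction principle: [P] propagates in both directions between
    points near [s], so it passes through the supremum of the points where it holds. *)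
Lemma interval_induction (P : R -> Prop) : P 0 ->
  (forall s, 0 <= s <= 1 -> exists2 e : R, 0 < e & forall t u, 0 <= t <= 1 -> 0 <= u <= 1 ->
     `|t - s| < e -> `|u - s| < e -> P t -> P u) -> P 1.
Proof.
move=> P0 H; pose A := [set s : R | 0 <= s <= 1 /\ P s].
have hA : has_sup A.
  by split; [exists 0; split => //; rewrite lexx ler01|exists 1 => s [/andP[]]].
have A0 : A 0 by split => //; rewrite lexx ler01.
have s0 : 0 <= sup A by exact: sup_upper_bound A0.
have s1 : sup A <= 1 by apply: ge_sup; [exists 0|move=> s [/andP[]]].
have hs : 0 <= sup A <= 1 by rewrite s0.
have [e e0 He] := H _ hs.
have [t [ht Pt] st] := sup_adherent e0 hA.
have ts : t <= sup A by exact: sup_upper_bound.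
pose u := Num.min 1 (sup A + e / 2).
have u1 : u <= 1 by rewrite ge_min lexx.
have ue : u <= sup A + e / 2 by rewrite ge_min lexx orbT.
have su : sup A <= u by rewrite le_min s1/=; lra.
have hu : 0 <= u <= 1 by rewrite u1 (le_trans s0).
have Pu : P u by apply: (He t u) => //; rewrite ltr_norml; lra.
have us : u <= sup A by apply: sup_upper_bound.
by move: us Pu; rewrite /u /Num.min; case: ltP => // h; lra.
Qed.

Definition convexC C := forall x y (s : R), C x -> C y -> 0 <= s <= 1 ->
  C (x + mkC s 0 * (y - x)).

Definition lift_at f h phi z := [/\ D (phi z), f (phi z) = h z & {for z, continuous phi}].

Definition evenly_covered f (Omega : set (Cplx R)) := forall w, Omega w ->
  exists U : set (Cplx R), [/\ open U, U w & exists VV : set (set (Cplx R)),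
    [/\ forall V, VV V -> open V,
        D `&` f @^-1` U = \bigcup_(V in VV) V,
        trivIset VV id & forall V, VV V -> homeo_on V U f]].

Lemma path_cont phi x y (s : R) : {for x + mkC s 0 * (y - x), continuous phi} ->
  forall e : R, 0 < e -> exists2 d : R, 0 < d & forall t, `|t - s| < d ->
    cabs (phi (x + mkC t 0 * (y - x)) - phi (x + mkC s 0 * (y - x))) < e.
Proof.
move=> /continuousCP H e /H[d d0 Hd].
have K0 : 0 < cabs (y - x) + 1 by have := cabs_ge0 (y - x); lra.
exists (d / (cabs (y - x) + 1)); first by rewrite divr_gt0.
move=> t; rewrite ltr_pdivlMr// => ht; apply: Hd.
have -> : x + mkC t 0 * (y - x) - (x + mkC s 0 * (y - x)) = mkC (t - s) 0 * (y - x).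
  have -> : mkC (t - s) 0 = mkC t 0 - mkC s 0 by apply: eqC; rewrite ?reCD ?imCD ?reCN ?imCN/= ?subrr.
  by ring.
rewrite cabsM cabs_real; apply: le_lt_trans ht; apply: ler_wpM2l => //; lra.
Qed.

Lemma open_cont V phi z : open V -> V (phi z) -> {for z, continuous phi} ->
  exists2 d : R, 0 < d & forall w, cabs (w - z) < d -> V (phi w).
Proof.
move=> /openCP oV /oV[e e0 He] /continuousCP/(_ e e0)[d d0 Hd].
by exists d => // w /Hd/He.
Qed.

(** Agreement propagates along the segment from [x] to [y]: near each parameter both lifts stay in
    one sheet, on which [f] is injective. *)
Lemma lift_unique f Omega h phi1 phi2 C x y : evenly_covered f Omega ->
  (forall z, D z -> Omega (h z)) -> convexC C ->
  (forall z, C z -> D z /\ lift_at f h phi1 z /\ lift_at f h phi2 z) ->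
  C x -> C y -> phi1 x = phi2 x -> phi1 y = phi2 y.
Proof.
move=> ec hO cC HC Cx Cy E.
pose gam (s : R) := x + mkC s 0 * (y - x).
have g0 : gam 0 = x by rewrite /gam (_ : mkC 0 0 = 0) ?mul0r ?addr0.
have g1 : gam 1 = y by rewrite /gam (_ : mkC 1 0 = 1) ?mul1r; [ring|].
rewrite -g1; apply: (@interval_induction (fun s => phi1 (gam s) = phi2 (gam s))).
  by rewrite g0.
move=> s hs; have Cs := cC _ _ _ Cx Cy hs.
have [Ds [[D1 E1 c1] [D2 E2 c2]]] := HC _ Cs.
have [U [oU Us [VV [oVV UE tV hV]]]] := ec _ (hO _ Ds).
have sheet phi : D (phi (gam s)) -> f (phi (gam s)) = h (gam s) -> exists2 V, VV V & V (phi (gam s)).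
  move=> h1 h2; have : (D `&` f @^-1` U) (phi (gam s)) by split => //=; rewrite h2.
  by rewrite UE => -[V]; exists V.
have [V1 VV1 h1] := sheet _ D1 E1; have [V2 VV2 h2] := sheet _ D2 E2.
have [e1 e10 He1] := (openCP V1).1 (oVV _ VV1) _ h1.
have [e2 e20 He2] := (openCP V2).1 (oVV _ VV2) _ h2.
have [d1 d10 Hd1] := path_cont c1 e10; have [d2 d20 Hd2] := path_cont c2 e20.
exists (Num.min d1 d2); first by rewrite lt_min d10.
move=> t u ht hu; rewrite !lt_min => /andP[t1 t2] /andP[u1 u2] Et.
(* The sheets are pairwise disjoint, and the common value at parameter [t] lies in both. *)
have V12 : V1 = V2.
  apply: tV => //; exists (phi1 (gam t)); split; first exact/He1/Hd1.
  by rewrite /= Et; exact/He2/Hd2.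
have Cu := cC _ _ _ Cx Cy hu; have [Du [[_ F1 _] [_ F2 _]]] := HC _ Cu.
have k1 : V1 (phi1 (gam u)) by exact/He1/Hd1.
have k2 : V1 (phi2 (gam u)) by rewrite V12; exact/He2/Hd2.
have [g [_ _ cfg _ _]] := hV _ VV1.
by rewrite -(cfg _ (mem_set k1)) -(cfg _ (mem_set k2)) F1 F2.
Qed.

(** The [d]-neighbourhood in the disk of the segment from 0 to [t z]. Being convex and open, tubes
    are suited both to [lift_unique] and to gluing. *)
Definition tube z (t d : R) : set (Cplx R) :=
  [set x | D x /\ exists2 s : R, 0 <= s <= t & cabs (x - mkC s 0 * z) < d].

Lemma convex_ball p (r : R) : convexC [set x | cabs (x - p) < r].
Proof.
move=> x y s /= hx hy /andP[s0 s1].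
have -> : x + mkC s 0 * (y - x) - p = mkC (1 - s) 0 * (x - p) + mkC s 0 * (y - p).
  have -> : mkC (1 - s) 0 = 1 - mkC s 0 by apply: eqC; rewrite ?reCD ?imCD ?reCN ?imCN/= ?subrr.
  by ring.
apply: le_lt_trans (cabsD _ _) _; rewrite !cabsM !cabs_real !ger0_norm//; last by lra.
have [->|sn0] := eqVneq s 0; first by rewrite subr0 mul1r mul0r addr0.
have sp : 0 < s by rewrite lt0r sn0.
have a1 : s * cabs (y - p) < s * r by rewrite ltr_pM2l.
have a2 : (1 - s) * cabs (x - p) <= (1 - s) * r.
  by apply: ler_wpM2l; [lra|exact: ltW].
have -> : r = (1 - s) * r + s * r by ring.
exact: ler_ltD.
Qed.

Lemma disk0 : D 0.
Proof. by have : cabs (0 : Cplx R) < 1 by rewrite cabs0. Qed.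

Lemma convex_disk : convexC D.
Proof.
move=> x y s hx hy hs; have := @convex_ball 0 1 x y s; rewrite /= !subr0; exact.
Qed.

Lemma convexI C N : convexC C -> convexC N -> convexC (C `&` N).
Proof. by move=> hC hN x y s [Cx Nx] [Cy Ny] hs; split; [exact: hC|exact: hN]. Qed.

Lemma convex_tube z t d : convexC (tube z t d).
Proof.
move=> x y s [Dx [u hu xu]] [Dy [v hv yv]] hs; split; first exact: convex_disk.
exists (u + s * (v - u)).
  have /andP[s0 s1] := hs; have /andP[u0 ut] := hu; have /andP[v0 vt] := hv.
  have -> : u + s * (v - u) = (1 - s) * u + s * v by ring.
  have s1' : 0 <= 1 - s by lra.
  apply/andP; split; first by rewrite addr_ge0// mulr_ge0.
  have -> : t = (1 - s) * t + s * t by ring.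
  by apply: lerD; apply: ler_wpM2l.
have := @convex_ball 0 d (x - mkC u 0 * z) (y - mkC v 0 * z) s; rewrite /= !subr0.
move=> /(_ xu yv hs); congr (cabs _ < _).
have -> : mkC (u + s * (v - u)) 0 = mkC u 0 + mkC s 0 * (mkC v 0 - mkC u 0).
  by apply: eqC; rewrite !(reCD, imCD, reCM, imCM, reCN, imCN)/=; ring.
by ring.
Qed.

Lemma open_tube z t d x : tube z t d x -> exists2 e : R, 0 < e &
  forall w, cabs (w - x) < e -> tube z t d w.
Proof.
move=> [Dx [s hs hx]]; rewrite /unit_disk/= in Dx.
exists (Num.min (1 - cabs x) (d - cabs (x - mkC s 0 * z))).
  by rewrite lt_min !subr_gt0 Dx.
move=> w; rewrite lt_min => /andP[w1 w2]; split.
  by rewrite /unit_disk/=; have := cabsB w x; lra.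
exists s => //; have := cabsD (w - x) (x - mkC s 0 * z); rewrite addrA subrK; lra.
Qed.

Lemma lift_at_near f h phi psi z (d : R) : 0 < d ->
  (forall w, cabs (w - z) < d -> phi w = psi w) ->
  lift_at f h phi z -> lift_at f h psi z.
Proof.
move=> d0 E [h1 h2 /continuousCP h3].
have Ez : phi z = psi z by apply: E; rewrite subrr cabs0.
split; rewrite -?Ez//; apply/continuousCP => e /h3[d' d'0 H].
exists (Num.min d d'); first by rewrite lt_min d0.
by move=> w; rewrite lt_min => /andP[/E <- /H]; rewrite Ez.
Qed.

(** Continuation along the radius by [interval_induction], the induction statement including some
    width of the tube. *)
Lemma tube_lift f Omega h a z : evenly_covered f Omega ->
  (forall z, D z -> {for z, continuous h}) ->
  (forall z, D z -> Omega (h z)) -> D a -> f a = h 0 -> D z ->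
  exists phi, exists2 d : R, 0 < d &
    phi 0 = a /\ forall x, tube z 1 d x -> lift_at f h phi x.
Proof.
move=> ec hc hO Da fa Dz.
pose P (t : R) := exists phi, exists2 d : R, 0 < d &
    phi 0 = a /\ forall x, tube z t d x -> lift_at f h phi x.
have Dseg (s : R) : 0 <= s <= 1 -> D (mkC s 0 * z).
  move=> /andP[s0 s1]; rewrite /unit_disk/= cabsM cabs_real ger0_norm//.
  by apply: le_lt_trans Dz; rewrite ler_piMl// cabs_ge0.
have D0 : D 0 := disk0.
have cg (s t : R) : cabs (mkC s 0 * z - mkC t 0 * z) <= `|s - t|.
  rewrite -mulrBl cabsM; have -> : mkC s 0 - mkC t 0 = mkC (s - t) 0.
    by apply: eqC; rewrite ?reCD ?imCD ?reCN ?imCN/= ?subrr.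
  by rewrite cabs_real ler_piMr// ltW.
(* around [s] a sheet over an evenly covered neighbourhood of [h (s z)] extends
   any lift defined along the segment up to a nearby point *)
have local (s : R) : 0 <= s <= 1 -> exists2 rho : R, 0 < rho & forall b,
    cabs (b - mkC s 0 * z) < rho -> forall q, D q -> f q = h b ->
    exists2 psi, psi b = q & forall x, cabs (x - mkC s 0 * z) < rho -> D x /\ lift_at f h psi x.
  move=> hs; set p := mkC s 0 * z; have Dp : D p := Dseg s hs.
  have [U [oU Us [VV [oVV UE tV hV]]]] := ec _ (hO _ Dp).
  have [d d0 Hd] := open_cont oU Us (hc _ Dp).
  rewrite /unit_disk/= in Dp.
  have Dp' : 0 < 1 - cabs p by rewrite subr_gt0.
  exists (Num.min d (1 - cabs p)); first by rewrite lt_min d0.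
  move=> b; rewrite lt_min => /andP[bd bp] q Dq fq.
  have : (D `&` f @^-1` U) q by split => //=; rewrite fq; exact: Hd.
  rewrite UE => -[V VVV Vq].
  have [g [sf sg cfg cgf [_ ctg]]] := hV _ VVV.
  exists (fun x => g (h x)); first by rewrite -fq cfg// inE.
  move=> x; rewrite lt_min => /andP[xd xp].
  have Dx : D x by rewrite /unit_disk/=; have := cabsB x p; lra.
  have Ux : U (h x) by exact: Hd.
  split => //; split.
  - have : (\bigcup_(V in VV) V) (g (h x)) by exists V => //; exact: sg.
    by rewrite -UE => -[].
  - by rewrite cgf// inE.
  - rewrite (continuous_open_subspace g oU) in ctg.
    exact (continuous_comp (hc _ Dx) (ctg _ (mem_set Ux))).
suff : P 1 by [].
apply: interval_induction.
  have h01 : 0 <= (0 : R) <= 1 by apply/andP; split; [exact: lexx|exact: ler01].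
  have [rho rho0 H] := local 0 h01.
  have m0 : mkC 0 0 * z = 0 :> Cplx R by rewrite (_ : mkC 0 0 = 0) ?mul0r.
  rewrite m0 in H.
  have [|psi psi0 Hpsi] := H 0 _ a Da fa; first by rewrite subrr cabs0.
  exists psi; exists rho => //; split => // x [Dx [s]].
  rewrite -eq_le => /eqP <-; rewrite m0 => hx; exact: (Hpsi x hx).2.
move=> s hs; have [rho rho0 Hl] := local s hs.
exists (rho / 2); first by rewrite divr_gt0.
move=> t u ht hu ts us [phi [d d0 [phi0 Hphi]]].
set p := mkC s 0 * z in Hl.
have ctp : cabs (mkC t 0 * z - p) < rho.
  by apply: le_lt_trans (cg t s) _; lra.
have tt : tube z t d (mkC t 0 * z).
  split; first exact: Dseg.
  by exists t; [case/andP: ht => ->; rewrite lexx|rewrite subrr cabs0].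
have [Dq fq _] := Hphi _ tt.
have [psi psit Hpsi] := Hl _ ctp _ Dq fq.
pose B : set (Cplx R) := [set x | cabs (x - p) < rho].
(* The lifts agree at [t z] by the choice of [psi], and the intersection of tube and ball is
   convex. *)
have agree x : tube z t d x -> B x -> phi x = psi x.
  move=> tx Bx; apply: (@lift_unique f Omega h phi psi (tube z t d `&` B) (mkC t 0 * z) x) => //.
  - by apply: convexI; [exact: convex_tube|exact: convex_ball].
  - by move=> w [tw Bw]; split; [case: tw|split; [exact: Hphi|case: (Hpsi w Bw)]].
have T0 : tube z t d 0.
  split => //; exists 0; first by case/andP: ht => ->; rewrite lexx.
  by rewrite (_ : mkC 0 0 = 0) ?mul0r ?subrr ?cabs0.
(* Segment points with parameter between [t] and [u] are within [rho / 2] of [p], so with width at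
   most [rho / 2] the newly added part of the tube lies in the ball, where [psi] is used. *)
exists (fun x => if `[< B x >] then psi x else phi x); exists (Num.min d (rho / 2)).
  by rewrite lt_min d0 divr_gt0.
split; first by case: asboolP => // B0; rewrite -agree.
move=> x [Dx [v hv xv]]; move: xv; rewrite lt_min => /andP[xd xr].
have [Bx|nBx] := pselect (B x).
  have [_ Lx] := Hpsi x Bx.
  have rx : 0 < rho - cabs (x - p) by rewrite subr_gt0.
  apply: (lift_at_near rx) Lx => w hw; case: asboolP => // -[].
  by rewrite /B/=; have := cabsD (w - x) (x - p); rewrite addrA subrK; lra.
have tx : tube z t d x.
  split => //; have [vt|tv] := leP v t; first by exists v => //; case/andP: hv => ->.
  case: nBx; rewrite /B/=.
  have vs : `|v - s| < rho / 2.
    by move: ts us; rewrite !ltr_norml; case/andP: hv => ? ?; lra.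
  have := cabsD (x - mkC v 0 * z) (mkC v 0 * z - p); rewrite addrA subrK.
  have := cg v s; rewrite -/p; lra.
have [e e0 He] := open_tube tx.
apply: (lift_at_near e0) (Hphi _ tx) => w /He tw.
by case: asboolP => // /(agree _ tw).
Qed.

(** Each point takes its value from the lift along its own radius. For nearby points the two tubes
    meet in a convex set containing 0, where both lifts equal [a], so the values fit together
    continuously. *)
Lemma disk_lift f Omega h a : evenly_covered f Omega ->
  (forall z, D z -> {for z, continuous h}) ->
  (forall z, D z -> Omega (h z)) -> D a -> f a = h 0 ->
  exists2 phi, phi 0 = a & forall x, D x -> lift_at f h phi x.
Proof.
move=> ec hc hO Da fa.
have D0 : D 0 := disk0.
(* Choice needs a value at every [z]; outside the disk the pair [(f, 0)] is a dummy. *)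
have ex z : exists pd : (Cplx R -> Cplx R) * R, D z -> 0 < pd.2 /\
    pd.1 0 = a /\ forall x, tube z 1 pd.2 x -> lift_at f h pd.1 x.
  have [Dz|nDz] := pselect (D z); last by exists (f, 0).
  by have [phi [d d0 [h1 h2]]] := tube_lift ec hc hO Da fa Dz; exists (phi, d).
have [F HF] := choice ex.
have m0 : mkC 0 0 = 0 :> Cplx R by [].
have m1 : mkC 1 0 = 1 :> Cplx R by [].
have T0 z : D z -> tube z 1 (F z).2 0.
  move=> /HF[d0 _]; split => //; exists 0; first by rewrite lexx ler01.
  by rewrite m0 mul0r subrr cabs0.
have T1 z : D z -> tube z 1 (F z).2 z.
  move=> Dz; have [d0 _] := HF _ Dz; split => //; exists 1; first by rewrite lexx ler01.
  by rewrite m1 mul1r subrr cabs0.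
exists (fun z => (F z).1 z); first by have [_ []] := HF 0 D0.
move=> x Dx; have [d0 [F0 FL]] := HF x Dx.
have near (w : Cplx R) : cabs (w - x) < Num.min (F x).2 (1 - cabs x) -> D w /\ tube x 1 (F x).2 w.
  rewrite lt_min => /andP[w1 w2].
  have Dw : D w by rewrite /unit_disk/=; have := cabsB w x; lra.
  by split => //; split => //; exists 1; rewrite ?lexx ?ler01// m1 mul1r.
have dd : 0 < Num.min (F x).2 (1 - cabs x) by rewrite lt_min d0 subr_gt0.
apply: (lift_at_near dd) (FL _ (T1 x Dx)) => w /near[Dw tw].
have [e0 [G0 GL]] := HF w Dw.
apply: (@lift_unique f Omega h (F x).1 (F w).1 (tube x 1 (F x).2 `&` tube w 1 (F w).2) 0 w) => //.
- by apply: convexI; exact: convex_tube.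
- by move=> y [ty tw']; split; [case: ty|split; [exact: FL|exact: GL]].
- by split; exact: T0.
- by split => //; exact: T1.
- by rewrite F0 G0.
Qed.

Lemma holomorphic_lift f Omega h a : universal_covering Omega f -> Hol Omega h ->
  D a -> f a = h 0 ->
  exists phi, [/\ holomorphic_on D phi, forall z, D z -> D (phi z),
    phi 0 = a & forall z, D z -> f (phi z) = h z].
Proof.
move=> [[hf fO] [_ _ cov]] [hh hO] Da fa.
have ec : evenly_covered f Omega.
  move=> w /cov[U [oU Uw _ HU]]; exists U; split => //.
have hc z : D z -> {for z, continuous h} by move=> Dz; exact: (derivable_cont (hh z Dz)).
have [phi phi0 L] := disk_lift ec hc hO Da fa.
suff hphi : holomorphic_on D phi.
  by exists phi; split; [exact hphi|move=> z /L[]|exact phi0|move=> z /L[]].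
move=> z Dz; have [Dp fp cp] := L z Dz.
have [U [oU Uz [VV [oVV UE tV hV]]]] := ec _ (hO _ Dz).
have : (D `&` f @^-1` U) (phi z) by split => //=; rewrite fp.
rewrite UE => -[V VVV Vp].
have [e e0 He] := (openCP _).1 (oVV _ VVV) _ Vp.
have VD w : V w -> D w.
  move=> Vw; have : (\bigcup_(V in VV) V) w by exists V.
  by rewrite -UE => -[].
(* The sheet through [phi z] has the inverse [g], which makes [f] injective on a ball about [phi z];
   hence its derivative there is nonzero. *)
have [g [_ _ cfg _ _]] := hV _ VVV.
have df w : cabs (w - phi z) < e -> derivable f w 1 by move=> /He/VD; exact: hf.
have fi w y : cabs (w - phi z) < e -> cabs (y - phi z) < e -> f w = f y -> w = y.
  by move=> /He Vw /He Vy E; rewrite -(cfg w (mem_set Vw)) E (cfg y (mem_set Vy)).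
have /derivableCP[l Hl] := hf _ Dp.
have l0 := injective_derivative_neq0 e0 df fi Hl.
have dz : 0 < 1 - cabs z by rewrite subr_gt0.
apply: (lift_derivable dz cp Hl l0 (hh z Dz)) => w hw.
have Dw : D w by rewrite /unit_disk/=; have := cabsB w z; lra.
by have [] := L w Dw.
Qed.

End Lifting.

(** * Sub-mean value inequality for arbitrary positive powers of the modulus *)

Section PlaneSquares.
Variable R : realType.
Implicit Types (f F : Cplx R -> Cplx R) (z w : Cplx R) (r t : R).
Local Notation mu := (@lebesgue_measure R).
Local Notation D := (@unit_disk R).

(** Retypes a set of complex numbers in the measurable product that carries the area measure. *)
Definition planeset (U : set (Cplx R)) : set (measurableTypeR R * measurableTypeR R) :=
  [set xy | U (mkC xy.1 xy.2)].

Definition square z r : set (measurableTypeR R * measurableTypeR R) :=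
  `[reC z - r, reC z + r] `*` `[imC z - r, imC z + r].

Lemma squareP z r x y : square z r (x, y) <->
  `|reC (mkC x y - z)| <= r /\ `|imC (mkC x y - z)| <= r.
Proof.
rewrite reCD imCD reCN imCN /square /= !in_itv/= !ler_norml.
by split=> -[/andP[h1 h2] /andP[h3 h4]]; split; apply/andP; split; lra.
Qed.

Lemma measurable_square z r : measurable (square z r).
Proof. by apply: measurableX; exact: measurable_itv. Qed.

Lemma open_planeset (U : set (Cplx R)) : open U -> open (planeset U : set (R * R)).
Proof.
move=> oU; rewrite openE => -[x y] /((openCP _).1 oU)[e e0 He].
exists (ball x (e / 2), ball y (e / 2)); first by split; apply: nbhsx_ballx; rewrite divr_gt0.
move=> [s t] [h1 h2]; apply: He; apply: le_lt_trans (cabs_le _) _.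
by move: h1 h2; rewrite /ball/= => h1 h2; rewrite (splitr e); apply: ltrD; rewrite distrC.
Qed.

Lemma open_disk : open D.
Proof.
apply/openCP => z Dz; rewrite /unit_disk/= in Dz; exists (1 - cabs z); first by rewrite subr_gt0.
by move=> w hw; rewrite /unit_disk/=; have := cabsB w z; lra.
Qed.

Lemma measurable_planeset (U : set (Cplx R)) : open U -> measurable (planeset U).
Proof. by move=> /open_planeset/open_measurable_plane. Qed.

Lemma measurable_abs_powR (U : set (Cplx R)) f (p : R) : open U -> holomorphic_on U f ->
  measurable_fun (planeset U) (fun xy => cabs (f (mkC xy.1 xy.2)) `^ p).
Proof.
move=> oU hf; apply: (measurableT_comp (measurable_powR p)).
exact: (measurable_rcont (u := fun z => cabs (f z)) (open_planeset oU)
  (fun xy Vxy => rcont_abs (derivable_cont (hf _ Vxy)))).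
Qed.

Lemma cabs_rcont z : rcont (@cabs R) z.
Proof.
move=> e e0; exists e => // w; apply: le_lt_trans.
rewrite ler_norml; have := cabsB w z; have := cabsB z w; rewrite (cabsBC z); lra.
Qed.

Lemma rcontX (u : Cplx R -> R) n z : rcont u z -> rcont (fun w => u w ^+ n) z.
Proof.
move=> Hu; elim: n => [|n IH].
  have -> : (fun w => u w ^+ 0) = fun=> 1 by apply/funext => w; rewrite expr0.
  exact: rcont_cst.
have -> : (fun w => u w ^+ n.+1) = fun w => u w * u w ^+ n by apply/funext => w; rewrite exprS.
exact: rcontM.
Qed.

Lemma measurable_disk_weight (alpha : R) :
  measurable_fun (planeset D) (fun xy => (1 - cabs (mkC xy.1 xy.2) ^+ 2) `^ alpha).
Proof.
apply: (measurableT_comp (measurable_powR alpha)).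
apply: (measurable_rcont (u := fun z : Cplx R => 1 - cabs z ^+ 2) (open_planeset open_disk)) => xy _.
have c2 := rcontX 2 (@cabs_rcont (mkC xy.1 xy.2)).
move=> e /c2[d d0 Hd]; exists d => // w /Hd.
by rewrite opprD opprK addrACA subrr add0r addrC distrC.
Qed.

(** Sup-norm distance from [w] to the boundary of [square z r], counted negatively outside. *)
Definition sq_depth z r w : R := r - Num.max `|reC (w - z)| `|imC (w - z)|.

Lemma sq_depth_rcont z r w : rcont (sq_depth z r) w.
Proof.
move=> e e0; exists e => // x xw; rewrite /sq_depth.
have hre : `|reC (x - z)| <= `|reC (w - z)| + cabs (x - w).
  have -> : x - z = (w - z) + (x - w) by ring.
  by rewrite reCD; apply: le_trans (ler_normD _ _) _; rewrite lerD2l reC_le.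
have him : `|imC (x - z)| <= `|imC (w - z)| + cabs (x - w).
  have -> : x - z = (w - z) + (x - w) by ring.
  by rewrite imCD; apply: le_trans (ler_normD _ _) _; rewrite lerD2l imC_le.
have hre' : `|reC (w - z)| <= `|reC (x - z)| + cabs (x - w).
  have -> : w - z = (x - z) + (w - x) by ring.
  by rewrite reCD cabsBC; apply: le_trans (ler_normD _ _) _; rewrite lerD2l reC_le.
have him' : `|imC (w - z)| <= `|imC (x - z)| + cabs (x - w).
  have -> : w - z = (x - z) + (w - x) by ring.
  by rewrite imCD cabsBC; apply: le_trans (ler_normD _ _) _; rewrite lerD2l imC_le.
apply: le_lt_trans xw; move: hre him hre' him'.
move: `|reC (x - z)| `|imC (x - z)| `|reC (w - z)| `|imC (w - z)| (cabs (x - w)) => a b c d k h1 h2 h3 h4.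
rewrite ler_norml.
have m1 : Num.max a b <= Num.max c d + k.
  by rewrite ge_max; apply/andP; split; [apply: le_trans h1 _|apply: le_trans h2 _];
    rewrite lerD2r le_max lexx ?orbT.
have m2 : Num.max c d <= Num.max a b + k.
  by rewrite ge_max; apply/andP; split; [apply: le_trans h3 _|apply: le_trans h4 _];
    rewrite lerD2r le_max lexx ?orbT.
apply/andP; split; lra.
Qed.

Lemma sq_depth_sub z r w x y (rho : R) : sq_depth z r w = 2 * rho ->
  square w rho (x, y) -> square z r (x, y) /\ rho <= sq_depth z r (mkC x y).
Proof.
rewrite /sq_depth => hd /squareP[h1 h2].
have k1 : `|reC (w - z)| <= Num.max `|reC (w - z)| `|imC (w - z)| by rewrite le_max lexx.
have k2 : `|imC (w - z)| <= Num.max `|reC (w - z)| `|imC (w - z)| by rewrite le_max lexx orbT.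
have rho0 : 0 <= rho by apply: le_trans h1.
have E : mkC x y - z = (mkC x y - w) + (w - z) by ring.
have a1 : `|reC (mkC x y - z)| <= r - rho.
  rewrite E reCD; apply: le_trans (ler_normD _ _) _; lra.
have a2 : `|imC (mkC x y - z)| <= r - rho.
  rewrite E imCD; apply: le_trans (ler_normD _ _) _; lra.
split; first by apply/squareP; split; [apply: le_trans a1 _|apply: le_trans a2 _]; lra.
rewrite lerBrDr addrC -lerBrDr ge_max; apply/andP; split => //.
Qed.

(* At a point maximising [|F| * depth ^ N] the factor [|F| ^ (1 - q)] is under
   control on the square of half its depth. *)
Lemma local_power_small F (q : R) N z r : 0 < q -> q <= 1 -> 2 <= N%:R * q ->
  holomorphic_on D F -> 0 < r -> square z r `<=` planeset D ->
  ((cabs (F z) `^ q * r ^+ 2)%:E <= (4 * 2 ^+ N)%:E *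
    \int[mu \x mu]_(xy in square z r) (cabs (F (mkC xy.1 xy.2)) `^ q)%:E)%E.
Proof.
move=> q0 q1 Nq hF r0 sD.
set I := (\int[_]_(_ in _) _)%E.
have I0 : (0 <= I)%E by apply: integral_ge0 => xy _; rewrite lee_fin powR_ge0.
have C0 : 0 < 4 * 2 ^+ N :> R by rewrite mulr_gt0// exprn_gt0.
have [->|Ifin] := eqVneq I +oo%E; first by rewrite gt0_muley ?leey// lte_fin.
have If : I \is a fin_num by rewrite ge0_fin_numE// ltey.
rewrite -(fineK If) -EFinM lee_fin; set J := fine I.
have J0 : 0 <= J by exact: fine_ge0.
have [Fz0|Fz0] := eqVneq (cabs (F z)) 0.
  by rewrite Fz0 powR0 ?gt_eqF// mul0r mulr_ge0// ltW.
have Fzp : 0 < cabs (F z) by rewrite lt0r Fz0 cabs_ge0.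
pose u w := cabs (F w) * sq_depth z r w ^+ N.
have inD x y : reC z - r <= x <= reC z + r -> imC z - r <= y <= imC z + r -> D (mkC x y).
  by move=> hx hy; apply: (sD (x, y)); split; rewrite /= in_itv.
have [|||x [y [hx hy Hm]]] := @rect_max R u (reC z - r) (reC z + r) (imC z - r) (imC z + r).
- by lra.
- by lra.
- move=> x y hx hy; apply: rcontM; last by apply: rcontX; exact: sq_depth_rcont.
  by apply: rcont_abs; exact: (derivable_cont (hF _ (inD x y hx hy))).
set w := mkC x y in Hm; pose M := u w.
have zM : cabs (F z) * r ^+ N <= M.
  have := Hm (reC z) (imC z) _ _; rewrite mkCK /u/sq_depth subrr normr0 maxxx subr0; apply;
  by apply/andP; split; lra.
have M0 : 0 < M by apply: lt_le_trans zM; rewrite mulr_gt0// exprn_gt0.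
have dw0 : 0 <= sq_depth z r w.
  rewrite /sq_depth subr_ge0 ge_max reCD imCD reCN imCN/= !ler_norml.
  by apply/andP; split; apply/andP; split; lra.
have dw : 0 < sq_depth z r w.
  rewrite lt0r dw0 andbT; apply/eqP => E; move: M0; rewrite /M/u E.
  have : (0 < N)%N by case: (N) Nq => //; rewrite mul0r; lra.
  by case: (N) => // n _; rewrite exprS mul0r mulr0 ltxx.
pose rho := sq_depth z r w / 2; have rho0 : 0 < rho by rewrite divr_gt0.
have rhoE : sq_depth z r w = 2 * rho by rewrite /rho; lra.
have rhor : rho <= r.
  by have : sq_depth z r w <= r by [rewrite /sq_depth gerBl le_max normr_ge0]; lra.
have sub := @sq_depth_sub z r w _ _ rho rhoE.
(* On [square w rho] the depth is at least [rho], so maximality bounds [|F|] by [X]; the depth at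
   [w] is [2 * rho], so [X] is just [2 ^+ N * |F w|]. *)
pose X := M / rho ^+ N; have X0 : 0 < X by rewrite divr_gt0// exprn_gt0.
have FX s t : square w rho (s, t) -> cabs (F (mkC s t)) <= X.
  move=> /sub[hs hd].
  have : u (mkC s t) <= M by case: hs; rewrite /= !in_itv/= => ? ?; exact: Hm.
  rewrite /u /X ler_pdivlMr ?exprn_gt0//; apply: le_trans; apply: ler_wpM2l; first exact: cabs_ge0.
  by apply: lerXn2r; rewrite ?nnegrE ?(ltW rho0)// (le_trans (ltW rho0)).
have Fw : cabs (F w) * 2 ^+ N = X.
  by rewrite /X /M /u rhoE exprMn mulrA mulfK// expf_neq0// gt_eqF.
have hFq s t : square w rho (s, t) -> cabs (F (mkC s t)) <= X `^ (1 - q) * cabs (F (mkC s t)) `^ q.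
  move=> /FX h; have c0 := cabs_ge0 (F (mkC s t)).
  have [->|cn0] := eqVneq (cabs (F (mkC s t))) 0; first by rewrite mulr_ge0 ?powR_ge0.
  rewrite -{1}[cabs _]powRr1// -{1}(subrK q 1) powRD; last by rewrite cn0 implybT.
  apply: ler_wpM2r; first exact: powR_ge0.
  by apply: ge0_ler_powR; rewrite ?nnegrE ?subr_ge0// ltW.
have swD : square w rho `<=` planeset D by move=> [s t] /sub[/sD].
have inw s t : x - rho <= s <= x + rho -> y - rho <= t <= y + rho -> D (mkC s t).
  by move=> hs ht; apply: (swD (s, t)); split; rewrite /= in_itv.
have H1 : ((rho ^+ 2 * cabs (F w))%:E <= 4%:E * \int[mu \x mu]_(xy in square w rho) (cabs (F (mkC xy.1 xy.2)))%:E)%E.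
  exact: (area_mean open_disk hF rho0 inw).
have mF (pp : R) : measurable_fun (square w rho) (fun xy => cabs (F (mkC xy.1 xy.2)) `^ pp).
  by apply: (measurable_funS (measurable_planeset open_disk) swD); exact: measurable_abs_powR open_disk hF.
have mz (pp : R) : measurable_fun (square z r) (fun xy => cabs (F (mkC xy.1 xy.2)) `^ pp).
  by apply: (measurable_funS (measurable_planeset open_disk) sD); exact: measurable_abs_powR open_disk hF.
have H2 : (\int[mu \x mu]_(xy in square w rho) (cabs (F (mkC xy.1 xy.2)))%:E <= (X `^ (1 - q))%:E * I)%E.
  apply: (@le_trans _ _ (\int[mu \x mu]_(xy in square w rho) ((X `^ (1 - q))%:E * (cabs (F (mkC xy.1 xy.2)) `^ q)%:E))%E).
    apply: ge0_le_integral.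
    - exact: measurable_square.
    - by move=> xy _; rewrite lee_fin cabs_ge0.
    - apply/measurable_EFinP; have := mF 1; congr (measurable_fun _ _).
      by apply/funext => xy; rewrite powRr1// cabs_ge0.
    - apply/measurable_EFinP; apply: (measurable_funM (f := cst (X `^ (1 - q)))) => //; exact: mF.
    - by move=> [s t] hst; rewrite -EFinM lee_fin; exact: hFq.
  rewrite ge0_integralZl_EFin ?powR_ge0//; last 3 first.
  - exact: measurable_square.
  - by move=> xy _; rewrite lee_fin powR_ge0.
  - by apply/measurable_EFinP; exact: mF.
  apply: lee_wpmul2l; first by rewrite lee_fin powR_ge0.
  apply: ge0_subset_integral.
  - exact: measurable_square.
  - exact: measurable_square.
  - by apply/measurable_EFinP; exact: mz.
  - by move=> xy _; rewrite lee_fin powR_ge0.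
  - by move=> [s t] /sub[].
have {H1 H2} H3 : rho ^+ 2 * cabs (F w) <= 4 * (X `^ (1 - q) * J).
  rewrite -lee_fin; apply: le_trans H1 _; rewrite EFinM EFinM.
  by apply: lee_wpmul2l; [rewrite lee_fin|rewrite /J fineK].
(* Cancelling [X] to the power [1 - q] on both sides of the area estimate is where the two-sided
   control of [|F|] by [X] pays off. *)
have Xsplit : X `^ (1 - q) * X `^ q = X.
  by rewrite -powRD ?subrK ?powRr1 ?(ltW X0)// gt_eqF// implybT.
have H4 : X `^ q * rho ^+ 2 <= 4 * 2 ^+ N * J.
  rewrite -(ler_pM2l (powR_gt0 (1 - q) X0)) mulrA Xsplit -{1}Fw.
  have := ler_wpM2l (exprn_ge0 N (ler0n R 2)) H3; lra.
apply: le_trans H4.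
have ratio : 1 <= r / rho by rewrite ler_pdivlMr// mul1r.
have XF : cabs (F z) * (r / rho) ^+ N <= X.
  by rewrite /X expr_div_n mulrA ler_pM2r// invr_gt0 exprn_gt0.
(* Returning from [w] to [z]: as [r / rho >= 1] and [N * q >= 2], the weight compensates for the
   smaller area [rho ^+ 2]. *)
have Fq : cabs (F z) `^ q * (r / rho) ^+ 2 <= X `^ q.
  apply: (@le_trans _ _ ((cabs (F z) * (r / rho) ^+ N) `^ q)); last first.
    apply: ge0_ler_powR XF; rewrite ?nnegrE ?(ltW q0) ?(ltW X0)//.
    by rewrite mulr_ge0 ?cabs_ge0// exprn_ge0// (le_trans ler01).
  have rr0 : 0 <= r / rho by exact: le_trans ler01 ratio.
  rewrite powRM ?cabs_ge0 ?exprn_ge0//; apply: ler_wpM2l; first exact: powR_ge0.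
  rewrite -!powR_mulrn// -powRrM; apply: ler_powR => //.
have := ler_wpM2r (sqr_ge0 rho) Fq; rewrite expr_div_n -!mulrA.
by rewrite mulVf ?mulr1// expf_neq0// gt_eqF.
Qed.

(** For a natural number [n >= p] the function [f ^+ n] is holomorphic and
    [|f|^p = |f ^+ n|^(p / n)], so an exponent at most 1 suffices. *)
Lemma local_power f (p : R) : 0 < p -> holomorphic_on D f ->
  exists2 C : R, 0 < C & forall z r, 0 < r -> square z r `<=` planeset D ->
  ((cabs (f z) `^ p * r ^+ 2)%:E <= C%:E *
    \int[mu \x mu]_(xy in square z r) (cabs (f (mkC xy.1 xy.2)) `^ p)%:E)%E.
Proof.
move=> p0 hf; pose n := (Num.truncn p).+1.
have np : p <= n%:R by have /truncn_itv/andP[_ /ltW] := ltW p0.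
have n0 : 0 < n%:R :> R by rewrite ltr0n.
pose q := p / n%:R; have q0 : 0 < q by rewrite divr_gt0.
have q1 : q <= 1 by rewrite ler_pdivrMr// mul1r.
pose N := (Num.truncn (2 / q)).+1.
have Nq : 2 <= N%:R * q.
  have /truncn_itv/andP[_ /ltW] : 0 <= 2 / q by rewrite divr_ge0// ltW.
  by rewrite -/N ler_pdivrMr.
exists (4 * 2 ^+ N); first by rewrite mulr_gt0// exprn_gt0.
move=> z r r0 sD.
have hF : holomorphic_on D (fun w => f w ^+ n).
  by move=> w Dw; exact: (dC_exp n (hf w Dw)).
have E w : cabs (f w ^+ n) `^ q = cabs (f w) `^ p.
  by rewrite cabsX -powR_mulrn ?cabs_ge0// -powRrM /q mulrC divfK ?gt_eqF.
have := local_power_small q0 q1 Nq hF r0 sD; rewrite E.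
by under eq_integral do rewrite E.
Qed.

End PlaneSquares.

(** * Growth exponents against Bergman exponents *)

Section GrowthBergman.
Variable R : realType.
Implicit Types (f : Cplx R -> Cplx R) (z w : Cplx R) (p alpha beta c : R).
Implicit Types (Omega : set (Cplx R)).
Local Notation mu := (@lebesgue_measure R).
Local Notation D := (@unit_disk R).

Lemma disk_pos z : D z -> 0 < 1 - cabs z <= 1.
Proof. by rewrite /unit_disk/= => h; have := cabs_ge0 z; lra. Qed.

Lemma HinfP beta f : Hinf beta f <->
  holomorphic_on D f /\ exists C : R, forall z, D z -> cabs (f z) * weight beta z <= C.
Proof.
split=> -[hf H]; split => //; last first.
  case: H => C HC; apply: (@le_lt_trans _ _ C%:E); last exact: ltry.
  by apply: ge_ereal_sup => _ [z Dz <-]; rewrite lee_fin; exact: HC.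
set S := ereal_sup _ in H.
have S0 : (0 <= S)%E.
  apply: (@le_trans _ _ ((cabs (f 0) * weight beta 0)%:E)).
    by rewrite lee_fin mulr_ge0 ?cabs_ge0// /weight powR_ge0.
  by apply: ereal_sup_ubound; exists 0 => //; exact: disk0.
have Sf : S \is a fin_num by rewrite ge0_fin_numE.
exists (fine S) => z Dz; rewrite -lee_fin fineK//.
by apply: ereal_sup_ubound; exists z.
Qed.

Lemma Hinf_mono beta gamma f : beta <= gamma -> Hinf beta f -> Hinf gamma f.
Proof.
move=> bg /HinfP[hf [C HC]]; apply/HinfP; split => //; exists C => z Dz.
apply: le_trans (HC z Dz); apply: ler_wpM2l; first exact: cabs_ge0.
by rewrite /weight; apply: ger_powR => //; exact: disk_pos.
Qed.

Lemma integral_disk_lty (g : measurableTypeR R * measurableTypeR R -> R) (K : R) :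
  measurable_fun (planeset D) g -> (forall xy, planeset D xy -> 0 <= g xy <= K) ->
  (\int[mu \x mu]_(xy in planeset D) (g xy)%:E < +oo)%E.
Proof.
move=> mg Hg; have mD := measurable_planeset (@open_disk R).
have sub : planeset D `<=` square 0 1.
  move=> [x y] /=; rewrite /planeset/= /unit_disk/= => h; apply/squareP; rewrite subr0.
  by split; apply: le_trans (ltW h); [exact: reC_le|exact: imC_le].
have K0 : 0 <= K.
  have D00 : planeset D (0, 0) by exact: disk0.
  by have /andP[h1 h2] := Hg _ D00; exact: le_trans h1 h2.
apply: (@le_lt_trans _ _ (\int[mu \x mu]_(xy in planeset D) (cst K%:E) xy)%E).
  apply: ge0_le_integral => //.
  - by move=> xy /Hg/andP[h _]; rewrite lee_fin.
  - by apply/measurable_EFinP.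
  - by move=> xy /Hg/andP[_ h]; rewrite lee_fin.
rewrite integral_cst//.
apply: (@le_lt_trans _ _ (K%:E * (mu \x mu) (square 0 1))%E).
  apply: lee_wpmul2l; first by rewrite lee_fin.
  by apply: le_measure; rewrite ?inE//; exact: measurable_square.
have mI (a : R) : mu `[a - 1, a + 1] = 2%:E.
  transitivity (if ((a - 1)%:E < (a + 1)%:E)%E then ((a + 1)%:E - (a - 1)%:E)%E else 0%E).
    exact: (lebesgue_measure_itv `[a - 1, a + 1]).
  by rewrite lte_fin ifT; [rewrite -EFinB; congr EFin; ring|lra].
have -> : ((mu \x mu) (square 0 1) = 2%:E * 2%:E)%E.
  transitivity (mu `[(reC (0 : Cplx R) - 1)%R, (reC (0 : Cplx R) + 1)%R] *
                mu `[(imC (0 : Cplx R) - 1)%R, (imC (0 : Cplx R) + 1)%R])%E; last by rewrite !mI.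
  by apply: product_measure1E; exact: measurable_itv.
by rewrite -!EFinM ltry.
Qed.

(** For [p = alpha / beta] the weight [(1 - |z|)^alpha] is the [p]-th power of [weight beta], so the
    integrand is bounded, with [1 - |z|^2 <= 2 (1 - |z|)]. *)
Lemma growth_Bergman beta alpha f : 0 < beta -> 0 < alpha -> Hinf beta f ->
  Bergman_space (alpha / beta) alpha f.
Proof.
move=> b0 a0 /HinfP[hf [C HC]]; split => //.
set p := alpha / beta; have p0 : 0 < p by rewrite divr_gt0.
have C0 : 0 <= C.
  have h := HC 0 (@disk0 R); apply: le_trans h.
  by rewrite mulr_ge0 ?cabs_ge0// /weight powR_ge0.
apply: (@integral_disk_lty (fun xy => (1 - cabs (mkC xy.1 xy.2) ^+ 2) `^ alpha *
        cabs (f (mkC xy.1 xy.2)) `^ p) (2 `^ alpha * C `^ p)).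
  apply: measurable_funM; first exact: measurable_disk_weight.
  exact: (measurable_abs_powR _ (@open_disk R) hf).
move=> [x y] Dxy; set z := mkC x y; have Dz : D z by [].
have /andP[z0 z1] := disk_pos Dz; have cz := cabs_ge0 z.
rewrite mulr_ge0 ?powR_ge0//=.
have h1 : (1 - cabs z ^+ 2) `^ alpha <= (2 * (1 - cabs z)) `^ alpha.
  by apply: ge0_ler_powR; rewrite ?nnegrE ?(ltW a0)//; nra.
apply: le_trans (ler_wpM2r (powR_ge0 _ _) h1) _.
rewrite powRM ?(ltW z0)// -mulrA; apply: ler_wpM2l; first exact: powR_ge0.
have -> : (1 - cabs z) `^ alpha = weight beta z `^ p.
  by rewrite /weight -powRrM /p mulrCA divff ?mulr1// gt_eqF.
rewrite -powRM ?cabs_ge0 ?powR_ge0// mulrC.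
apply: ge0_ler_powR; rewrite ?nnegrE ?(ltW p0)//; last exact: HC.
by rewrite mulr_ge0 ?cabs_ge0 ?powR_ge0.
Qed.

Lemma Bergman_growth p alpha f : 0 < p -> Bergman_space p alpha f ->
  Hinf ((alpha + 2) / p) f.
Proof.
move=> p0 [hf HI]; apply/HinfP; split => //.
have [C C0 HC] := local_power p0 hf.
set B := (\int[_]_(_ in _) _)%E in HI.
have B0 : (0 <= B)%E.
  by apply: integral_ge0 => xy _; rewrite lee_fin mulr_ge0 ?powR_ge0.
have Bf : B \is a fin_num by rewrite ge0_fin_numE.
pose b := fine B; have b0 : 0 <= b by exact: fine_ge0.
(* On the square [1 - |w|^2] lies between [2 * r] and [12 * r]; the sign of [alpha] decides which
   end bounds its power from below. *)
pose kappa : R := Num.min (2 `^ alpha) (12 `^ alpha).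
have kappa0 : 0 < kappa by rewrite lt_min !powR_gt0.
pose C1 := C * (kappa^-1 * b).
have C10 : 0 <= C1 by rewrite mulr_ge0 ?mulr_ge0 ?invr_ge0// ltW.
exists (4 `^ ((alpha + 2) / p) * C1 `^ p^-1) => z Dz.
have /andP[z0 z1] := disk_pos Dz; have cz := cabs_ge0 z.
(* Points of the square are within [2 * r] of [z], which keeps it in the disk at a distance from the
   circle comparable to [r]. *)
pose r := (1 - cabs z) / 4; have r0 : 0 < r by rewrite divr_gt0.
have rE : 1 - cabs z = 4 * r by rewrite /r; lra.
have near x y : square z r (x, y) -> 2 * r <= 1 - cabs (mkC x y) <= 6 * r.
  move=> /squareP[h1 h2]; have h3 : cabs (mkC x y - z) <= 2 * r.
    by apply: le_trans (cabs_le _) _; lra.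
  have := cabsB (mkC x y) z; have := cabsB z (mkC x y); rewrite (cabsBC z).
  by move=> h4 h5; apply/andP; split; lra.
have sD : square z r `<=` planeset D.
  move=> [x y] /near/andP[h _]; have h' : cabs (mkC x y) < 1 by lra.
  exact: h'.
have ra0 : 0 < r `^ alpha by exact: powR_gt0.
have scale (c gam : R) : 0 <= c -> (c * r) `^ gam = c `^ gam * r `^ gam.
  by move=> c0; apply: powRM => //; exact: ltW.
have low x y : square z r (x, y) -> kappa * r `^ alpha <= (1 - cabs (mkC x y) ^+ 2) `^ alpha.
  move=> /near/andP[h1 h2]; set t := cabs (mkC x y) in h1 h2 *.
  have t0 : 0 <= t by exact: cabs_ge0.
  have k1 : 2 * r <= 1 - t ^+ 2 by nra.
  have k2 : 1 - t ^+ 2 <= 12 * r by nra.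
  have k0 : 0 < 1 - t ^+ 2 by lra.
  have [a0|a0] := leP 0 alpha.
    apply: (@le_trans _ _ ((2 * r) `^ alpha)).
      rewrite scale//; apply: ler_wpM2r; first exact: powR_ge0.
      by rewrite ge_min lexx.
    by apply: ge0_ler_powR; rewrite ?nnegrE//; lra.
  apply: (@le_trans _ _ ((12 * r) `^ alpha)).
    rewrite scale//; apply: ler_wpM2r; first exact: powR_ge0.
    by rewrite ge_min lexx orbT.
  rewrite -[alpha]opprK !(powRN _ (- alpha)) lef_pV2 ?posrE ?powR_gt0//; last by lra.
  by apply: ge0_ler_powR; rewrite ?nnegrE//; lra.
have mD := measurable_planeset (@open_disk R).
have mf := measurable_abs_powR p (@open_disk R) hf.
have mw := @measurable_disk_weight R alpha.
have I1 : ((kappa * r `^ alpha)%:E * \int[mu \x mu]_(xy in square z r) (cabs (f (mkC xy.1 xy.2)) `^ p)%:E <= B)%E.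
  rewrite -ge0_integralZl_EFin; first last.
  - by rewrite mulr_ge0// ltW.
  - by apply/measurable_EFinP; apply: measurable_funS mf.
  - by move=> xy _; rewrite lee_fin powR_ge0.
  - exact: measurable_square.
  have mprod : measurable_fun (planeset D) (fun xy => (1 - cabs (mkC xy.1 xy.2) ^+ 2) `^ alpha *
        cabs (f (mkC xy.1 xy.2)) `^ p) by exact: measurable_funM.
  apply: (@le_trans _ _ (\int[mu \x mu]_(xy in square z r)
     ((1 - cabs (mkC xy.1 xy.2) ^+ 2) `^ alpha * cabs (f (mkC xy.1 xy.2)) `^ p)%:E)%E).
    apply: ge0_le_integral.
    - exact: measurable_square.
    - by move=> xy _; rewrite lee_fin mulr_ge0 ?powR_ge0// mulr_ge0// ltW.
    - apply/measurable_EFinP; apply: (measurable_funM (f := cst (kappa * r `^ alpha))) => //.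
      exact: measurable_funS mf.
    - by apply/measurable_EFinP; exact: measurable_funS mprod.
    - move=> [x y] hxy; rewrite -EFinM lee_fin; apply: ler_wpM2r; first exact: powR_ge0.
      exact: low.
  apply: ge0_subset_integral.
  - exact: measurable_square.
  - exact: mD.
  - by apply/measurable_EFinP; exact: mprod.
  - by move=> xy _; rewrite lee_fin mulr_ge0 ?powR_ge0.
  - exact: sD.
have kr0 : 0 < kappa * r `^ alpha by rewrite mulr_gt0.
have I2 : ((kappa * r `^ alpha * (cabs (f z) `^ p * r ^+ 2))%:E <= (C * b)%:E)%E.
  rewrite EFinM.
  apply: le_trans (lee_wpmul2l _ (HC z r r0 sD)) _; first by rewrite lee_fin ltW.
  rewrite muleA (muleC (kappa * _)%:E) -muleA (EFinM C b).
  apply: lee_wpmul2l; first by rewrite lee_fin ltW.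
  by rewrite /b fineK.
rewrite lee_fin in I2.
have I3 : cabs (f z) `^ p * r `^ (alpha + 2) <= C1.
  rewrite powRD; last by apply/implyP => _; rewrite (gt_eqF r0).
  have -> : r `^ 2 = r ^+ 2 by rewrite -powR_mulrn// ltW.
  rewrite -(ler_pM2l kappa0) /C1.
  have -> : kappa * (C * (kappa^-1 * b)) = (kappa * kappa^-1) * (C * b) by ring.
  rewrite divff ?gt_eqF// mul1r; apply: le_trans I2; rewrite le_eqVlt; apply/orP; left; apply/eqP; ring.
have I4 : cabs (f z) * r `^ ((alpha + 2) / p) <= C1 `^ p^-1.
  have pV : p * p^-1 = 1 by rewrite divff// gt_eqF.
  have -> : cabs (f z) * r `^ ((alpha + 2) / p) = (cabs (f z) `^ p * r `^ (alpha + 2)) `^ p^-1.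
    by rewrite powRM ?powR_ge0// -!powRrM pV powRr1// cabs_ge0.
  by apply: ge0_ler_powR; rewrite ?nnegrE ?invr_ge0 ?(ltW p0)// mulr_ge0 ?powR_ge0.
by rewrite /weight rE scale// mulrCA; apply: ler_wpM2l => //; exact: powR_ge0.
Qed.

Lemma bergman_number_fun_ge0 f : (0 <= bergman_number_fun f)%E.
Proof.
rewrite /bergman_number_fun /esup0; case: eqVneq => // /set0P[x Ax].
apply: (@le_trans _ _ x); last exact: ereal_sup_ubound.
case: Ax => -[p alpha] [/= p0 a1 _] <-; rewrite lee_fin divr_ge0 ?(ltW p0)//; lra.
Qed.

Lemma bergman_number_ge0 Omega : (0 <= bergman_number Omega)%E.
Proof. by apply: le_ereal_inf_tmp => _ [f _ <-]; exact: bergman_number_fun_ge0. Qed.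

(** Every [alpha > 0] gives the quotient [alpha / (beta (alpha + 2))]; these increase to [1 / beta]
    without reaching it. *)
Lemma bergman_fun_ge beta f : 0 < beta -> Hinf beta f ->
  ((beta^-1)%:E <= bergman_number_fun f)%E.
Proof.
move=> b0 Hf; have lower alpha : 0 < alpha -> ((alpha / beta / (alpha + 2))%:E <= bergman_number_fun f)%E.
  move=> a0; set S := [set (pa.1 / (pa.2 + 2))%:E | pa in
    [set pa : R * R | [/\ 0 < pa.1, -1 < pa.2 & Bergman_space pa.1 pa.2 f]]].
  have Sx : S (alpha / beta / (alpha + 2))%:E.
    exists (alpha / beta, alpha) => //=; split; [by rewrite divr_gt0|lra|exact: growth_Bergman].
  rewrite /bergman_number_fun -/S /esup0; case: eqVneq Sx => [->//|_ Sx].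
  exact: ereal_sup_ubound.
rewrite leNgt; apply/negP => h.
have := bergman_number_fun_ge0 f; move: lower h; case: (bergman_number_fun f) => // b lower.
rewrite lte_fin lee_fin => h b0'.
have bb : 0 < 1 - b * beta by rewrite subr_gt0 -ltr_pdivlMr// mul1r.
(* The quotient exceeds [b] as soon as [alpha (1 - b beta) > 2 b beta]; here the left side is
   [2 b beta + 2]. *)
pose alpha := 2 * (b * beta + 1) / (1 - b * beta).
have bb0 : 0 <= b * beta by rewrite mulr_ge0// ltW.
have a0 : 0 < alpha by rewrite divr_gt0//; lra.
have aE : alpha * (1 - b * beta) = 2 * (b * beta + 1) by rewrite /alpha divfK// gt_eqF.
have := lower _ a0; rewrite lee_fin ler_pdivrMr; last by lra.
rewrite ler_pdivrMr//; nra.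
Qed.

(** The strict inequality provides a pair with [p / (alpha + 2) > c], whose growth exponent is less
    than [1 / c]. If there are no pairs, the convention [esup0] gives 0, which is not above [c]. *)
Lemma bergman_fun_growth c f : 0 < c -> holomorphic_on D f ->
  (c%:E < bergman_number_fun f)%E -> Hinf c^-1 f.
Proof.
move=> c0 hf; rewrite /bergman_number_fun /esup0; case: eqVneq => [_|_].
  by rewrite lte_fin => h; have := lt_trans c0 h; rewrite ltxx.
move=> /ereal_sup_gt[_ [[p alpha] [/= p0 a1 Hf] <-]]; rewrite lte_fin => h.
apply: Hinf_mono (Bergman_growth p0 Hf).
have a2 : 0 < alpha + 2 by lra.
by rewrite ler_pdivrMr// mulrC ler_pdivlMr// mulrC; move: h; rewrite ltr_pdivlMr// => /ltW.
Qed.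

Definition growth_exponent Omega beta := 0 < beta /\ Hol Omega `<=` Hinf beta.

Lemma bergman_ge Omega beta : growth_exponent Omega beta ->
  ((beta^-1)%:E <= bergman_number Omega)%E.
Proof.
move=> [b0 H]; apply: le_ereal_inf_tmp => _ [f Hf <-].
by apply: bergman_fun_ge => //; exact: H.
Qed.

(** Converse of [bergman_ge] up to the endpoint; the two together give all three cases of the
    comparison. *)
Lemma growth_exponent_bergman Omega c : 0 < c -> (c%:E < bergman_number Omega)%E ->
  growth_exponent Omega c^-1.
Proof.
move=> c0 h; split; first by rewrite invr_gt0.
move=> f Hf; apply: bergman_fun_growth => //; first by case: Hf.
by apply: lt_le_trans h _; apply: ereal_inf_lbound; exists f.
Qed.

Lemma growth_number_ge0 Omega : (0 <= growth_number Omega)%E.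
Proof. by apply: le_ereal_inf_tmp => _ [b [b0 _] <-]; rewrite lee_fin ltW. Qed.

Lemma growth_number_le Omega beta : growth_exponent Omega beta ->
  (growth_number Omega <= beta%:E)%E.
Proof. by move=> H; apply: ereal_inf_lbound; exists beta. Qed.

Lemma growth_number_lt Omega (x : R) : (growth_number Omega < x%:E)%E ->
  exists2 beta, growth_exponent Omega beta & beta < x.
Proof. by move=> /ereal_inf_lt[_ [b Hb <-]]; rewrite lte_fin; exists b. Qed.

Lemma lte_dense (x : R) (y : \bar R) : (x%:E < y)%E -> exists2 c : R, x < c & (c%:E < y)%E.
Proof.
case: y => [y| |]//; last by exists (x + 1); [lra|rewrite ltry].
by rewrite lte_fin => h; exists ((x + y) / 2); rewrite ?lte_fin; lra.
Qed.

Lemma growth_eq0 Omega : growth_number Omega = 0%E <-> bergman_number Omega = +oo%E.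
Proof.
split=> H.
  apply/eqyP => c c0; have : (growth_number Omega < (c^-1)%:E)%E by rewrite H lte_fin invr_gt0.
  move=> /growth_number_lt[b Hb bc]; apply: le_trans (bergman_ge Hb); rewrite lee_fin.
  by case: Hb => b0 _; rewrite -[c]invrK lef_pV2 ?posrE ?invr_gt0// ltW.
apply/le_anti; rewrite growth_number_ge0 andbT; apply/lee_addgt0Pr => e e0; rewrite add0e.
rewrite -[e]invrK; apply: growth_number_le; apply: growth_exponent_bergman.
  by rewrite invr_gt0.
by rewrite H ltry.
Qed.

Lemma growth_eqy Omega : growth_number Omega = +oo%E <-> bergman_number Omega = 0%E.
Proof.
split=> H; apply/eqP.
  rewrite eq_le bergman_number_ge0 andbT leNgt; apply/negP => /lte_dense[c c0 cb].
  have := growth_number_le (growth_exponent_bergman c0 cb).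
  by rewrite H leNgt ltry.
rewrite eq_le leey/= leNgt; apply/negP => gy.
have [x gx] : exists x : R, (growth_number Omega < x%:E)%E.
  move: gy (growth_number_ge0 Omega); case: (growth_number Omega) => // r _ _.
  by exists (r + 1); rewrite lte_fin; lra.
have [b Hb _] := growth_number_lt gx.
have := bergman_ge Hb; rewrite H lee_fin; case: Hb => b0 _.
by rewrite leNgt invr_gt0 b0.
Qed.

Lemma growth_mul_bergman Omega : (0 < growth_number Omega < +oo)%E ->
  (growth_number Omega * bergman_number Omega = 1)%E.
Proof.
move=> /andP[]; case E : (growth_number Omega) => [g| |]//; rewrite lte_fin => g0 _.
suff -> : bergman_number Omega = (g^-1)%:E by rewrite -EFinM divff// gt_eqF.
apply/eqP; rewrite eq_le; apply/andP; split; rewrite leNgt; apply/negP.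
  move=> /lte_dense[c gc cb].
  have c0 : 0 < c by apply: lt_trans gc; rewrite invr_gt0.
  have := growth_number_le (growth_exponent_bergman c0 cb).
  by rewrite E lee_fin leNgt -[g]invrK ltf_pV2 ?posrE ?invr_gt0// gc.
move=> bg; have := bergman_number_ge0 Omega; move: bg.
case Eb : (bergman_number Omega) => [b| |]//; rewrite lte_fin lee_fin => bg b0.
(* [1 / x] is the midpoint of [b] and [1 / g]: thus [g < x], and any exponent [beta < x] has
   [1 / beta > b]. The formula also covers [b = 0]. *)
pose x := 2 / (b + g^-1).
have gi : 0 < g^-1 by rewrite invr_gt0.
have s0 : 0 < b + g^-1 by lra.
have gx : (growth_number Omega < x%:E)%E.
  by rewrite E lte_fin /x ltr_pdivlMr// mulrDr divff ?gt_eqF//; have := ltr_pM2l g0 b g^-1; rewrite bg divff ?gt_eqF//; lra.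
have [beta Hb bx] := growth_number_lt gx.
have := bergman_ge Hb; rewrite Eb lee_fin; case: Hb => beta0 _.
rewrite leNgt => /negP; apply.
have bs : beta * (b + g^-1) < 2 by rewrite -ltr_pdivlMr.
have bb : 0 < beta * (g^-1 - b) by rewrite mulr_gt0// subr_gt0.
rewrite -[beta^-1]mul1r ltr_pdivlMr//; lra.
Qed.

End GrowthBergman.

(** * Hyperbolic distance and growth of the covering map *)

Section HyperbolicDistance.
Variable R : realType.
Implicit Types (f h : Cplx R -> Cplx R) (a b z w : Cplx R) (c k r : R).
Implicit Types (Omega : set (Cplx R)).
Local Notation D := (@unit_disk R).

Lemma moebius_sym a b : cabs (moebius a b) = cabs (moebius b a).
Proof.
have E : 1 - a * (conjc b : Cplx R) = conjc (1 - b * (conjc a : Cplx R) : Cplx R).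
  by rewrite rmorphB rmorph1 rmorphM/= conjcK mulrC.
by rewrite /moebius !cabsM !cabsV cabsBC E cabs_conj.
Qed.

(** A change of base point alters [1 - |z|] only by bounded factors: in [moebius_sqr] the
    denominator stays between [1 - |a|] and 2. *)
Lemma moebius_bounds a : D a -> exists2 k, 0 < k & forall z, D z ->
  k * (1 - cabs z) <= 1 - cabs (moebius a z) /\
  k * (1 - cabs (moebius a z)) <= 1 - cabs z.
Proof.
rewrite /unit_disk/= => a1; pose x := 1 - cabs a; have x0 : 0 < x by rewrite subr_gt0.
have ax : cabs a = 1 - x by rewrite /x; ring.
have x1 : x <= 1 by rewrite gerBl cabs_ge0.
(* The 8 comes from [d ^+ 2 <= 4] and [1 - rho ^+ 2 <= 2 * (1 - rho)]; the reverse comparison needs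
   only [x ^+ 2 / 2]. *)
exists (x ^+ 2 / 8); first by rewrite divr_gt0// exprn_gt0.
move=> z; rewrite /unit_disk/= => z1.
have H := moebius_sqr a1 z1.
have r1 := moebius_lt1 a1 z1; have r0 := cabs_ge0 (moebius a z).
have z0 := cabs_ge0 z; set t := cabs z in z0 z1 H *.
set rho := cabs (moebius a z) in r0 r1 H *.
set d := cabs (1 - z * _) in H.
have da : cabs (z * (conjc a : Cplx R)) <= 1 - x.
  by rewrite cabsM cabs_conj ax; apply: ler_piMl; [lra|exact: ltW].
have d1 : x <= d.
  by have := cabsB 1 (z * (conjc a : Cplx R)); rewrite cabs1 -/d; lra.
have d2 : d <= 2.
  have := cabsD 1 (- (z * (conjc a : Cplx R))); rewrite cabs1 cabsN -/d; lra.
have dd : 0 < d ^+ 2 by rewrite exprn_gt0//; lra.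
have {}H : (1 - rho ^+ 2) * d ^+ 2 = (1 - (1 - x) ^+ 2) * (1 - t ^+ 2).
  by rewrite H -ax divfK// gt_eqF.
have d4 : d ^+ 2 <= 4 by nra.
have dx : x ^+ 2 <= d ^+ 2 by nra.
have p0 : 0 <= 1 - rho ^+ 2 by nra.
have p1 : 1 - rho <= 1 - rho ^+ 2 by nra.
have p2 : 1 - rho ^+ 2 <= 2 * (1 - rho) by nra.
have q1 : 1 - t <= 1 - t ^+ 2 by nra.
have q2 : 1 - t ^+ 2 <= 2 * (1 - t) by nra.
have y1 : x ^+ 2 <= 1 - (1 - x) ^+ 2 by nra.
have y2 : 1 - (1 - x) ^+ 2 <= 1 by nra.
have h1 : x ^+ 2 * (1 - t) <= (1 - (1 - x) ^+ 2) * (1 - t ^+ 2).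
  by apply: ler_pM => //; [exact: sqr_ge0|lra].
have h2 : (1 - (1 - x) ^+ 2) * (1 - t ^+ 2) <= 2 * (1 - t).
  by apply: le_trans q2; rewrite ler_piMl//; lra.
have h3 : (1 - rho ^+ 2) * d ^+ 2 <= 2 * (1 - rho) * 4.
  by apply: ler_pM => //; exact: ltW.
have h4 : x ^+ 2 * (1 - rho) <= (1 - rho ^+ 2) * d ^+ 2.
  by rewrite mulrC; apply: ler_pM => //; [lra|exact: sqr_ge0].
by split; lra.
Qed.

Lemma dist_diskE a z : dist_disk a z =
  ln ((1 + cabs (moebius z a)) / (1 - cabs (moebius z a))).
Proof. by []. Qed.

Lemma dist_disk_bounds a z : D a -> D z ->
  - ln (1 - cabs (moebius a z)) <= dist_disk a z <= ln 2 - ln (1 - cabs (moebius a z)).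
Proof.
move=> Da Dz; rewrite dist_diskE (moebius_sym z a).
have := moebius_lt1 Da Dz; have := cabs_ge0 (moebius a z); set rho := cabs _ => r0 r1.
have p0 : 0 < 1 - rho by lra.
have p1 : 0 < 1 + rho by lra.
rewrite ln_div ?posrE//; have l0 : 0 <= ln (1 + rho) by apply: ln_ge0; lra.
have l2 : ln (1 + rho) <= ln 2 by rewrite ler_ln ?posrE//; lra.
by lra.
Qed.

Lemma dist_disk_ge0 a z : D a -> D z -> 0 <= dist_disk a z.
Proof.
move=> Da Dz; have /andP[h _] := dist_disk_bounds Da Dz; apply: le_trans h.
have := moebius_lt1 Da Dz; have := cabs_ge0 (moebius a z); set rho := cabs _ => r0 r1.
by rewrite oppr_ge0; apply: ln_le0; lra.
Qed.

(** The numerator of the liminf is an infimum in the extended reals, so clearing the denominator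
    goes by cases. *)
Lemma lte_ediv (x : \bar R) c k : 0 < k -> (c%:E < x / k%:E)%E = ((c * k)%:E < x)%E.
Proof.
move=> k0; rewrite inver gt_eqF//; case: x => [x| |].
- by rewrite -EFinM !lte_fin ltr_pdivlMr.
- by rewrite gt0_mulye ?lte_fin ?invr_gt0// !ltry.
- by rewrite gt0_mulNye ?lte_fin ?invr_gt0// !ltNge !leNye.
Qed.

Lemma lee_ediv (x : \bar R) c k : 0 < k -> (c%:E <= x / k%:E)%E = ((c * k)%:E <= x)%E.
Proof.
move=> k0; rewrite inver gt_eqF//; case: x => [x| |].
- by rewrite -EFinM !lee_fin ler_pdivlMr.
- by rewrite gt0_mulye ?lte_fin ?invr_gt0// !leey.
- by rewrite gt0_mulNye ?lte_fin ?invr_gt0// !leNgt !ltNyr.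
Qed.

Section Liminf.
Variables (Omega : set (Cplx R)) (f : Cplx R -> Cplx R).
Local Notation dist0 r := (dist_cover_set f 0 (circle_in Omega r)).
Local Notation L := (limf_einf (fun r => (dist0 r / (ln r)%:E)%E) (pinfty_nbhs R)).

Lemma liminf_gt c : (c%:E < L)%E ->
  exists2 M, 1 <= M & forall r, M < r -> ((c * ln r)%:E < dist0 r)%E.
Proof.
rewrite limf_einfE => /ereal_sup_gt[_ [V [M [_ HM]] <-] cV].
(* Beyond 1 the logarithm is positive and may be cleared from the denominator. *)
exists (Num.max 1 M); first by rewrite le_max lexx.
move=> r; rewrite gt_max => /andP[r1 rM].
rewrite -lte_ediv; last exact: ln_gt0.
by apply: lt_le_trans cV _; apply: ereal_inf_lbound; exists r => //; exact: HM.
Qed.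

Lemma liminf_ge c M : (forall r, M < r -> ((c * ln r)%:E <= dist0 r)%E) -> (c%:E <= L)%E.
Proof.
move=> H; rewrite limf_einfE; pose M' := Num.max 1 M.
apply: (@le_trans _ _ (ereal_inf [set (dist0 r / (ln r)%:E)%E | r in [set r | M' < r]])).
  apply: le_ereal_inf_tmp => _ [r /= + <-]; rewrite gt_max => /andP[r1 rM].
  by rewrite lee_ediv; [exact: H|exact: ln_gt0].
apply: ereal_sup_ubound; exists [set r | M' < r] => //.
by exists M'; split; [exact: num_real|].
Qed.

Lemma dist0_ge c r : (forall a b, D a -> D b -> f a = 0 -> cabs (f b) = r -> c <= dist_disk a b) ->
  (c%:E <= dist0 r)%E.
Proof.
move=> H; apply: le_ereal_inf_tmp => _ [w [_ wr] <-].
apply: le_ereal_inf_tmp => _ [[a b] [/= Da Db fa fb] <-]; rewrite lee_fin.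
by apply: H => //; rewrite fb.
Qed.

Lemma dist0_le a b : set_fun D Omega f -> D a -> D b -> f a = 0 ->
  (dist0 (cabs (f b)) <= (dist_disk a b)%:E)%E.
Proof.
move=> fO Da Db fa.
apply: (@le_trans _ _ (dist_cover f 0 (f b))).
  by apply: ereal_inf_lbound; exists (f b) => //; split => //; exact: fO.
by apply: ereal_inf_lbound; exists (a, b).
Qed.

Lemma liminf_ge0 : (0%:E <= L)%E.
Proof.
apply: (@liminf_ge 0 0) => r _; rewrite mul0r; apply: dist0_ge => a b Da Db _ _.
exact: dist_disk_ge0.
Qed.

Hypotheses (cover : universal_covering Omega f) (Omega0 : Omega 0).

Lemma preimage w : Omega w -> exists2 a, D a & f a = w.
Proof. by case: cover => _ [_ E _]; rewrite -E => -[a Da fa]; exists a. Qed.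

(** Where [|f z|] is large, [c ln |f z|] is below the distance from a point over 0, hence below
    [ln (2 / (k (1 - |z|)))]; exponentiating gives the growth bound. Where [|f z| <= M], the weight
    is at most 1. *)
Lemma liminf_covering c : 0 < c -> (c%:E < L)%E -> Hinf c^-1 f.
Proof.
move=> c0 /liminf_gt[M M1 HM]; have [[hf fO] _] := cover.
have [a0 Da fa] := preimage Omega0; have [k k0 Hk] := moebius_bounds Da.
have ci : 0 <= c^-1 by rewrite invr_ge0 ltW.
apply/HinfP; split => //; exists (Num.max M ((2 / k) `^ c^-1)) => z Dz.
have /andP[z0 z1] := disk_pos Dz; have f0 := cabs_ge0 (f z).
rewrite le_max /weight; apply/orP; have [rM|rM] := leP (cabs (f z)) M.
  left; rewrite -[M]mulr1; apply: ler_pM => //; first exact: powR_ge0.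
  by rewrite -[leRHS](powRr0 (1 - cabs z)); apply: ger_powR; rewrite ?z0.
right; have := lt_le_trans (HM _ rM) (dist0_le fO Da Dz fa); rewrite lte_fin.
have [+ _] := Hk z Dz; have /andP[_] := dist_disk_bounds Da Dz.
set rho := cabs (moebius _ _); set r := cabs (f z) in f0 rM * => h1 h2 h3.
have r0 : 0 < r by lra.
have kz : 0 < k * (1 - cabs z) by rewrite mulr_gt0.
have rho0 : 0 < 1 - rho by lra.
have h4 : ln (r `^ c) <= ln (2 / (k * (1 - cabs z))).
  rewrite ln_powR ln_div ?posrE//.
  have : ln (k * (1 - cabs z)) <= ln (1 - rho) by rewrite ler_ln ?posrE.
  by lra.
rewrite ler_ln ?posrE ?powR_gt0 ?divr_gt0// in h4.
have h5 : r `^ c * (1 - cabs z) <= 2 / k.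
  by rewrite -ler_pdivlMr// -mulrA -invfM.
have -> : r * (1 - cabs z) `^ c^-1 = (r `^ c * (1 - cabs z)) `^ c^-1.
  by rewrite powRM ?powR_ge0 ?(ltW z0)// -powRrM divff ?gt_eqF// powRr1.
apply: ge0_ler_powR => //; rewrite nnegrE; last by rewrite divr_ge0// ltW.
by rewrite mulr_ge0 ?powR_ge0// ltW.
Qed.

(* Subordination: every [h] with values in [Omega] factors through the covering map. *)
Lemma covering_growth_exponent beta : 0 < beta -> Hinf beta f -> growth_exponent Omega beta.
Proof.
move=> b0 /HinfP[hf [C HC]]; split; [exact: b0|move=> h Hh]; have [hh hO] := Hh.
have [a Da fa] := preimage (hO _ (@disk0 R)).
have [phi [dphi Dphi phi0 fphi]] := holomorphic_lift cover Hh Da fa.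
have [k k0 Hk] := moebius_bounds Da.
apply/HinfP; split => //; exists (C * k^-1 `^ beta) => z Dz.
have /andP[z0 z1] := disk_pos Dz; have /andP[p0 p1] := disk_pos (Dphi z Dz).
(* Schwarz-Pick from the base point 0, whose image is [a], followed by the change of base point from
   [a] to 0. *)
have le_phi : 1 - cabs z <= k^-1 * (1 - cabs (phi z)).
  have [_ h1] := Hk _ (Dphi z Dz).
  have := schwarz_pick dphi Dphi (@disk0 R) Dz.
  have -> : moebius 0 z = z by rewrite /moebius conjc0 mulr0 !subr0 divr1.
  rewrite phi0 => h2; rewrite mulrC ler_pdivlMr// mulrC; apply: le_trans h1.
  by rewrite ler_pM2l//; lra.
rewrite -fphi//; apply: (@le_trans _ _ (cabs (f (phi z)) * (k^-1 `^ beta * weight beta (phi z)))).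
  apply: ler_wpM2l; first exact: cabs_ge0.
  rewrite /weight -powRM ?invr_ge0 ?(ltW k0) ?(ltW p0)//.
  by apply: ge0_ler_powR; rewrite ?nnegrE ?(ltW b0) ?(ltW z0)// mulr_ge0 ?invr_ge0 ?(ltW k0) ?(ltW p0).
rewrite mulrCA mulrC; apply: ler_wpM2r; first exact: powR_ge0.
exact: HC (Dphi z Dz).
Qed.

(* The infimum over all points of the fibre of 0 is reduced to one base point
   by lifting [f \o moebius (- a)], again with Schwarz-Pick. *)
Lemma growth_exponent_dist c : 0 < c -> growth_exponent Omega c^-1 ->
  exists K, forall a b, D a -> D b -> f a = 0 -> 0 < cabs (f b) ->
    c * ln (cabs (f b)) - K <= dist_disk a b.
Proof.
move=> c0 [_ Hg]; have [[hf fO] _] := cover.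
have /HinfP[_ [C HC]] := Hg _ (conj hf fO).
have [a0 Da0 fa0] := preimage Omega0; have [k k0 Hk] := moebius_bounds Da0.
exists (c * ln (Num.max C 1) - ln k) => a b Da Db fa fb.
have Dna : D (- a) by rewrite /unit_disk/= cabsN.
pose h z := f (moebius (- a) z).
have Hh : Hol Omega h.
  split=> z Dz; last exact: fO (moebius_lt1 Dna Dz).
  exact (dC_comp (dC_moebius Dna Dz) (hf _ (moebius_lt1 Dna Dz))).
have h0 : f a0 = h 0.
  by rewrite fa0 /h /moebius mul0r subr0 divr1 opprK add0r fa.
have [phi [dphi Dphi phi0 fphi]] := holomorphic_lift cover Hh Da0 h0.
have Dw : D (moebius a b) by exact: moebius_lt1.
(* [b'] lies over [f b] and is no farther from the fixed [a0] than [b] is from [a], so the constant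
   [K] does not depend on [a]. *)
set b' := phi (moebius a b); have Db' : D b' by exact: Dphi.
have fb' : f b' = f b by rewrite fphi// /h moebiusK.
have sp : cabs (moebius a0 b') <= cabs (moebius a b).
  have := schwarz_pick dphi Dphi (@disk0 R) Dw; rewrite phi0 -/b'.
  have -> // : moebius 0 (moebius a b) = moebius a b.
  by rewrite [LHS]/moebius conjc0 mulr0 !subr0 divr1.
have /andP[d1 _] := dist_disk_bounds Da Db; have [_ h1] := Hk _ Db'.
have /andP[p0 _] := disk_pos Db'.
have := HC _ Db'; rewrite fb' /weight => h2.
set s := cabs (f b) in fb h2 *; set t := 1 - cabs b' in h1 p0 h2.
have l1 : ln s + c^-1 * ln t <= ln (Num.max C 1).
  rewrite -ln_powR -lnM ?posrE ?powR_gt0// ler_ln ?posrE ?mulr_gt0 ?powR_gt0//.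
    by rewrite le_max h2.
  by rewrite lt_max ltr01 orbT.
have r1 : 0 < 1 - cabs (moebius a b) by rewrite subr_gt0.
have l2 : ln k + ln (1 - cabs (moebius a b)) <= ln t.
  rewrite -lnM ?posrE// ler_ln ?posrE ?mulr_gt0//; apply: le_trans h1.
  by rewrite ler_pM2l//; lra.
have l3 : c * ln s + ln t <= c * ln (Num.max C 1).
  have -> : c * ln s + ln t = c * (ln s + c^-1 * ln t).
    by rewrite mulrDr mulrA divff ?gt_eqF// mul1r.
  by rewrite ler_pM2l.
by lra.
Qed.

(** The additive constant [K] is absorbed by [(c - c') * ln r] as soon as [r] exceeds
    [expR (K / (c - c'))]. *)
Lemma growth_exponent_liminf c c' : 0 < c -> c' < c -> growth_exponent Omega c^-1 ->
  (c'%:E <= L)%E.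
Proof.
move=> c0 cc /(growth_exponent_dist c0)[K HK].
have d0 : 0 < c - c' by rewrite subr_gt0.
apply: (@liminf_ge _ (expR (K / (c - c')))) => r rM.
have r0 : 0 < r by apply: lt_trans rM; exact: expR_gt0.
have lr : K <= (c - c') * ln r.
  rewrite mulrC -ler_pdivrMr// -(expRK (K / _)) ler_ln ?posrE ?expR_gt0//; exact: ltW.
apply: dist0_ge => a b Da Db fa fb.
by have := HK a b Da Db fa; rewrite fb => /(_ r0); lra.
Qed.

Lemma bergman_liminf : bergman_number Omega = L.
Proof.
apply/eqP; rewrite eq_le; apply/andP; split; rewrite leNgt; apply/negP.
  (* Two constants [c' < c] are inserted between the sides, because passing from a growth exponent
     to the liminf loses a little. *)
  move=> LB; have : exists2 c' : R, 0 < c' & ((L < c'%:E)%E /\ (c'%:E < bergman_number Omega)%E).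
    have : (L < bergman_number Omega)%E := LB.
    have := liminf_ge0; case: L => [l| |]// l0.
      rewrite lee_fin in l0 => /lte_dense[x lx xb]; exists x; last by rewrite lte_fin.
      exact: le_lt_trans lx.
    by rewrite ltNge leey.
  move=> [c' c'0 [Lc /lte_dense[c cc cb]]]; have c0 := lt_trans c'0 cc.
  have := growth_exponent_liminf c0 cc (growth_exponent_bergman c0 cb).
  by rewrite leNgt Lc.
move=> BL; have := bergman_number_ge0 Omega; case E : (bergman_number Omega) => [x| |]//.
  rewrite lee_fin => x0; rewrite E in BL; have [c xc cL] := lte_dense BL.
  have c0 := le_lt_trans x0 xc; have ci : 0 < c^-1 by rewrite invr_gt0.
  have := bergman_ge (covering_growth_exponent ci (liminf_covering c0 cL)).
  by rewrite invrK E lee_fin leNgt xc.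
by move: BL; rewrite E ltNge leey.
Qed.

End Liminf.
End HyperbolicDistance.

Theorem theorem1p2 (R : realType) (Omega : set (Cplx R)) (hOmega : domain Omega) :
  [/\ growth_number Omega = 0%E <-> bergman_number Omega = +oo%E,
      growth_number Omega = +oo%E <-> bergman_number Omega = 0%E,
      (0 < growth_number Omega < +oo)%E ->
        (growth_number Omega * bergman_number Omega = 1)%E &
      hyperbolic Omega -> ~ bounded_set Omega -> Omega 0 ->
      forall f_Omega : Cplx R -> Cplx R, universal_covering Omega f_Omega ->
        bergman_number Omega =
        limf_einf (fun r : R =>
          (dist_cover_set f_Omega 0%R (circle_in Omega r) / (ln r)%:E)%E)
          (pinfty_nbhs R)].
Proof.
split; [exact: growth_eq0|exact: growth_eqy|exact: growth_mul_bergman|].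
by move=> _ _ Omega0 f cover; exact: bergman_liminf.
Qed.
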